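(* $c^{\mathrm{np}}\le 4.735820221\ldots$ (in particular $c^{\mathrm{np}}<4.735820222$), where $$c^{\mathrm{np}}=\lim_{n\to\infty}\frac{\log_2 f^{\mathrm{np}}(n,n)}{n^2}$$ and $f^{\mathrm{np}}(m,n)$ is the number of all (not necessarily primitive) lattice triangulations of the $m\times n$ rectangle.
   Context: A lattice triangulation of the rectangle $[0,m]\times[0,n]$ ($m,n$ positive integers) is a triangulation of it with all vertices in $\mathbb Z^2$; not every lattice point of the rectangle has to be a vertex. *)

(* Defs.v *)
From HB Require Import structures.
From mathcomp Require Import all_boot all_order all_algebra.
From mathcomp Require Import all_classical all_reals all_analysis.

Set Implicit Arguments.
Unset Strict Implicit.
Unset Printing Implicit Defensive.

Import Order.TTheory GRing.Theory Num.Theory.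
Import numFieldNormedType.Exports.

Local Open Scope classical_set_scope.
Local Open Scope ring_scope.

(* The points of Z^2 lying in the rectangle [0,m] x [0,n]. *)
Definition lattice_point (m n : nat) : finType := ('I_m.+1 * 'I_n.+1)%type.

Section LatticeTriangulation.
Variables (R : realType) (m n : nat).
Implicit Types (A : {set lattice_point m n}) (T : {set {set lattice_point m n}}).

Definition rectangle : set (R * R) :=
  [set x | 0 <= x.1 <= m%:R /\ 0 <= x.2 <= n%:R].

(* The convex hull, in the real plane, of a finite set of lattice points. *)
Definition hull A : set (R * R) :=
  [set x | exists w : lattice_point m n -> R,
    [/\ forall p, p \in A -> 0 <= w p,
        \sum_(p in A) w p = 1,
        x.1 = \sum_(p in A) w p * (p.1 : nat)%:R &
        x.2 = \sum_(p in A) w p * (p.2 : nat)%:R]].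

Definition affinely_independent A : Prop :=
  forall w : lattice_point m n -> R,
    \sum_(p in A) w p = 0 ->
    \sum_(p in A) w p * (p.1 : nat)%:R = 0 ->
    \sum_(p in A) w p * (p.2 : nat)%:R = 0 ->
    forall p, p \in A -> w p = 0.

(* A triangle is represented by its set of vertices. *)
Definition is_triangle A : Prop := #|A| = 3%N /\ affinely_independent A.

(* A triangulation is represented by its set of (two-dimensional) triangles;
   the last condition says that any two of them meet in a common face, possibly
   empty, so that gluings which are not edge-to-edge are excluded.
   Neither primitivity nor the use of all lattice points is required. *)
Definition is_lattice_triangulation T : Prop :=
  [/\ forall A, A \in T -> is_triangle A,
      \bigcup_(A in [set A | A \in T]) hull A = rectangle &
      forall A B, A \in T -> B \in T -> hull A `&` hull B = hull (A :&: B)].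

Definition fnp : nat :=
  #|[pred T : {set {set lattice_point m n}} | `[< is_lattice_triangulation T >]]|.

End LatticeTriangulation.

Definition log2 (R : realType) (x : R) : R := ln x / ln 2.

(* The value at n = 0 is a division by zero, irrelevant for the limit. *)
Definition np_capacity_seq (R : realType) : R^nat :=
  fun n => log2 (fnp R n n)%:R / n%:R ^+ 2.

Definition cnp (R : realType) : R := limn (np_capacity_seq R).

(* The real number with decimal expansion a.bcd, for three-digit blocks b, c, d;
   split because numerals denote unary natural numbers. *)
Definition decimal9 (R : realType) (a b c d : nat) : R :=
  a%:R + b%:R / 10 ^+ 3 + c%:R / 10 ^+ 6 + d%:R / 10 ^+ 9.

(* Main.v *)
(* Counting. Inserting an unused lattice point [p] stellarly, i.e. coning it off
   over the star of the face containing it, is at most two-to-one on the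
   triangulations avoiding [p].  Summing over the sets of unused points,
     f(m,n) <= 3^((m+1)(n+1)) * F(m,n),
   where [F] counts the triangulations using every lattice point.  The triangles of
   such a triangulation are unimodular, so that each half-integral point which is
   not integral is the midpoint of exactly one edge.  Scanning these midpoints in a
   generic direction, the edges already found leave at most two choices for the
   next one (Anclin), hence F(n,n) <= 2^(3n^2+O(n)).  Altogether f has capacity at
   most 3 + log2 3 < 4.6.

   Existence of the limit. Call the set of vertices on the left (right) side of the
   rectangle its left (right) type.  Some pair of types is shared by at least
   f(m,n) / 4^(n+1) triangulations; k of these can be glued side by side, every
   second one being reflected, and a last piece of any width can be added since
   every left type is realized.  So f(m,n)^k <= 4^((n+1)k) f(km+r,n), and using this
   in both directions gives a Fekete-type inequality for log2 f(n,n) / n^2. *)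
Require Import Defs.
From mathcomp Require Import all_boot all_order all_algebra.
From mathcomp Require Import all_classical all_reals all_analysis.
From mathcomp Require Import ring lra zify.
Set Implicit Arguments.
Unset Strict Implicit.
Unset Printing Implicit Defensive.
Import mathcomp.boot.fintype mathcomp.boot.finset Order.TTheory GRing.Theory Num.Theory.
Import numFieldNormedType.Exports.
Local Open Scope ring_scope.

(** * Convex hulls of lattice points *)

(** A triangulation is given only by hulls and common faces, so incidences come from two tools: the
    barycentric weights of a point are the same in every triangle containing it, and some triangle
    contains the beginning of any given segment. Both bounds of two are proved in the form: among
    any three elements of a fibre, two coincide. In the scan, suppose that three distinct edges
    share their midpoint and all that precedes it. For any two of them, the lowest of their ends
    spans with the other edge a unimodular triangle, so the two directions have determinant 2 or -2.
    The linear relation between three plane vectors then becomes one with coefficients 1 or -1, and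
    parity makes the midpoint integral. The hard part is to find that triangle, because the two
    edges belong to different triangulations that share only the earlier edges. Every left type
    containing both corners is realized because stellar insertion adds any set of points to the
    triangulation with two triangles. A crude constant suffices: 3^5 < 2^8 gives log2 3 <= 8/5,
    hence 3 + 8/5 = 23/5. *)

Lemma leq_card_fibers2 (T U : finType) (A : {set T}) (f : T -> U) :
  (forall x y z, x \in A -> y \in A -> z \in A -> f x = f y -> f y = f z ->
     [\/ x = y, y = z | z = x]) ->
  (#|A| <= 2 * #|f @: A|)%N.
Proof.
move=> fib2; rewrite -sum1_card (partition_big_imset f) /=.
rewrite mulnC -sum_nat_const; apply: leq_sum => u _.
rewrite sum1dep_card leqNgt; apply/negP => /card_gt2P[x [y [z]]].
rewrite !inE => -[[/andP[xA /eqP fx] /andP[yA /eqP fy] /andP[zA /eqP fz]]].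
move=> [/eqP xy /eqP yz /eqP zx].
by case: (fib2 x y z) => //; congruence.
Qed.

Lemma sum_mulr1 (R : realType) (I : finType) (P : pred I) (F : I -> R) :
  \sum_(i | P i) F i * 1 = \sum_(i | P i) F i.
Proof. by apply: eq_bigr => i _; rewrite mulr1. Qed.

Section Barycentric.
Variables (R : realType) (m n : nat).
Local Notation point := (lattice_point m n).
Implicit Types (A B : {set point}) (T : {set {set point}}) (x y : R * R)
  (w v : point -> R) (p q : point).

Definition coord p : R * R := ((p.1 : nat)%:R, (p.2 : nat)%:R).

(** The weights live on all lattice points and vanish off [A], whereas the witness in [hull] is
    arbitrary there. Weights for different sets can thus be compared as functions. *)
Definition bary A x w : Prop :=
  [/\ forall p, 0 <= w p, forall p, p \notin A -> w p = 0,
      \sum_p w p = 1, x.1 = \sum_p w p * (p.1 : nat)%:R &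
      x.2 = \sum_p w p * (p.2 : nat)%:R].

Lemma sum_supported A w (f : point -> R) :
  (forall p, p \notin A -> w p = 0) ->
  \sum_p w p * f p = \sum_(p in A) w p * f p.
Proof.
move=> w0; rewrite [RHS]big_mkcond /=; apply: eq_bigr => p _.
by case: ifPn => // /w0 ->; rewrite mul0r.
Qed.

Lemma sum_supported1 A w :
  (forall p, p \notin A -> w p = 0) -> \sum_p w p = \sum_(p in A) w p.
Proof.
move=> w0; rewrite [RHS]big_mkcond /=; apply: eq_bigr => p _.
by case: ifPn => // /w0 ->.
Qed.

Lemma hullP A x : hull A x <-> exists w, bary A x w.
Proof.
split=> [[w [w0 w1 wx wy]]|[w [w0 wA w1 wx wy]]]; last first.
  by exists w; split=> //; rewrite -?(sum_supported _ wA) -?(sum_supported1 wA).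
have eqA (f : point -> R) : \sum_(p in A) w p * f p =
    \sum_p (if p \in A then w p else 0) * f p.
  by rewrite big_mkcond /=; apply: eq_bigr => p _; case: ifP; rewrite ?mul0r.
exists (fun p => if p \in A then w p else 0); split=> [p|p /negPf -> //|||].
- by case: ifP => // /w0.
- by rewrite -big_mkcond.
- by rewrite -eqA.
- by rewrite -eqA.
Qed.

Lemma bary_hull A x w : bary A x w -> hull A x.
Proof. by move=> b; apply/hullP; exists w. Qed.

Lemma bary_sub A B x w : A \subset B -> bary A x w -> bary B x w.
Proof.
move=> /subsetP sAB [w0 wA w1 wx wy]; split=> // p pB.
by apply: wA; apply: contra pB => /sAB.
Qed.

Lemma hull_sub A B x : A \subset B -> hull A x -> hull B x.
Proof. by move=> sAB /hullP[w /(bary_sub sAB)/bary_hull]. Qed.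

Lemma bary_cap A B x w : bary A x w -> bary B x w -> bary (A :&: B) x w.
Proof.
move=> [w0 wA w1 wx wy] [_ wB _ _ _]; split=> // p.
by rewrite inE negb_and => /orP[/wA|/wB].
Qed.

Lemma bary_uniq A x w v : affinely_independent R A ->
  bary A x w -> bary A x v -> w =1 v.
Proof.
move=> iA [_ wA w1 wx wy] [_ vA v1 vx vy] p.
pose d q := w q - v q.
have dA q : q \notin A -> d q = 0 by move=> qA; rewrite /d wA // vA // subrr.
have dE (f : point -> R) :
    \sum_(q in A) d q * f q = \sum_q w q * f q - \sum_q v q * f q.
  by rewrite -sum_supported // -sumrB; apply: eq_bigr => q _; rewrite mulrBl.
apply/eqP; rewrite -subr_eq0 -/(d p); apply/eqP.
case: (boolP (p \in A)) => [pA|/dA //]; apply: (iA d) => //.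
- by rewrite -sum_supported1 // sumrB w1 v1 subrr.
- by rewrite dE -wx -vx subrr.
- by rewrite dE -wy -vy subrr.
Qed.

Lemma bary_vertex A p : p \in A -> bary A (coord p) (fun q => (q == p)%:R).
Proof.
move=> pA; have sE (f : point -> R) : \sum_q (q == p)%:R * f q = f p.
  rewrite (bigD1 p) //= eqxx mul1r big1 ?addr0 // => q /negPf ->.
  by rewrite mul0r.
split=> [q|q qA||/=|/=]; rewrite ?sE ?ler0n //.
- by case: eqP qA => // ->; rewrite pA.
- by rewrite -[RHS](sE (fun=> 1)); apply: eq_bigr => q _; rewrite mulr1.
Qed.

Lemma hull_vertex A p : p \in A -> hull A (coord p).
Proof. by move=> /bary_vertex/bary_hull. Qed.

Lemma bary_nonempty A x w : bary A x w -> exists2 p, p \in A & 0 < w p.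
Proof.
move=> [w0 wA w1 _ _]; have [p /andP[pA wp]|no] := pickP [pred p | (p \in A) && (0 < w p)].
  by exists p.
have : \sum_p w p = 0.
  rewrite big1 // => p _; have [pA|/wA //] := boolP (p \in A).
  by have /= := no p; rewrite pA /= lt_def w0 andbT => /negbFE/eqP.
by rewrite w1 => /eqP; rewrite oner_eq0.
Qed.

Definition affine_fun (c0 c1 c2 : R) x := c0 + c1 * x.1 + c2 * x.2.

Lemma bary_affine A x w c0 c1 c2 : bary A x w ->
  affine_fun c0 c1 c2 x = \sum_p w p * affine_fun c0 c1 c2 (coord p).
Proof.
move=> [_ _ w1 wx wy]; rewrite /affine_fun wx wy /=.
under [RHS]eq_bigr do rewrite !mulrDr.
rewrite !big_split /=; congr (_ + _ + _).
- by rewrite -mulr_suml w1 mul1r.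
- by rewrite mulr_sumr; apply: eq_bigr => p _; ring.
- by rewrite mulr_sumr; apply: eq_bigr => p _; ring.
Qed.

Definition lerp (t : R) x y : R * R :=
  (x.1 + t * (y.1 - x.1), x.2 + t * (y.2 - x.2)).

Lemma bary_lerp A t x y w v : 0 <= t <= 1 -> bary A x w -> bary A y v ->
  bary A (lerp t x y) (fun p => w p + t * (v p - w p)).
Proof.
move=> /andP[t0 t1] [w0 wA w1 wx wy] [v0 vA v1 vx vy].
have sE (f : point -> R) : \sum_p (w p + t * (v p - w p)) * f p =
    \sum_p w p * f p + t * (\sum_p v p * f p - \sum_p w p * f p).
  rewrite mulrBr !mulr_sumr -sumrB -big_split /=; apply: eq_bigr => p _; ring.
split=> [p|p pA|||].
- have -> : w p + t * (v p - w p) = (1 - t) * w p + t * v p by ring.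
  by rewrite addr_ge0 // mulr_ge0 // ?subr_ge0.
- by rewrite wA // vA // subrr mulr0 addr0.
- have := sE (fun=> 1); under eq_bigr do rewrite mulr1; move=> ->.
  under eq_bigr do rewrite mulr1; rewrite w1.
  by under eq_bigr do rewrite mulr1; rewrite v1; ring.
- by rewrite sE -wx -vx.
- by rewrite sE -wy -vy.
Qed.

Lemma hull_lerp A t x y : 0 <= t <= 1 -> hull A x -> hull A y ->
  hull A (lerp t x y).
Proof.
by move=> t01 /hullP[w bw] /hullP[v bv]; apply: bary_hull (bary_lerp t01 bw bv).
Qed.

Lemma hull_rect A x : hull A x -> @rectangle R m n x.
Proof.
move=> /hullP[w [w0 _ w1 wx wy]]; rewrite /rectangle /= wx wy.
have key (f : point -> nat) k : (forall p, f p <= k)%N ->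
    0 <= \sum_p w p * (f p)%:R <= k%:R.
  move=> fk; rewrite sumr_ge0 //=; last by move=> p _; rewrite mulr_ge0.
  have -> : k%:R = \sum_p w p * k%:R by rewrite -mulr_suml w1 mul1r.
  apply: ler_sum => p _.
  by apply: ler_wpM2l; [exact: w0|rewrite ler_nat; exact: fk].
by split; apply: key => p; rewrite -ltnS.
Qed.

Lemma coord_inj : injective coord.
Proof.
move=> [a b] [c d] [/eqP + /eqP]; rewrite !eqr_nat => /eqP/val_inj -> /eqP.
by move/val_inj ->.
Qed.

Lemma hull1 p x : hull [set p] x <-> x = coord p.
Proof.
split=> [[w [_]]|->]; last by apply: hull_vertex; rewrite set11.
rewrite !big_set1 => ->; rewrite !mul1r => ex ey.
by rewrite (surjective_pairing x) ex ey.
Qed.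

Lemma bary_restrict A B x w : bary A x w ->
  (forall p, p \notin B -> w p = 0) -> bary B x w.
Proof. by move=> [w0 _ w1 wx wy] wB. Qed.

Lemma bary_coord_unused A p w : p \notin A -> bary A (coord p) w ->
  forall q, exists2 z, z != q & 0 < w z.
Proof.
move=> pA bw q; have [z /andP[zq wz]|no] := pickP [pred z | (z != q) && (0 < w z)].
  by exists z.
have [w0 wA _ _ _] := bw.
have wq z : z \notin [set q] -> w z = 0.
  rewrite inE => zq; have := no z; rewrite /= zq lt_def w0 andbT.
  by move/negbFE/eqP.
have /bary_hull/hull1/coord_inj pq := bary_restrict bw wq.
have [z zA wz] := bary_nonempty bw.
have zq : z \notin [set q] by rewrite inE -pq; apply: contraNneq pA => <-.
by move: wz; rewrite wq // ltxx.
Qed.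

End Barycentric.

(** * Stellar subdivision *)

Section Triangulation.
Variables (R : realType) (m n : nat) (T : {set {set lattice_point m n}}).
Hypothesis triT : is_lattice_triangulation R T.
Local Notation point := (lattice_point m n).
Implicit Types (A B : {set point}) (x y : R * R) (w v : point -> R) (p q : point).

Lemma tri_indep A : A \in T -> affinely_independent R A.
Proof. by case: triT => h _ _ /h []. Qed.

Lemma tri_card A : A \in T -> #|A| = 3%N.
Proof. by case: triT => h _ _ /h []. Qed.

Lemma tri_cover x : @rectangle R m n x -> exists2 A, A \in T & hull A x.
Proof. by case: triT => _ <- _ [A /= AT Ax]; exists A. Qed.

(** The common face condition gives weights of [x] supported on the intersection of [A] and [B]; by
    affine independence they agree with [w] in [A] and with [v] in [B]. *)
Lemma tri_bary_uniq A B x w v : A \in T -> B \in T ->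
  bary A x w -> bary B x v -> w =1 v.
Proof.
move=> AT BT bw bv; have [_ _ /(_ A B AT BT) cap] := triT.
have : (hull A `&` hull B)%classic x by split; apply: bary_hull; eassumption.
rewrite cap => /hullP[u bu] p.
rewrite (bary_uniq (tri_indep AT) bw (bary_sub (subsetIl _ _) bu)).
by rewrite (bary_uniq (tri_indep BT) bv (bary_sub (subsetIr _ _) bu)).
Qed.

Lemma tri_face A B (X Y : {set point}) x : A \in T -> B \in T ->
  X \subset A -> Y \subset B -> hull X x -> hull Y x -> hull (X :&: Y) x.
Proof.
move=> AT BT XA YB /hullP[w bw] /hullP[v bv]; apply: bary_hull (bary_cap bw _).
apply: (bary_restrict bw) => p pY.
rewrite (tri_bary_uniq AT BT (bary_sub XA bw) (bary_sub YB bv)).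
by case: bv => _ ->.
Qed.

Lemma coord_rect p : @rectangle R m n (coord R p).
Proof. by rewrite /rectangle /= !ler0n !ler_nat !leq_ord. Qed.

Lemma tri_vertex A p : A \in T -> p \in cover T -> hull A (coord R p) -> p \in A.
Proof.
move=> AT /bigcupP[B BT pB] /hullP[w bw].
have /(tri_bary_uniq AT BT bw)/(_ p) := bary_vertex R pB.
rewrite eqxx => wp; have [_ wA _ _ _] := bw.
by apply: contraT => /wA /eqP; rewrite wp oner_eq0.
Qed.

End Triangulation.

Section Stellar.
Variables (R : realType) (m n : nat).
Local Notation point := (lattice_point m n).
Implicit Types (A B : {set point}) (T : {set {set point}}) (x y : R * R)
  (w v : point -> R) (p q z : point).

(** Substituting the expression of [p] turns a relation on the new vertices into a relation on [A]
    with coefficient [w p * l z] at [z]. Hence [w p = 0], and what remains is a relation on [A]. *)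
Lemma cone_indep A p z l : p \notin A -> affinely_independent R A ->
  bary A (coord R p) l -> 0 < l z -> affinely_independent R (p |: A :\ z).
Proof.
move=> pA iA bl lz w w0 wx wy.
have [_ lA l1 lx ly] := bl.
have zA : z \in A by apply: contraLR lz => /lA ->; rewrite ltxx.
have pAz : p \notin A :\ z by rewrite !inE (negPf pA) andbF.
pose v q := (if q \in A :\ z then w q else 0) + w p * l q.
have vE (f : point -> R) : f p = \sum_q l q * f q ->
    \sum_(q in A) v q * f q = \sum_(q in p |: A :\ z) w q * f q.
  move=> fp; rewrite big_setU1 //= fp (sum_supported _ lA) mulr_sumr.
  rewrite [X in _ = _ + X]big_mkcond [X in _ = X + _]big_mkcond.
  rewrite -big_split [LHS]big_mkcond /=; apply: eq_bigr => q _.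
  rewrite /v mulrDl mulrA; case: ifP => qA; first by case: ifP; rewrite ?mul0r 1?addrC.
  by rewrite !inE qA andbF addr0.
have v0 : forall q, q \in A -> v q = 0.
  apply: iA; rewrite ?vE //.
  by rewrite -sum_mulr1 (vE (fun=> 1)) sum_mulr1 ?w0 ?l1.
have wp : w p = 0.
  have /eqP := v0 z zA; rewrite /v !inE eqxx add0r mulf_eq0 (gt_eqF lz) orbF.
  by move/eqP.
move=> q; rewrite in_setU1 => /predU1P[-> //|qA].
have : q \in A by move: qA; rewrite inE => /andP[].
by move/v0; rewrite /v qA wp mul0r addr0.
Qed.

(** Subtract from the weights of [x] the largest multiple [t] of the weights of [p] that keeps them
    nonnegative. The weight at a minimizer [z] of [w z / l z] vanishes, so [x] lies in the cone from
    [p] over the face opposite [z]. *)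
Lemma cone_cover A p x l : p \notin A -> bary A (coord R p) l -> hull A x ->
  exists2 z, 0 < l z & hull (p |: A :\ z) x.
Proof.
move=> pA bl /hullP[w bw]; have [z0 _ lz0] := bary_nonempty bl.
have [l0 lA l1 lx ly] := bl; have [w0 wA w1 wx wy] := bw.
case: (@arg_minP _ R point z0 (fun z => 0 < l z) (fun z => w z / l z) lz0) => z lz minz.
exists z => //; set t := w z / l z in minz.
have t0 : 0 <= t by rewrite divr_ge0.
have sE (f : point -> R) : \sum_q (w q - t * l q + t * (q == p)%:R) * f q =
    \sum_q w q * f q - t * \sum_q l q * f q + t * f p.
  have -> : f p = \sum_q (q == p)%:R * f q.
    rewrite (bigD1 p) //= eqxx mul1r big1 ?addr0 // => q /negPf ->.
    by rewrite mul0r.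
  rewrite !mulr_sumr -sumrB -big_split /=; apply: eq_bigr => q _; ring.
apply: (@bary_hull _ _ _ _ _ (fun q => w q - t * l q + t * (q == p)%:R)).
split=> [q|q qA|||].
- apply: addr_ge0; last by rewrite mulr_ge0 ?ler0n.
  have [lq|lq] := ltP 0 (l q); first by rewrite subr_ge0 -ler_pdivlMr // minz.
  have -> : l q = 0 by apply/le_anti; rewrite lq l0.
  by rewrite mulr0 subr0.
- have /negPf qp : q != p by apply: contraNneq qA => ->; rewrite !inE eqxx.
  rewrite qp mulr0 addr0; have [->|qz] := eqVneq q z.
    by rewrite /t divfK ?subrr // gt_eqF.
  have qA' : q \notin A by move: qA; rewrite !inE qp qz.
  by rewrite wA // lA // mulr0 subrr.
- by rewrite -sum_mulr1 (sE (fun=> 1)) !sum_mulr1 w1 l1; ring.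
- by rewrite sE -wx -lx /=; ring.
- by rewrite sE -wy -ly /=; ring.
Qed.

Lemma cone_bary A p z x l w : p \notin A -> bary A (coord R p) l -> z \in A ->
  bary (p |: A :\ z) x w ->
  bary A x (fun q => (if q == p then 0 else w q) + w p * l q).
Proof.
move=> pA [l0 lA l1 lx ly] zA [w0 wA w1 wx wy].
have sE (f : point -> R) : f p = \sum_q l q * f q ->
    \sum_q ((if q == p then 0 else w q) + w p * l q) * f q = \sum_q w q * f q.
  move=> fp; under eq_bigr do rewrite mulrDl -mulrA.
  rewrite big_split /= -mulr_sumr -fp [RHS](bigD1 p) //= addrC; congr (_ + _).
  rewrite (bigD1 p) //= eqxx mul0r add0r; apply: eq_bigr => q /negPf -> //.
split=> [q|q qA|||]; rewrite ?sE //.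
- by apply: addr_ge0; [case: ifP|apply: mulr_ge0].
- rewrite lA // mulr0 addr0; case: eqP => // /eqP qp; apply: wA.
  by rewrite !inE (negPf qp) (negPf qA) andbF.
- by rewrite -sum_mulr1 (sE (fun=> 1)) sum_mulr1 ?l1.
Qed.

(* The vertices of the smallest face of [T] containing [p]. *)
Definition carrier T p : {set point} :=
  [set z | `[< exists A w, [/\ A \in T, bary A (coord R p) w & 0 < w z] >]].

Definition stellar T p : {set {set point}} :=
  [set A in T | ~~ (carrier T p \subset A)] :|:
  [set p |: (Az.1 :\ Az.2) | Az in setX [set A in T | carrier T p \subset A] (carrier T p)].

Lemma stellarP T p B : reflect
  ((B \in T /\ ~~ (carrier T p \subset B)) \/
   exists A z, [/\ A \in T, carrier T p \subset A, z \in carrier T p & B = p |: A :\ z])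
  (B \in stellar T p).
Proof.
apply: (iffP idP); rewrite in_setU.
  case/orP; first by rewrite inE => /andP; left.
  case/imsetP => -[A z] /=; rewrite in_setX /= inE => /andP[/andP[? ?] ?] ->.
  by right; exists A, z.
case=> [[BT nB]|[A [z [AT GA zG ->]]]]; first by rewrite inE BT nB.
apply/orP; right; apply/imsetP; exists (A, z) => //.
by rewrite in_setX /= inE AT GA.
Qed.

Variables (T : {set {set point}}) (p : point).
Hypotheses (triT : is_lattice_triangulation R T) (pT : p \notin cover T).

Lemma unused A : A \in T -> p \notin A.
Proof. by move=> AT; apply: contra pT => pA; apply/bigcupP; exists A. Qed.

Lemma carrierE A l : A \in T -> bary A (coord R p) l ->
  carrier T p = [set z | 0 < l z].
Proof.
move=> AT bl; apply/setP => z; rewrite !inE; apply/asboolP/idP; last by exists A, l.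
by move=> [B [w [BT bw]]]; rewrite (tri_bary_uniq triT BT AT bw bl).
Qed.

Lemma carrier_bary : exists l, [/\ carrier T p = [set z | 0 < l z],
  forall A, A \in T -> carrier T p \subset A -> bary A (coord R p) l &
  forall A, A \in T -> hull A (coord R p) -> carrier T p \subset A].
Proof.
have [A0 A0T /hullP[l bl]] := tri_cover triT (coord_rect R p).
exists l; have GE := carrierE A0T bl; split=> // A AT.
  move=> /subsetP GA; apply: (bary_restrict bl) => q qA.
  have [l0 _ _ _ _] := bl; apply/eqP; apply: contraNT qA => lq; apply: GA.
  by rewrite GE inE lt_def lq l0.
move=> /hullP[w bw]; rewrite (carrierE AT bw); apply/subsetP => q; rewrite inE.
by move=> wq; apply: contraLR wq => qA; case: bw => _ /(_ _ qA) -> _ _ _; rewrite ltxx.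
Qed.

Lemma carrier_other q : exists2 z, z != q & z \in carrier T p.
Proof.
have [A0 A0T /hullP[l bl]] := tri_cover triT (coord_rect R p).
have [z zq lz] := bary_coord_unused (unused A0T) bl q.
by exists z => //; rewrite (carrierE A0T bl) inE.
Qed.

Lemma carrier_sub : exists2 A, A \in T & carrier T p \subset A.
Proof.
have [A0 A0T hA] := tri_cover triT (coord_rect R p).
by have [l [_ _ /(_ _ A0T hA)]] := carrier_bary; exists A0.
Qed.

Lemma stellar_cover : cover (stellar T p) = p |: cover T.
Proof.
apply/setP => q; apply/bigcupP/idP => [[B]|].
  case/stellarP => [[BT _] qB|[A [z [AT _ _ ->]]]].
    by rewrite in_setU1; apply/orP; right; apply/bigcupP; exists B.
  rewrite !inE => /orP[->//|/andP[_ qA]]; apply/orP; right; apply/bigcupP.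
  by exists A.
rewrite in_setU1 => /predU1P[->|/bigcupP[A AT qA]].
  have [A AT GA] := carrier_sub; have [z _ zG] := carrier_other p.
  by exists (p |: A :\ z); rewrite ?setU11 //; apply/stellarP; right; exists A, z.
have [GA|nGA] := boolP (carrier T p \subset A); last first.
  by exists A => //; apply/stellarP; left.
have [z zq zG] := carrier_other q.
exists (p |: A :\ z); first by apply/stellarP; right; exists A, z.
by rewrite !inE (eq_sym q z) zq qA orbT.
Qed.

Lemma stellar_tri : is_lattice_triangulation R (stellar T p).
Proof.
have [l [GE Gb Gh]] := carrier_bary.
have GA A : A \in T -> carrier T p \subset A -> forall z, z \in carrier T p ->
    [/\ z \in A, 0 < l z, p \notin A & bary A (coord R p) l].
  move=> AT sGA z zG; split; [exact: (subsetP sGA)| |exact: unused|exact: Gb].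
  by move: zG; rewrite GE inE.
(* The weights of [x] in [A] and [B] agree. At a carrier vertex [i] outside [B] this makes a sum of
   nonnegative terms vanish, so [w p * l i = 0]: the point [x] is on the face of the cone opposite
   [p]. *)
have old_new A B z x : A \in T -> carrier T p \subset A -> z \in carrier T p ->
    B \in T -> ~~ (carrier T p \subset B) -> hull (p |: A :\ z) x -> hull B x ->
    hull ((p |: A :\ z) :&: B) x.
  move=> AT sGA zG BT /subsetPn[i iG iB] /hullP[w bw] /hullP[v bv].
  have [zA lz pA bl] := GA _ AT sGA _ zG.
  have e := tri_bary_uniq triT AT BT (cone_bary pA bl zA bw) bv.
  have [_ vB _ _ _] := bv; have [w0 _ _ _ _] := bw; have [l0 _ _ _ _] := bl.
  have w'0 q : q \notin B -> (if q == p then 0 else w q) = 0 /\ w p * l q = 0.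
    move=> qB; have := e q; rewrite vB // => /eqP; rewrite paddr_eq0.
    - by move=> /andP[/eqP -> /eqP ->].
    - by case: ifP.
    - by rewrite mulr_ge0.
  have wp : w p = 0.
    have [_ /eqP] := w'0 i iB; rewrite mulf_eq0 => /orP[/eqP //|/eqP li0].
    by move: iG; rewrite GE inE li0 ltxx.
  apply: bary_hull (bary_cap bw (bary_restrict bw _)) => q qB.
  have [+ _] := w'0 q qB; by case: eqP => // ->.
split=> [B|| B1 B2].
- case/stellarP => [[BT _]|[A [z [AT sGA zG ->]]]]; first by case: triT => /(_ _ BT).
  have [zA lz pA bl] := GA _ AT sGA _ zG; split.
    rewrite cardsU1 !inE (negPf pA) andbF /=.
    by have := cardsD1 z A; rewrite (tri_card triT AT) zA => ->.
  exact: cone_indep pA (tri_indep triT AT) bl lz.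
- apply/seteqP; split=> [x [B _]|x /(tri_cover triT)[A AT Ax]]; first exact: hull_rect.
  have [sGA|nGA] := boolP (carrier T p \subset A); last first.
    by exists A => //=; apply/stellarP; left.
  have [z lz hx] := cone_cover (unused AT) (Gb _ AT sGA) Ax.
  exists (p |: A :\ z) => //=; apply/stellarP; right; exists A, z; split=> //.
  by rewrite GE inE.
move=> B1s B2s; apply/seteqP; split=> x; last first.
  by move=> h; split; apply: hull_sub h; rewrite ?subsetIl ?subsetIr.
case=> h1 h2; case/stellarP: B1s h1 => [[B1T n1]|[A [z [AT sGA zG ->]]]] h1;
  case/stellarP: B2s h2 => [[B2T n2]|[A' [z' [AT' sGA' zG' ->]]]] h2.
- exact: (tri_face triT B1T B2T).
- by rewrite setIC; apply: old_new.
- exact: old_new.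
move/hullP: h1 => [w bw]; move/hullP: h2 => [v bv].
have [zA lz pA bl] := GA _ AT sGA _ zG.
have [zA' lz' pA' bl'] := GA _ AT' sGA' _ zG'.
have e := tri_bary_uniq triT AT AT' (cone_bary pA bl zA bw) (cone_bary pA' bl' zA' bv).
have [w0 wA _ _ _] := bw; have [v0 vA _ _ _] := bv.
have half (u1 u2 : point -> R) (y : point) : 0 < l y -> u1 y = 0 -> 0 <= u2 y -> y != p ->
    (if y == p then 0 else u1 y) + u1 p * l y =
    (if y == p then 0 else u2 y) + u2 p * l y -> u2 p <= u1 p.
  move=> ly u1y u2y /negPf ->; rewrite u1y add0r => eq12.
  by rewrite -(ler_pM2r ly) eq12 lerDr.
have neqp (y : point) B : y \in B -> p \notin B -> y != p by move=> yB; apply: contraNneq => <-.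
(* Since [w z = 0], comparison at [z] gives [w p * l z = v z + v p * l z], so [v p <= w p]; the
   vertex [z'] gives the other inequality. *)
have wpvp : w p = v p.
  have wz : w z = 0 by apply: wA; rewrite !inE eqxx /= orbF; apply: neqp zA pA.
  have vz' : v z' = 0 by apply: vA; rewrite !inE eqxx /= orbF; apply: neqp zA' pA'.
  by apply/le_anti; rewrite (half v w z') ?(half w v z) //; apply: neqp; eassumption.
apply: bary_hull (bary_cap bw (bary_restrict bw _)) => q qB.
rewrite -(vA _ qB); have [-> //|/negPf qp] := eqVneq q p.
by have := e q; rewrite qp wpvp => /addIr.
Qed.

End Stellar.

(** * Orientation of triples and germs of affine functions *)

Section Plane.
Variable R : realType.
Implicit Types x y z : R * R.

Definition orient x y z : R :=
  (y.1 - x.1) * (z.2 - x.2) - (y.2 - x.2) * (z.1 - x.1).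

Lemma orient_lerp x y t u v : orient x y (lerp t u v) =
  orient x y u + t * (orient x y v - orient x y u).
Proof. rewrite /orient /lerp /=; ring. Qed.

Lemma orient_lerpl x y t u v : orient (lerp t u v) x y =
  orient u x y + t * (orient v x y - orient u x y).
Proof. rewrite /orient /lerp /=; ring. Qed.

Lemma orient_lerpm x y t u v : orient x (lerp t u v) y =
  orient x u y + t * (orient x v y - orient x u y).
Proof. rewrite /orient /lerp /=; ring. Qed.

Lemma orientC x y z : orient y z x = orient x y z.
Proof. rewrite /orient; ring. Qed.

Lemma orient_xxy x y : orient x x y = 0.
Proof. rewrite /orient; ring. Qed.

Lemma orient_xyx x y : orient x y x = 0.
Proof. rewrite /orient; ring. Qed.

Lemma orient_xyy x y : orient x y y = 0.
Proof. rewrite /orient; ring. Qed.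

Definition orient0 := (orient_xxy, orient_xyx, orient_xyy).

(** The alternatives differ at [t = 0]: a function that vanishes there with negative slope is
    nonnegative at 0 itself, yet negative at every small positive parameter. *)
Lemma affine_germ (c d : R) : exists2 e, 0 < e &
  (forall t, 0 <= t <= e -> 0 <= c + d * t) \/ (forall t, 0 < t <= e -> c + d * t < 0).
Proof.
have [c0|c0|c0] := ltgtP c 0.
- exists (- c / (`|d| + 1) / 2) => [|].
    by rewrite !divr_gt0 // ?oppr_gt0 // ltr_wpDl.
  right=> t /andP[t0 te]; have n1 : 0 < `|d| + 1 by rewrite ltr_wpDl.
  have dn := ler_norm d.
  have : t * (`|d| + 1) <= - c / 2 by rewrite -ler_pdivlMr // mulrAC.
  nra.
- exists (c / (`|d| + 1)); first by rewrite divr_gt0 // ltr_wpDl.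
  left=> t /andP[t0 te]; have n1 : 0 < `|d| + 1 by rewrite ltr_wpDl.
  have dn : - d <= `|d| by rewrite -normrN ler_norm.
  have : t * (`|d| + 1) <= c by rewrite -ler_pdivlMr.
  nra.
- exists 1 => //; rewrite c0; have [d0|d0] := leP 0 d.
    by left=> t /andP[t0 _]; rewrite add0r mulr_ge0.
  by right=> t /andP[t0 _]; rewrite add0r nmulr_rlt0.
Qed.

Lemma affine_pos_germ (c d : R) : 0 < c ->
  exists2 e, 0 < e & forall t, 0 <= t <= e -> 0 <= c + d * t.
Proof.
move=> c0; have [e e0 [h|h]] := affine_germ c d; first by exists e.
exists (c / (`|d| + 1)); first by rewrite divr_gt0 // ltr_wpDl.
move=> t /andP[t0 te]; have n1 : 0 < `|d| + 1 by rewrite ltr_wpDl.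
have dn : - d <= `|d| by rewrite -normrN ler_norm.
have : t * (`|d| + 1) <= c by rewrite -ler_pdivlMr.
nra.
Qed.

End Plane.

Lemma big_set3 (R : realType) (I : finType) (a b c : I) (F : I -> R) :
  a != b -> a != c -> b != c -> \sum_(i in [set a; b; c]) F i = F a + F b + F c.
Proof.
move=> ab ac bc; rewrite -setUA big_setU1 ?inE ?negb_or ?ab //=.
by rewrite big_setU1 ?inE //= big_set1 addrA.
Qed.

Lemma cards3P (I : finType) (A : {set I}) : #|A| = 3%N ->
  exists a b c, [/\ a != b, a != c, b != c & A = [set a; b; c]].
Proof.
move=> A3; have /card_gt2P[a [b [c [[aA bA cA] [ab bc ca]]]]] : (2 < #|A|)%N by rewrite A3.
exists a, b, c; split; rewrite // 1?eq_sym //.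
apply/eqP; rewrite eq_sym eqEcard A3 -setUA cardsU1 !inE negb_or ab (eq_sym a c) ca.
rewrite cardsU1 inE bc cards1 /= andbT; apply/subsetP => x; rewrite !inE.
by case/or3P => /eqP ->.
Qed.

Section PlaneTriangle.
Variables (R : realType) (m n : nat).
Local Notation point := (lattice_point m n).
Local Notation co := (@coord R m n).
Implicit Types (A B : {set point}) (T : {set {set point}}) (x y : R * R)
  (w v : point -> R) (a b c d p q : point).

Lemma bary_orient A x w y z : bary A x w ->
  orient y z x = \sum_(p in A) w p * orient y z (co p).
Proof.
move=> bw; have [_ wA _ _ _] := bw; rewrite -sum_supported //.
have e u : orient y z u = affine_fun
    (- (z.1 - y.1) * y.2 + (z.2 - y.2) * y.1) (- (z.2 - y.2)) (z.1 - y.1) u.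
  by rewrite /orient /affine_fun; ring.
by rewrite e (bary_affine _ _ _ bw); apply: eq_bigr => p _; rewrite e.
Qed.

Lemma indep_orient a b c : a != b -> a != c -> b != c ->
  affinely_independent R [set a; b; c] -> orient (co a) (co b) (co c) != 0.
Proof.
move=> ab ac bc ia; apply/eqP => o0.
pose W (s t : R) p : R := if p == a then - s - t else if p == b then s else t.
have key (s t : R) : s * ((co b).1 - (co a).1) + t * ((co c).1 - (co a).1) = 0 ->
    s * ((co b).2 - (co a).2) + t * ((co c).2 - (co a).2) = 0 -> s = 0 /\ t = 0.
  move=> e1 e2; have Wa : W s t a = - s - t by rewrite /W eqxx.
  have Wb : W s t b = s by rewrite /W eq_sym (negPf ab) eqxx.
  have Wc : W s t c = t by rewrite /W eq_sym (negPf ac) eq_sym (negPf bc).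
  have := ia (W s t); rewrite !big_set3 // !Wa !Wb !Wc => H.
  split; [rewrite -Wb|rewrite -Wc]; apply: H; rewrite ?inE ?eqxx ?orbT //.
  - by ring.
  - by rewrite -[RHS]e1 /=; ring.
  - by rewrite -[RHS]e2 /=; ring.
  - by ring.
  - by rewrite -[RHS]e1 /=; ring.
  - by rewrite -[RHS]e2 /=; ring.
have [||h1 _] := key ((co c).1 - (co a).1) (- ((co b).1 - (co a).1)).
- by ring.
- by move: o0; rewrite /orient => /eqP; rewrite -oppr_eq0 => /eqP <-; ring.
have [||h2 _] := key ((co c).2 - (co a).2) (- ((co b).2 - (co a).2)).
- by move: o0; rewrite /orient => <-; ring.
- by ring.
move: ac; rewrite -(inj_eq (@coord_inj R m n)) => /eqP[].
rewrite (surjective_pairing (co a)) (surjective_pairing (co c)).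
by rewrite (subr0_eq h1) (subr0_eq h2).
Qed.

Lemma orient_indep a b c : a != b -> a != c -> b != c ->
  orient (co a) (co b) (co c) != 0 -> affinely_independent R [set a; b; c].
Proof.
move=> ab ac bc o0 w; rewrite !big_set3 // => w0 wx wy.
have wa : w a = - w b - w c by apply/eqP; rewrite -subr_eq0 -[X in _ == X]w0; apply/eqP; ring.
have wb : w b = 0.
  apply: (mulIf o0); rewrite mul0r /orient /=.
  have -> : w b * (((b.1 : nat)%:R - (a.1 : nat)%:R) * ((c.2 : nat)%:R - (a.2 : nat)%:R) -
      ((b.2 : nat)%:R - (a.2 : nat)%:R) * ((c.1 : nat)%:R - (a.1 : nat)%:R)) =
    (w a * (a.1 : nat)%:R + w b * (b.1 : nat)%:R + w c * (c.1 : nat)%:R) *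
      ((c.2 : nat)%:R - (a.2 : nat)%:R) -
    (w a * (a.2 : nat)%:R + w b * (b.2 : nat)%:R + w c * (c.2 : nat)%:R) *
      ((c.1 : nat)%:R - (a.1 : nat)%:R) by rewrite wa; ring.
  by rewrite wx wy !mul0r subrr.
have wc : w c = 0.
  apply: (mulIf o0); rewrite mul0r /orient /=.
  have -> : w c * (((b.1 : nat)%:R - (a.1 : nat)%:R) * ((c.2 : nat)%:R - (a.2 : nat)%:R) -
      ((b.2 : nat)%:R - (a.2 : nat)%:R) * ((c.1 : nat)%:R - (a.1 : nat)%:R)) =
    (w a * (a.2 : nat)%:R + w b * (b.2 : nat)%:R + w c * (c.2 : nat)%:R) *
      ((b.1 : nat)%:R - (a.1 : nat)%:R) -
    (w a * (a.1 : nat)%:R + w b * (b.1 : nat)%:R + w c * (c.1 : nat)%:R) *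
      ((b.2 : nat)%:R - (a.2 : nat)%:R) by rewrite wa; ring.
  by rewrite wx wy !mul0r subrr.
by move=> p; rewrite !inE => /orP[/orP[]|] /eqP -> //; rewrite wa wb wc; ring.
Qed.

Definition tri_weight a b c x : point -> R := fun p =>
  (if p == a then orient x (co b) (co c) else
   if p == b then orient (co a) x (co c) else
   if p == c then orient (co a) (co b) x else 0) / orient (co a) (co b) (co c).

Lemma tri_weightE a b c x : a != b -> a != c -> b != c ->
  let D := orient (co a) (co b) (co c) in
  [/\ tri_weight a b c x a = orient x (co b) (co c) / D,
      tri_weight a b c x b = orient (co a) x (co c) / D &
      tri_weight a b c x c = orient (co a) (co b) x / D].
Proof.
move=> ab ac bc; rewrite /tri_weight !eqxx.
by rewrite (eq_sym b a) (negPf ab) (eq_sym c a) (negPf ac) (eq_sym c b) (negPf bc).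
Qed.

Lemma tri_weight_bary a b c x : a != b -> a != c -> b != c ->
  orient (co a) (co b) (co c) != 0 ->
  0 <= tri_weight a b c x a -> 0 <= tri_weight a b c x b ->
  0 <= tri_weight a b c x c -> bary [set a; b; c] x (tri_weight a b c x).
Proof.
move=> ab ac bc o0 pa pb pc.
have sA p : p \notin [set a; b; c] -> tri_weight a b c x p = 0.
  by rewrite !inE !negb_or /tri_weight => /andP[/andP[/negPf -> /negPf ->] /negPf ->]; rewrite mul0r.
have [wa wb wc] := tri_weightE x ab ac bc.
split=> // [p||/=|/=].
- have [|/sA -> //] := boolP (p \in [set a; b; c]).
  by rewrite !inE => /orP[/orP[]|] /eqP ->.
- rewrite (sum_supported1 sA) big_set3 // wa wb wc.
  by rewrite -!mulrDl; apply: (mulIf o0); rewrite divfK // mul1r /orient /=; ring.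
- rewrite (sum_supported _ sA) big_set3 // wa wb wc.
  rewrite -[LHS](mulfK o0).
  have -> : x.1 * orient (co a) (co b) (co c) = orient x (co b) (co c) * (a.1 : nat)%:R +
    orient (co a) x (co c) * (b.1 : nat)%:R + orient (co a) (co b) x * (c.1 : nat)%:R.
    by rewrite /orient /=; ring.
  by ring.
- rewrite (sum_supported _ sA) big_set3 // wa wb wc.
  rewrite -[LHS](mulfK o0).
  have -> : x.2 * orient (co a) (co b) (co c) = orient x (co b) (co c) * (a.2 : nat)%:R +
    orient (co a) x (co c) * (b.2 : nat)%:R + orient (co a) (co b) x * (c.2 : nat)%:R.
    by rewrite /orient /=; ring.
  by ring.
Qed.

Lemma bary_weightE a b c x w : a != b -> a != c -> b != c ->
  orient (co a) (co b) (co c) != 0 -> bary [set a; b; c] x w ->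
  w =1 tri_weight a b c x.
Proof.
move=> ab ac bc o0 bw p; have [w0 wA w1 _ _] := bw.
have [wa wb wc] := tri_weightE x ab ac bc.
have [|pA] := boolP (p \in [set a; b; c]); last first.
  rewrite wA //; move: pA; rewrite !inE !negb_or /tri_weight.
  by move=> /andP[/andP[/negPf -> /negPf ->] /negPf ->]; rewrite mul0r.
have o2 : orient (co a) x (co c) = orient (co c) (co a) x by rewrite orientC.
rewrite !inE => /orP[/orP[]|] /eqP ->; rewrite ?wa ?wb ?wc ?o2 -1?[orient x _ _]orientC;
  rewrite (bary_orient _ _ bw) big_set3 // !orient0 !mulr0 ?addr0 ?add0r.
- by rewrite orientC mulfK.
- by rewrite -orientC mulfK.
- by rewrite mulfK.
Qed.

Lemma tri_hullP a b c x : a != b -> a != c -> b != c ->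
  let D := orient (co a) (co b) (co c) in D != 0 ->
  hull [set a; b; c] x <->
  [/\ 0 <= orient x (co b) (co c) / D, 0 <= orient (co a) x (co c) / D &
      0 <= orient (co a) (co b) x / D].
Proof.
move=> ab ac bc D D0; have [wa wb wc] := tri_weightE x ab ac bc.
split=> [/hullP[w bw]|[pa pb pc]].
  have [w0 _ _ _ _] := bw; rewrite -wa -wb -wc.
  by rewrite -!(bary_weightE ab ac bc D0 bw).
by apply: bary_hull (tri_weight_bary ab ac bc D0 _ _ _); rewrite ?wa ?wb ?wc.
Qed.

Lemma tri_germ a b c x y : a != b -> a != c -> b != c ->
  orient (co a) (co b) (co c) != 0 -> exists2 e, 0 < e &
  (forall t, 0 <= t <= e -> hull [set a; b; c] (lerp t x y)) \/
  (forall t, 0 < t <= e -> ~ hull [set a; b; c] (lerp t x y)).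
Proof.
move=> ab ac bc D0; set D := orient _ _ _ in D0.
pose g (y1 y2 z : R * R) := orient y1 y2 z / D.
have gE y1 y2 t : g y1 y2 (lerp t x y) = g y1 y2 x + (g y1 y2 y - g y1 y2 x) * t.
  by rewrite /g orient_lerp; ring.
have hE t : hull [set a; b; c] (lerp t x y) <->
    [/\ 0 <= g (co b) (co c) (lerp t x y), 0 <= g (co c) (co a) (lerp t x y) &
        0 <= g (co a) (co b) (lerp t x y)].
  rewrite /g (orientC (lerp t x y)) -(orientC (co c) (co a)).
  exact: tri_hullP ab ac bc D0.
have germ y1 y2 : exists2 e, 0 < e &
    (forall t, 0 <= t <= e -> 0 <= g y1 y2 (lerp t x y)) \/
    (forall t, 0 < t <= e -> g y1 y2 (lerp t x y) < 0).
  have [e e0 h] := affine_germ (g y1 y2 x) (g y1 y2 y - g y1 y2 x).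
  by exists e => //; case: h => h; [left|right] => t te; rewrite gE h.
have [e1 e10 [h1|h1]] := germ (co b) (co c); last first.
  by exists e1 => //; right=> t te /hE[+ _ _]; rewrite leNgt h1.
have [e2 e20 [h2|h2]] := germ (co c) (co a); last first.
  by exists e2 => //; right=> t te /hE[_ + _]; rewrite leNgt h2.
have [e3 e30 [h3|h3]] := germ (co a) (co b); last first.
  by exists e3 => //; right=> t te /hE[_ _ +]; rewrite leNgt h3.
exists (Num.min e1 (Num.min e2 e3)); first by rewrite !lt_min e10 e20.
by left=> t; rewrite !le_min => /and4P[? ? ? ?]; apply/hE; split;
  [apply: h1|apply: h2|apply: h3]; apply/andP.
Qed.

End PlaneTriangle.

(** * Local structure of triangulations and the fibres of stellar insertion *)

Section Star.
Variables (R : realType) (m n : nat).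
Local Notation point := (lattice_point m n).
Local Notation co := (@coord R m n).
Implicit Types (A B : {set point}) (T : {set {set point}}) (x y : R * R)
  (w v : point -> R) (a b c d p q : point).

Lemma set3_eq (I : finType) (S : {set I}) (i j k : I) : #|S| = 3%N ->
  i \in S -> j \in S -> k \in S -> i != j -> i != k -> j != k -> S = [set i; j; k].
Proof.
move=> S3 iS jS kS ij ik jk; apply/esym/eqP; rewrite eqEcard S3.
rewrite -setUA cardsU1 !inE negb_or ij ik cardsU1 inE jk cards1 andbT.
by rewrite !subUset !sub1set iS jS kS.
Qed.

Lemma rect_lerp t x y : 0 <= t <= 1 ->
  @rectangle R m n x -> @rectangle R m n y -> @rectangle R m n (lerp t x y).
Proof.
move=> /andP[t0 t1] [/andP[x1 x1'] /andP[x2 x2']] [/andP[y1 y1'] /andP[y2 y2']].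
by rewrite /rectangle /lerp /=; split; apply/andP; split; nra.
Qed.

(** By [tri_germ], each of the finitely many triangles contains an initial piece of the segment or
    misses one, its starting point aside. With a common length [e], the triangle covering a point at
    a positive parameter at most [e] is of the first kind. *)
Lemma tri_ray T x y : is_lattice_triangulation R T ->
  @rectangle R m n x -> @rectangle R m n y ->
  exists A e, [/\ A \in T, 0 < e & forall t, 0 <= t <= e -> hull A (lerp t x y)].
Proof.
move=> triT rx ry.
pose P e A := (forall t, 0 <= t <= e -> hull A (lerp t x y)) \/
  (forall t, 0 < t <= e -> ~ hull A (lerp t x y)).
have Pmon e e' A : e' <= e -> P e A -> P e' A.
  by move=> ee' [h|h]; [left|right] => t /andP[t0 te]; apply: h; rewrite t0 (le_trans te).
have [e e0 He] : exists2 e, 0 < e & forall A, A \in T -> P e A.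
  suff H (s : seq {set point}) : {subset s <= T} ->
      exists2 e, 0 < e & forall A, A \in s -> P e A.
    by have [|e e0 He] := H (enum T); [move=> A|exists e => // A AT; apply: He];
      rewrite mem_enum.
  elim: s => [|A s IH] sT; first by exists 1.
  have [|e e0 He] := IH; first by move=> B Bs; apply: sT; rewrite inE Bs orbT.
  have AT : A \in T by apply: sT; rewrite inE eqxx.
  have [a [b [c [ab ac bc AE]]]] := cards3P (tri_card triT AT).
  have := tri_indep triT AT; rewrite AE => /(indep_orient ab ac bc) D0.
  have [e' e'0 He'] := tri_germ x y ab ac bc D0.
  exists (Num.min e e'); first by rewrite lt_min e0.
  move=> B; rewrite inE => /predU1P[->|Bs].
    by apply: (Pmon e'); rewrite ?ge_min ?lexx ?orbT // AE.
  by apply: (Pmon e); rewrite ?ge_min ?lexx //; apply: He.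
pose t := Num.min e 1; have t0 : 0 < t by rewrite lt_min e0 ltr01.
have t1 : 0 <= t <= 1 by rewrite ltW //= ge_min lexx orbT.
have [A AT hA] := tri_cover triT (rect_lerp t1 rx ry).
exists A, e; split=> //; have [//|h] := He A AT.
by case: (h t); rewrite // t0 /t ge_min lexx.
Qed.

(** If [c] and [d] were on the same side, a point slightly off the midpoint of [a b] towards [d]
    would lie in both triangles but off the line [a b], whereas the triangles meet in the hull of
    their common vertices. *)
Lemma tri_sides T a b c d : is_lattice_triangulation R T ->
  a != b -> a != c -> b != c -> a != d -> b != d -> c != d ->
  [set a; b; c] \in T -> [set a; b; d] \in T ->
  orient (co a) (co b) (co c) * orient (co a) (co b) (co d) < 0.
Proof.
move=> triT ab ac bc ad bd cd cT dT.
have C0 := indep_orient ab ac bc (tri_indep triT cT).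
have D0 := indep_orient ab ad bd (tri_indep triT dT).
rewrite lt_neqAle mulf_neq0 //= leNgt; apply/negP => CD.
pose mid := lerp (1 / 2) (co a) (co b).
have g1 : orient mid (co b) (co c) / orient (co a) (co b) (co c) = 1 / 2.
  by rewrite orient_lerpl !orient0; field.
have g2 : orient (co a) mid (co c) / orient (co a) (co b) (co c) = 1 / 2.
  by rewrite orient_lerpm !orient0; field.
have [e1 e10 h1] := @affine_pos_germ R (1 / 2)
  (orient (co d) (co b) (co c) / orient (co a) (co b) (co c) - 1 / 2) ltac:(lra).
have [e2 e20 h2] := @affine_pos_germ R (1 / 2)
  (orient (co a) (co d) (co c) / orient (co a) (co b) (co c) - 1 / 2) ltac:(lra).
pose t := Num.min 1 (Num.min e1 e2).
have t0 : 0 < t by rewrite !lt_min ltr01 e10.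
have [t1 te1 te2] : [/\ t <= 1, t <= e1 & t <= e2].
  by rewrite /t !ge_min !lexx !orbT.
pose y := lerp t mid (co d).
have hm (S : {set point}) : a \in S -> b \in S -> hull S mid.
  by move=> aS bS; apply: hull_lerp; [lra|exact: hull_vertex|exact: hull_vertex].
have hB : hull [set a; b; d] y.
  apply: hull_lerp; first by rewrite ltW.
    by apply: hm; rewrite !inE eqxx ?orbT.
  by apply: hull_vertex; rewrite !inE eqxx ?orbT.
have hA : hull [set a; b; c] y.
  apply/(tri_hullP y ab ac bc C0); split.
  - have := h1 t; rewrite (ltW t0) te1 => /(_ isT); congr (0 <= _).
    by rewrite /y orient_lerpl -g1; ring.
  - have := h2 t; rewrite (ltW t0) te2 => /(_ isT); congr (0 <= _).
    by rewrite /y orient_lerpm -g2; ring.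
  - rewrite /y orient_lerp /mid orient_lerp !orient0.
    have -> : 0 + 1 / 2 * (0 - 0) + t * (orient (co a) (co b) (co d) - (0 + 1 / 2 * (0 - 0))) =
      t * orient (co a) (co b) (co d) by ring.
    rewrite -mulrA mulr_ge0 ?(ltW t0) //.
    have -> : orient (co a) (co b) (co d) / orient (co a) (co b) (co c) =
        orient (co a) (co b) (co c) * orient (co a) (co b) (co d) /
        orient (co a) (co b) (co c) ^+ 2 by field.
    by rewrite divr_ge0 ?sqr_ge0 // ltW.
have /hullP[w bw] := tri_face triT cT dT (subxx _) (subxx _) hA hB.
have sab : [set a; b; c] :&: [set a; b; d] \subset [set a; b].
  apply/subsetP => q; rewrite !inE => /andP[/orP[-> //|/eqP ->]].
  by rewrite (negPf cd) orbF.
have [_ bwA _ _ _] := bary_sub sab bw.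
have : orient (co a) (co b) y = 0.
  rewrite (bary_orient _ _ (bary_sub sab bw)) big_setU1 ?inE //= big_set1.
  by rewrite orient_xyx orient_xyy !mulr0 addr0.
rewrite /y orient_lerp /mid orient_lerp !orient0 => /eqP.
have -> : 0 + 1 / 2 * (0 - 0) + t * (orient (co a) (co b) (co d) - (0 + 1 / 2 * (0 - 0))) =
      t * orient (co a) (co b) (co d) by ring.
by rewrite mulf_eq0 (gt_eqF t0) (negPf D0).
Qed.

Lemma face_vertex T A B p : is_lattice_triangulation R T -> A \in T ->
  B \subset A -> p \in A -> hull B (co p) -> p \in B.
Proof.
move=> triT AT BA pA /hullP[w bw]; have [_ wB _ _ _] := bw.
have := bary_uniq (tri_indep triT AT) (bary_sub BA bw) (bary_vertex R pA) p.
by rewrite eqxx; apply: contra_eqT => /wB ->; rewrite eq_sym oner_eq0.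
Qed.

Section Fiber.
Variable p : point.

(** The carrier in [T2] has a vertex other than [q], and dropping it gives a cone triangle through
    [q]. This triangle contains [p], so it is a cone triangle over [T1] as well. *)
Lemma stellar_inv T1 T2 q : is_lattice_triangulation R T1 ->
  is_lattice_triangulation R T2 -> p \notin cover T1 -> p \notin cover T2 ->
  stellar R T1 p = stellar R T2 p -> q \in carrier R T2 p ->
  exists A, [/\ A \in T1, carrier R T1 p \subset A & q \in A].
Proof.
move=> tri1 tri2 p1 p2 e qG.
have [A2 A2T GA2] := carrier_sub p tri2.
have [z zq zG] := carrier_other tri2 p2 q.
have : p |: A2 :\ z \in stellar R T1 p.
  by rewrite e; apply/stellarP; right; exists A2, z.
case/stellarP => [[AT _]|[A [z' [AT GA z'G eq]]]].
  by have := unused p1 AT; rewrite setU11.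
exists A; split=> //.
have : q \in p |: A2 :\ z by rewrite !inE (eq_sym q z) zq (subsetP GA2) ?orbT.
rewrite eq !inE => /predU1P[qp|/andP[]//].
by have := unused p2 A2T; rewrite -qp (subsetP GA2).
Qed.

(** Suppose that [y] is only in the second carrier. Then [a b y] is a triangle of [T1] whose side
    [a b] is the first carrier and contains [p]. The cone triangles [p a y] and [p b y] come in [T2]
    from one and the same triangle, which is again [a b y]; dropping [y] from it gives the cone
    triangle [p a b], which is degenerate. *)
Lemma carrier_meet T1 T2 a : is_lattice_triangulation R T1 ->
  is_lattice_triangulation R T2 -> p \notin cover T1 -> p \notin cover T2 ->
  stellar R T1 p = stellar R T2 p ->
  a \in carrier R T1 p -> a \in carrier R T2 p ->
  carrier R T2 p \subset carrier R T1 p.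
Proof.
move=> tri1 tri2 p1 p2 e a1 a2; apply/subsetP => y y2; apply: contraT => y1.
have tri' := stellar_tri tri2 p2.
have [A [AT GA yA]] := stellar_inv tri1 tri2 p1 p2 e y2.
have [b ba bG] := carrier_other tri1 p1 a.
have aA := subsetP GA _ a1; have bA := subsetP GA _ bG.
have ay : a != y by apply: contraNneq y1 => <-.
have by' : b != y by apply: contraNneq y1 => <-.
have ab : a != b by rewrite eq_sym.
have AE := set3_eq (tri_card tri1 AT) aA bA yA ab ay by'.
have pA : p \notin A := unused p1 AT.
have [pa pb py] : [/\ p != a, p != b & p != y].
  by split; apply: contraNneq pA => ->.
have GE : carrier R T1 p \subset [set a; b].
  apply/subsetP => q qG; have := subsetP GA _ qG; rewrite AE !inE => /orP[//|/eqP qy].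
  by rewrite -qy qG in y1.
have hab : hull [set a; b] (co p).
  have [l [_ lb _]] := carrier_bary p tri1; have [l0 lA l1 lx ly] := lb A AT GA.
  have [l' [GE' _ _]] := carrier_bary p tri1.
  apply: bary_hull (bary_restrict (lb A AT GA) _) => q qab.
  have qG : q \notin carrier R T1 p by apply: contra qab; apply: (subsetP GE).
  by move: qG; rewrite (carrierE tri1 AT (lb A AT GA)) inE lt_def l0 andbT => /negbNE/eqP.
have inT' z q : z \in A -> z \in carrier R T1 p -> p |: A :\ z \in stellar R T2 p.
  by move=> zA zG; rewrite -e; apply/stellarP; right; exists A, z.
have contra' (C : {set point}) : C \in stellar R T2 p -> p \in C -> a \in C -> b \in C -> False.
  move=> CT pC aC bC; have := face_vertex tri' CT _ pC hab.
  by rewrite !subUset !sub1set aC bC !inE (negPf pa) (negPf pb) => /(_ isT).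
have := inT' b a bA bG; case/stellarP => [[BT _]|[A' [z' [AT' GA' zG' eq]]]].
  by have := unused p2 BT; rewrite setU11.
have inA' q : q \in A -> q != b -> q != p -> q \in A' :\ z'.
  move=> qA qb qp; have : q \in p |: A :\ b by rewrite !inE qA qb orbT.
  by rewrite eq in_setU1 (negPf qp).
have := inA' a aA ab; rewrite eq_sym pa => /(_ isT); rewrite !inE => /andP[az' aA'].
have := inA' y yA; rewrite eq_sym by' eq_sym py => /(_ isT isT).
rewrite !inE => /andP[yz' yA'].
have zA' := subsetP GA' _ zG'.
have AE' := set3_eq (tri_card tri2 AT') aA' yA' zA' ay az' yz'.
have := inT' a b aA a1; case/stellarP => [[BT _]|[A'' [z'' [AT'' GA'' zG'' eq'']]]].
  by have := unused p2 BT; rewrite setU11.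
have AA : A'' = A'.
  apply/esym/eqP; rewrite eqEcard (tri_card tri2 AT') (tri_card tri2 AT'') andbT.
  by rewrite AE' !subUset !sub1set !(subsetP GA'').
have bA' : b \in A'.
  have : b \in p |: A :\ a by rewrite !inE bA ba orbT.
  by rewrite eq'' AA !inE eq_sym (negPf pb) => /andP[].
exfalso; apply: (contra' (p |: A' :\ y)).
- by apply/stellarP; right; exists A', y.
- by rewrite setU11.
- by rewrite !inE ay aA' orbT.
- by rewrite !inE by' bA' orbT.
Qed.

(** A cone triangle lacks just one vertex of its parent, and that vertex is in the carrier; adding
    the whole carrier restores the parent. So the carrier is the only information that [stellar]
    loses. *)
Lemma stellar_recover T : is_lattice_triangulation R T -> p \notin cover T ->
  T = [set B in stellar R T p | p \notin B] :|:
      [set (B :\ p) :|: carrier R T p | B in [set B in stellar R T p | p \in B]].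
Proof.
move=> triT pT.
have back A z : A \in T -> carrier R T p \subset A -> z \in carrier R T p ->
    ((p |: A :\ z) :\ p) :|: carrier R T p = A.
  move=> AT; have pA := unused pT AT; move: (carrier R T p) => G GA zG.
  apply/setP => q; rewrite !inE; have [->|qp] := eqVneq q p; rewrite /=.
    by rewrite (negPf pA); apply: contraNF pA; apply: (subsetP GA).
  have [->|qz] := eqVneq q z; first by rewrite zG (subsetP GA).
  by case: (boolP (q \in A)) => //= qA; apply: contraNF qA; apply: (subsetP GA).
apply/setP => A; rewrite in_setU; apply/idP/orP => [AT|[]].
- have [GA|nGA] := boolP (carrier R T p \subset A); last first.
    left; rewrite inE (unused pT AT) andbT; by apply/stellarP; left.
  right; have [z _ zG] := carrier_other triT pT p.
  apply/imsetP; exists (p |: A :\ z); last by rewrite back.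
  by rewrite inE setU11 andbT; apply/stellarP; right; exists A, z.
- rewrite inE => /andP[/stellarP[[]//|[A' [z [_ _ _ ->]]]]].
  by rewrite setU11.
- case/imsetP => B; rewrite inE => /andP[/stellarP[[BT _]|[A' [z [AT' GA' zG' ->]]]] pB ->].
    by rewrite (negPf (unused pT BT)) in pB.
  by rewrite back.
Qed.

(* An unused point [p] lies inside a triangle or inside an edge; in the second
   case the star of [p] after subdivision is a quadrilateral, one of whose two
   diagonals was the edge. *)
Lemma stellar_fiber T1 T2 T3 :
  is_lattice_triangulation R T1 -> is_lattice_triangulation R T2 ->
  is_lattice_triangulation R T3 ->
  p \notin cover T1 -> p \notin cover T2 -> p \notin cover T3 ->
  stellar R T1 p = stellar R T2 p -> stellar R T2 p = stellar R T3 p ->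
  [\/ T1 = T2, T2 = T3 | T3 = T1].
Proof.
move=> tri1 tri2 tri3 p1 p2 p3 e12 e23.
have meet T T' a : is_lattice_triangulation R T -> is_lattice_triangulation R T' ->
    p \notin cover T -> p \notin cover T' -> stellar R T p = stellar R T' p ->
    a \in carrier R T p -> a \in carrier R T' p -> T = T'.
  move=> triT triT' pT pT' e aT aT'.
  rewrite (stellar_recover triT pT) (stellar_recover triT' pT') e.
  suff -> : carrier R T p = carrier R T' p by [].
  by apply/eqP; rewrite eqEsubset (carrier_meet triT' triT pT' pT _ aT' aT) //;
    rewrite (carrier_meet triT triT' pT pT' _ aT aT').
have e13 : stellar R T1 p = stellar R T3 p by rewrite e12.
have [x _ xG] := carrier_other tri1 p1 p; have [b bx bG] := carrier_other tri1 p1 x.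
have [c1 _ c1G] := carrier_other tri2 p2 p; have [c2 c21 c2G] := carrier_other tri2 p2 c1.
have [c3 _ c3G] := carrier_other tri3 p3 p.
have [c1n|c1n] := boolP (c1 \in carrier R T1 p); first by constructor 1; apply: (meet _ _ c1).
have [c2n|c2n] := boolP (c2 \in carrier R T1 p); first by constructor 1; apply: (meet _ _ c2).
have [c3n|c3n] := boolP (c3 \in carrier R T1 p).
  by constructor 3; apply: (meet _ _ c3).
have [c3n2|c3n2] := boolP (c3 \in carrier R T2 p).
  by constructor 2; apply: (meet _ _ c3).
(* In the remaining case three triangles of [T1], with apexes [c1], [c2] and [c3], share the edge
   [x b] and lie pairwise on opposite sides of it; three negative products of signs are
   impossible. *)
have xb : x != b by rewrite eq_sym.
have key (T : {set {set point}}) c : is_lattice_triangulation R T -> p \notin cover T ->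
    stellar R T1 p = stellar R T p -> c \in carrier R T p -> c \notin carrier R T1 p ->
    [/\ x != c, b != c & [set x; b; c] \in T1].
  move=> triT pT e cG cn; have [A [AT GA cA]] := stellar_inv tri1 triT p1 pT e cG.
  have xc : x != c by apply: contraNneq cn => <-.
  have bc : b != c by apply: contraNneq cn => <-.
  by split=> //; rewrite -(set3_eq (tri_card tri1 AT) (subsetP GA _ xG) (subsetP GA _ bG) cA).
have [xc1 bc1 Tc1] := key _ _ tri2 p2 e12 c1G c1n.
have [xc2 bc2 Tc2] := key _ _ tri2 p2 e12 c2G c2n.
have [xc3 bc3 Tc3] := key _ _ tri3 p3 e13 c3G c3n.
have c12 : c1 != c2 by rewrite eq_sym.
have c13 : c1 != c3 by apply: contraNneq c3n2 => <-.
have c23 : c2 != c3 by apply: contraNneq c3n2 => <-.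
have s12 := tri_sides tri1 xb xc1 bc1 xc2 bc2 c12 Tc1 Tc2.
have s13 := tri_sides tri1 xb xc1 bc1 xc3 bc3 c13 Tc1 Tc3.
have s23 := tri_sides tri1 xb xc2 bc2 xc3 bc3 c23 Tc2 Tc3.
by suff : (0 : R) < 0 by [rewrite ltxx]; nra.
Qed.

End Fiber.

Definition triangulations (U : {set point}) : {set {set {set point}}} :=
  [set T | `[< is_lattice_triangulation R T >] && (~: cover T == U)].

Lemma triangulationsP U T : reflect (is_lattice_triangulation R T /\ ~: cover T = U)
  (T \in triangulations U).
Proof.
by rewrite inE; apply: (iffP andP) => [[/asboolP ? /eqP]|[/asboolP ? /eqP]].
Qed.

Lemma card_triangulations U : (#|triangulations U| <= 2 ^ #|U| * #|triangulations set0|)%N.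
Proof.
move Uk : #|U| => k; elim: k U Uk => [|k IH] U Uk.
  by rewrite expn0 mul1n; move/eqP: Uk; rewrite cards_eq0 => /eqP ->.
have /set0Pn[p pU] : U != set0 by rewrite -cards_eq0 Uk.
have unusedU T : T \in triangulations U -> is_lattice_triangulation R T /\ p \notin cover T.
  by move=> /triangulationsP[triT cU]; split=> //; move: pU; rewrite -cU inE.
apply: (@leq_trans (2 * #|triangulations (U :\ p)|)); last first.
  rewrite expnS -mulnA leq_pmul2l //; apply: IH.
  by have := cardsD1 p U; rewrite Uk pU => -[].
apply: leq_trans (leq_card_fibers2 (f := fun T => stellar R T p) _) _.
  move=> T1 T2 T3 /unusedU[? ?] /unusedU[? ?] /unusedU[? ?]; exact: stellar_fiber.
rewrite leq_pmul2l //; apply: subset_leq_card; apply/subsetP => _ /imsetP[T TU ->].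
have [triT pT] := unusedU _ TU; have /triangulationsP[_ cU] := TU.
apply/triangulationsP; split; first exact: stellar_tri.
by rewrite stellar_cover // setCU cU setIC setDE.
Qed.

Lemma fnp_le : (fnp R m n <= 3 ^ (m.+1 * n.+1) * #|triangulations set0|)%N.
Proof.
have -> : fnp R m n = (\sum_(U : {set point}) #|triangulations U|)%N.
  rewrite /fnp -sum1_card (partition_big (fun T : {set {set point}} => ~: cover T) xpredT) //=.
  by apply: eq_bigr => U _; rewrite sum1dep_card cardsE.
apply: (@leq_trans (\sum_(U : {set point}) 2 ^ #|U| * #|triangulations set0|)%N).
  by apply: leq_sum => U _; exact: card_triangulations.
rewrite -big_distrl /= leq_mul2r; apply/orP; right.
have -> : (\sum_(U : {set point}) 2 ^ #|U| = \prod_(p : point) (2 + 1))%N.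
  rewrite bigA_distr; apply: eq_bigr => U _.
  rewrite -big_mkcond /= prod_nat_const //.
by rewrite prod_nat_const card_prod !card_ord.
Qed.

End Star.

(** * Triangulations using every lattice point *)

(** To be applied to twice the barycentric coordinates of a half-integral point in a unimodular
    triangle. *)
Lemma sum_to_two (x y z : int) : 0 <= x -> 0 <= y -> 0 <= z -> x + y + z = 2 ->
  [\/ [\/ [/\ x = 2, y = 0 & z = 0], [/\ x = 0, y = 2 & z = 0] | [/\ x = 0, y = 0 & z = 2]],
    [/\ x = 1, y = 1 & z = 0], [/\ x = 1, y = 0 & z = 1] | [/\ x = 0, y = 1 & z = 1]].
Proof.
move=> x0 y0 z0 s.
have ex : x = 0 \/ x = 1 \/ x = 2 by lia.
have ey : y = 0 \/ y = 1 \/ y = 2 by lia.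
case: ex => [e|[e|e]]; case: ey => [e'|[e'|e']]; first
  [ by constructor 1; constructor 1; split; lia | by constructor 1; constructor 2; split; lia
  | by constructor 1; constructor 3; split; lia | by constructor 2; split; lia
  | by constructor 3; split; lia | by constructor 4; split; lia | lia].
Qed.

Section Full.
Variables (R : realType) (m n : nat).
Local Notation point := (lattice_point m n).
Local Notation co := (@coord R m n).
Implicit Types (A B e : {set point}) (T : {set {set point}}) (x y : R * R)
  (a b c d p q : point).

Definition full_triangulation T : Prop :=
  is_lattice_triangulation R T /\ cover T = setT.

Lemma full_vertex T A p : full_triangulation T -> A \in T -> hull A (co p) -> p \in A.
Proof. by move=> [triT cT] AT; apply: (tri_vertex triT AT); rewrite cT. Qed.

Lemma full_face_vertex T A B p : full_triangulation T -> A \in T -> B \subset A ->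
  hull B (co p) -> p \in B.
Proof.
move=> fT AT BA hB; have pA := full_vertex fT AT (hull_sub BA hB).
exact: face_vertex fT.1 AT BA pA hB.
Qed.

Definition iorient a b c : int :=
  ((b.1 : nat)%:Z - (a.1 : nat)%:Z) * ((c.2 : nat)%:Z - (a.2 : nat)%:Z) -
  ((b.2 : nat)%:Z - (a.2 : nat)%:Z) * ((c.1 : nat)%:Z - (a.1 : nat)%:Z).

Lemma orient_int a b c : orient (co a) (co b) (co c) = (iorient a b c)%:~R.
Proof. rewrite /orient /iorient !(intrB, intrM). done. Qed.

(* A non-unimodular lattice parallelogram contains a lattice point
   [(r u + s v) / D] which is not a corner; by central symmetry it may be taken
   in the triangle. *)
Lemma parallelogram_point (u1 u2 v1 v2 : int) :
  let D := u1 * v2 - u2 * v1 in 1 < D ->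
  exists r s w1 w2 : int,
    [/\ 0 <= r, 0 <= s, r + s <= D, 0 < r < D \/ 0 < s < D &
        D * w1 = r * u1 + s * v1 /\ D * w2 = r * u2 + s * v2].
Proof.
move=> D D1; have D0 : 0 < D by lia.
suff [r [s [w1 [w2 [r0 rD s0 [sD rs e1 e2]]]]]] : exists r s w1 w2 : int,
    [/\ 0 <= r, r < D, 0 <= s & [/\ s < D, 0 < r \/ 0 < s,
       D * w1 = r * u1 + s * v1 & D * w2 = r * u2 + s * v2]].
  have [le|gt] := leP (r + s) D; first by exists r, s, w1, w2; split=> //; lia.
  exists (D - r), (D - s), (u1 + v1 - w1), (u2 + v2 - w2); split; [lia|lia|lia|lia|].
  split; rewrite [LHS]mulrBr ?e1 ?e2 /D; ring.
(* Up to the factor [D], these are the coordinates of the lattice vector [(f1, f2)] in the basis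
   [u], [v]; reducing them modulo [D] translates the vector into the parallelogram. *)
have lift (f1 f2 : int) : ((f1 * v2 - f2 * v1) %% D)%Z != 0 \/
    ((u1 * f2 - u2 * f1) %% D)%Z != 0 -> exists r s w1 w2 : int,
    [/\ 0 <= r, r < D, 0 <= s & [/\ s < D, 0 < r \/ 0 < s,
       D * w1 = r * u1 + s * v1 & D * w2 = r * u2 + s * v2]].
  move=> nz; set r := ((f1 * v2 - f2 * v1) %% D)%Z; set s := ((u1 * f2 - u2 * f1) %% D)%Z.
  have r0 : 0 <= r by apply: modz_ge0; lia.
  have s0 : 0 <= s by apply: modz_ge0; lia.
  have rD : r < D by apply: ltz_pmod.
  have sD : s < D by apply: ltz_pmod.
  have er := divz_eq (f1 * v2 - f2 * v1) D; have es := divz_eq (u1 * f2 - u2 * f1) D.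
  rewrite -/r in er; rewrite -/s in es.
  set k := (_ %/ D)%Z in er; set l := (_ %/ D)%Z in es.
  exists r, s, (f1 - k * u1 - l * v1), (f2 - k * u2 - l * v2); split=> //; split=> //.
  - by case: nz; rewrite -/r -/s; lia.
  - have -> : r = (f1 * v2 - f2 * v1) - k * D by rewrite er; ring.
    have -> : s = (u1 * f2 - u2 * f1) - l * D by rewrite es; ring.
    by rewrite /D; ring.
  - have -> : r = (f1 * v2 - f2 * v1) - k * D by rewrite er; ring.
    have -> : s = (u1 * f2 - u2 * f1) - l * D by rewrite es; ring.
    by rewrite /D; ring.
have [h|/norP[/negbNE h1 /negbNE h2]] :=
  boolP ((((1 * v2 - 0 * v1) %% D)%Z != 0) || (((u1 * 0 - u2 * 1) %% D)%Z != 0)).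
  by apply: (lift 1 0); apply/orP.
have [h|/norP[/negbNE h3 /negbNE h4]] :=
  boolP ((((0 * v2 - 1 * v1) %% D)%Z != 0) || (((u1 * 1 - u2 * 0) %% D)%Z != 0)).
  by apply: (lift 0 1); apply/orP.
have dv (x : int) : (x %% D)%Z == 0 -> exists k, x = k * D.
  by move=> /eqP/dvdz_mod0P/dvdzP.
have [[k1 e1] [k2 e2] [k3 e3] [k4 e4]] := And4 (dv _ h1) (dv _ h2) (dv _ h3) (dv _ h4).
(* If neither unit vector gives a nonzero residue, all entries of [u] and [v] are multiples of [D],
   so [D ^+ 2] divides [D]. *)
have eD : D * (D * (k4 * k1 - k2 * k3) - 1) = 0.
  have e1' : v2 = k1 * D by rewrite -e1; ring.
  have e2' : - u2 = k2 * D by rewrite -e2; ring.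
  have e3' : - v1 = k3 * D by rewrite -e3; ring.
  have e4' : u1 = k4 * D by rewrite -e4; ring.
  have -> : D * (D * (k4 * k1 - k2 * k3) - 1) =
     (k4 * D) * (k1 * D) - (k2 * D) * (k3 * D) - D by ring.
  by rewrite -e1' -e2' -e3' -e4' /D; ring.
move/eqP: eD; rewrite mulf_eq0 gt_eqF //= subr_eq0 => /eqP eD.
have := dvdz_mulr (k4 * k1 - k2 * k3) (dvdzz D); rewrite eD dvdz1; lia.
Qed.

(** For [D > 1] the point found by [parallelogram_point] has barycentric coordinates [D - r - s],
    [r], [s], each divided by [D]. Since all lattice points are used it would be a vertex, against
    [0 < r < D] or [0 < s < D]. *)
Lemma full_unimodular T a b c : full_triangulation T ->
  a != b -> a != c -> b != c -> [set a; b; c] \in T ->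
  orient (co a) (co b) (co c) = 1 \/ orient (co a) (co b) (co c) = - 1.
Proof.
move=> fT; wlog D0 : b c / 0 < iorient a b c => [th|] ab ac bc AT.
  have [lt0|ge0|eq0] := ltgtP (iorient a b c) 0; last first.
  - by have := indep_orient ab ac bc (tri_indep fT.1 AT); rewrite orient_int eq0 eqxx.
  - exact: th.
  have AT' : [set a; c; b] \in T by rewrite setUAC.
  have swap : orient (co a) (co c) (co b) = - orient (co a) (co b) (co c).
    by rewrite /orient; ring.
  have o1 : 0 < iorient a c b.
    have -> : iorient a c b = - iorient a b c by rewrite /iorient; ring.
    by rewrite oppr_gt0.
  have cb : c != b by rewrite eq_sym.
  by have := th c b o1 ac ab cb AT'; rewrite swap => -[] h; [right|left]; lra.
have C0 : orient (co a) (co b) (co c) != 0.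
  exact: indep_orient ab ac bc (tri_indep fT.1 AT).
left; rewrite orient_int; suff -> : iorient a b c = 1 by [].
apply/eqP; rewrite eq_le -[X in _ && X]gtz0_ge1 D0 andbT leNgt; apply/negP => D1.
have [r [s [w1 [w2 [r0 s0 rsD nc [e1 e2]]]]]] := parallelogram_point D1.
rewrite -/(iorient a b c) in rsD nc e1 e2; set D := iorient a b c in D0 D1 rsD nc e1 e2.
(* [D * (x + w)] is a combination of [x], [y] and [z] with nonnegative weights of sum [D], so the
   new point stays in the rectangle. *)
have box (x y z w : int) k : 0 <= x <= k -> 0 <= y <= k -> 0 <= z <= k ->
    D * w = r * (y - x) + s * (z - x) -> 0 <= x + w <= k.
  move=> /andP[x0 xk] /andP[y0 yk] /andP[z0 zk] e.
  have e' : D * (x + w) = (D - r - s) * x + r * y + s * z by rewrite mulrDr e; ring.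
  have q0 : 0 <= D - r - s by lia.
  have l0 : 0 <= D * (x + w) by rewrite e' !addr_ge0 // mulr_ge0.
  have lk : D * (x + w) <= D * k.
    have -> : D * k = (D - r - s) * k + r * k + s * k by ring.
    by rewrite e' !lerD // ler_wpM2l.
  by move: l0 lk; rewrite pmulr_rge0 // ler_pM2l // => -> ->.
have bd1 (p : point) : 0 <= (p.1 : nat)%:Z <= m%:Z by rewrite /= lez_nat leq_ord.
have bd2 (p : point) : 0 <= (p.2 : nat)%:Z <= n%:Z by rewrite /= lez_nat leq_ord.
have /andP[x0 xm] := box _ _ _ _ _ (bd1 a) (bd1 b) (bd1 c) e1.
have /andP[y0 yn] := box _ _ _ _ _ (bd2 a) (bd2 b) (bd2 c) e2.
pose p : point := (inord (absz ((a.1 : nat)%:Z + w1)), inord (absz ((a.2 : nat)%:Z + w2))).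
have p1 : (p.1 : nat)%:Z = (a.1 : nat)%:Z + w1 by rewrite inordK ?gez0_abs //; lia.
have p2 : (p.2 : nat)%:Z = (a.2 : nat)%:Z + w2 by rewrite inordK ?gez0_abs //; lia.
have oC : iorient a p c = r.
  apply: (mulfI (lt0r_neq0 D0)); rewrite /iorient p1 p2.
  have -> : D * (((a.1 : nat)%:Z + w1 - (a.1 : nat)%:Z) * ((c.2 : nat)%:Z - (a.2 : nat)%:Z) -
    ((a.2 : nat)%:Z + w2 - (a.2 : nat)%:Z) * ((c.1 : nat)%:Z - (a.1 : nat)%:Z)) =
    (D * w1) * ((c.2 : nat)%:Z - (a.2 : nat)%:Z) - (D * w2) * ((c.1 : nat)%:Z - (a.1 : nat)%:Z) by ring.
  by rewrite e1 e2 /D /iorient; ring.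
have oB : iorient a b p = s.
  apply: (mulfI (lt0r_neq0 D0)); rewrite /iorient p1 p2.
  have -> : D * (((b.1 : nat)%:Z - (a.1 : nat)%:Z) * ((a.2 : nat)%:Z + w2 - (a.2 : nat)%:Z) -
    ((b.2 : nat)%:Z - (a.2 : nat)%:Z) * ((a.1 : nat)%:Z + w1 - (a.1 : nat)%:Z)) =
    ((b.1 : nat)%:Z - (a.1 : nat)%:Z) * (D * w2) - ((b.2 : nat)%:Z - (a.2 : nat)%:Z) * (D * w1) by ring.
  by rewrite e1 e2 /D /iorient; ring.
have oA : iorient p b c = D - r - s by rewrite -oC -oB /D /iorient; ring.
have pA : p \in [set a; b; c].
  apply: (full_vertex fT AT); apply/(tri_hullP (co p) ab ac bc C0).
  rewrite !orient_int oA oB oC -/D; split; apply: divr_ge0; rewrite ler0z; lia.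
move: pA oC oB; rewrite !inE => /orP[/orP[]|] /eqP ->; move: nc;
  rewrite /D /iorient; lia.
Qed.

Definition edges T : {set {set point}} :=
  [set e : {set point} | (#|e| == 2%N) && [exists A in T, e \subset A]].

Lemma edgesP T e : reflect (#|e| = 2%N /\ exists2 A, A \in T & e \subset A)
  (e \in edges T).
Proof.
rewrite inE; apply: (iffP andP) => [[/eqP e2 /exists_inP[A AT eA]]|[-> [A AT eA]]].
  by split=> //; exists A.
by split=> //; apply/exists_inP; exists A.
Qed.

Lemma edge_in T A a b : A \in T -> a \in A -> b \in A -> a != b ->
  [set a; b] \in edges T.
Proof.
move=> AT aA bA ab; apply/edgesP; rewrite cards2 ab; split=> //.
by exists A; rewrite // subUset !sub1set aA.
Qed.

Lemma edge_vertex T e p : full_triangulation T -> e \in edges T ->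
  hull e (co p) -> p \in e.
Proof. by move=> fT /edgesP[_ [A AT eA]]; apply: full_face_vertex fT AT eA. Qed.

Lemma edges_face T e e' x : full_triangulation T -> e \in edges T -> e' \in edges T ->
  hull e x -> hull e' x -> hull (e :&: e') x.
Proof.
by move=> fT /edgesP[_ [A AT eA]] /edgesP[_ [B BT eB]]; apply: (tri_face fT.1 AT BT eA eB).
Qed.

Lemma edge_tri_face T e A x : full_triangulation T -> e \in edges T -> A \in T ->
  hull e x -> hull A x -> hull (e :&: A) x.
Proof.
by move=> fT /edgesP[_ [B BT eB]] AT; apply: (tri_face fT.1 BT AT eB (subxx _)).
Qed.

Lemma hull_set0 x : ~ hull (set0 : {set point}) x.
Proof. by move=> /hullP[w /bary_nonempty[p]]; rewrite inE. Qed.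

Lemma hull_small (e : {set point}) x : hull e x -> (#|e| <= 1)%N ->
  exists2 p, p \in e & x = co p.
Proof.
move=> he; case ce : #|e| => [|[|//]] _.
  by case: (@hull_set0 x); rewrite -(cards0_eq ce).
move/eqP/cards1P: ce he => [p ->] /hull1 ->; by exists p; rewrite ?set11.
Qed.

Lemma edge_meet T e e' x : full_triangulation T -> e \in edges T -> e' \in edges T ->
  e != e' -> hull e x -> hull e' x -> exists p, [/\ p \in e, p \in e' & x = co p].
Proof.
move=> fT eT eT' ee' he he'; have hI := edges_face fT eT eT' he he'.
have [|p] := hull_small hI; last by rewrite inE => /andP[pe pe'] ->; exists p.
have /edgesP[e2 _] := eT; have /edgesP[e2' _] := eT'.
rewrite leqNgt; apply: contra ee' => lt; apply/eqP.
have eI : e :&: e' = e by apply/eqP; rewrite eqEcard subsetIl e2.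
by apply/eqP; rewrite eqEcard e2 e2' -{1}eI subsetIr.
Qed.

Lemma hull_pair a b t : 0 <= t <= 1 -> hull [set a; b] (lerp t (co a) (co b)).
Proof.
by move=> t01; apply: hull_lerp => //; apply: hull_vertex; rewrite !inE eqxx ?orbT.
Qed.

Definition midpoint a b : R * R := lerp (1 / 2) (co a) (co b).

Lemma midpoint_eq a b c d : (a.1 + b.1 = c.1 + d.1 :> nat)%N ->
  (a.2 + b.2 = c.2 + d.2 :> nat)%N -> midpoint a b = midpoint c d.
Proof.
move=> e1 e2; have f1 : ((a.1 : nat)%:R + (b.1 : nat)%:R : R) = (c.1 : nat)%:R + (d.1 : nat)%:R.
  by rewrite -!natrD e1.
have f2 : ((a.2 : nat)%:R + (b.2 : nat)%:R : R) = (c.2 : nat)%:R + (d.2 : nat)%:R.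
  by rewrite -!natrD e2.
by rewrite /midpoint /lerp /=; congr pair; lra.
Qed.

Lemma hull_midpoint a b : hull [set a; b] (midpoint a b).
Proof. by apply: hull_pair; lra. Qed.

Lemma midpoint_vertex a b : (midpoint a b = co a \/ midpoint a b = co b) -> a = b.
Proof.
move=> h; apply: (@coord_inj R m n).
rewrite (surjective_pairing (co a)) (surjective_pairing (co b)).
by case: h => -[h1 h2]; rewrite /lerp /= in h1 h2; congr pair; move: h1 h2 => /=; lra.
Qed.

(** Distinct edges meet at most in a common vertex, and a midpoint is never an end of its edge. *)
Lemma same_midpoint T a b c d : full_triangulation T ->
  [set a; b] \in edges T -> [set c; d] \in edges T ->
  (a.1 + b.1 = c.1 + d.1 :> nat)%N -> (a.2 + b.2 = c.2 + d.2 :> nat)%N ->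
  [set a; b] = [set c; d].
Proof.
move=> fT abT cdT e1 e2; apply/eqP; apply: contraT => ne.
have mE := midpoint_eq e1 e2.
have h := hull_midpoint c d; rewrite -mE in h.
have [p [pe _ mp]] := edge_meet fT abT cdT ne (hull_midpoint a b) h.
have ab : a = b.
  by apply: midpoint_vertex; move: pe mp; rewrite !inE => /orP[] /eqP ->; [left|right].
by have /edgesP[] := abT; rewrite ab setUid cards1.
Qed.

Lemma edge_midpoint T a b p : full_triangulation T -> [set a; b] \in edges T ->
  ~ (a.1 + b.1 = 2 * p.1 /\ a.2 + b.2 = 2 * p.2)%N.
Proof.
move=> fT abT [e1 e2]; have mE : midpoint a b = co p.
  rewrite (@midpoint_eq a b p p) ?e1 ?e2 ?mul2n ?addnn //.
  by rewrite /midpoint /lerp /coord /=; congr pair; ring.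
have hp := hull_midpoint a b; rewrite mE in hp.
have ab : a = b.
  apply: midpoint_vertex; rewrite mE; have := edge_vertex fT abT hp.
  by rewrite !inE => /orP[] /eqP ->; [left|right].
by have /edgesP[] := abT; rewrite ab setUid cards1.
Qed.

(** In the unimodular triangle containing the point, twice its barycentric coordinates are
    nonnegative integers of sum 2. If one of them is 2, the point is integral; otherwise two of them
    are 1, and it is the midpoint of a side. *)
Lemma half_point_edge T i j : full_triangulation T -> (i <= m.*2)%N -> (j <= n.*2)%N ->
  ~~ (~~ odd i && ~~ odd j) ->
  exists a b, [/\ [set a; b] \in edges T, a.1 + b.1 = i :> nat & a.2 + b.2 = j :> nat]%N.
Proof.
move=> fT im jn odd_ij; pose x : R * R := (i%:R / 2, j%:R / 2).
have rx : @rectangle R m n x.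
  rewrite /rectangle /= !divr_ge0 //= !ler_pdivrMr // -!natrM !ler_nat.
  by rewrite !muln2 im jn.
have [A AT hA] := tri_cover fT.1 rx.
have [a [b [c [ab ac bc AE]]]] := cards3P (tri_card fT.1 AT); rewrite AE in AT hA.
have D1 := full_unimodular fT ab ac bc AT.
have D0 : orient (co a) (co b) (co c) != 0 by case: D1 => ->; rewrite ?oppr_eq0 oner_eq0.
have /hullP[w bw] := hA.
have wE := bary_weightE ab ac bc D0 bw.
have [wa wb wc] := tri_weightE x ab ac bc; rewrite -!wE in wa wb wc.
have [w0 wA w1 wx wy] := bw.
rewrite (sum_supported1 wA) big_set3 // in w1.
rewrite (sum_supported _ wA) big_set3 // in wx; rewrite (sum_supported _ wA) big_set3 // in wy.
have Dinv z : z / orient (co a) (co b) (co c) = z * orient (co a) (co b) (co c).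
  by case: D1 => ->; rewrite ?invrN invr1.
have int_half (p q : point) : exists k : int, 2 * orient (co p) (co q) x = k%:~R.
  exists (((q.1 : nat)%:Z - (p.1 : nat)%:Z) * (j%:Z - (p.2 : nat)%:Z - (p.2 : nat)%:Z) -
     ((q.2 : nat)%:Z - (p.2 : nat)%:Z) * (i%:Z - (p.1 : nat)%:Z - (p.1 : nat)%:Z)).
  by rewrite /orient /= !(intrB, intrM); field.
have int_w (p q : point) : exists k : int,
    2 * (orient (co p) (co q) x / orient (co a) (co b) (co c)) = k%:~R.
  have [k kE] := int_half p q; rewrite Dinv mulrA kE.
  by case: D1 => ->; [exists k|exists (- k)]; rewrite ?mulr1 // mulrN1 intrN.
have [ka kaE] := int_w b c; have [kb kbE] := int_w c a; have [kc kcE] := int_w a b.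
have wa' : 2 * w a = ka%:~R by rewrite wa -orientC kaE.
have wb' : 2 * w b = kb%:~R by rewrite wb -orientC -orientC kbE.
have wc' : 2 * w c = kc%:~R by rewrite wc kcE.
have pos p k : 2 * w p = k%:~R -> 0 <= k.
  by move=> e; rewrite -(ler0z R) -e mulr_ge0.
have [ka0 kb0 kc0] := And3 (pos _ _ wa') (pos _ _ wb') (pos _ _ wc').
have sum2 : ka + kb + kc = 2.
  by apply: (@intr_inj R); rewrite !intrD -wa' -wb' -wc' -!mulrDr w1 mulr1.
have coordE (f : point -> nat) k : (k%:R / 2 : R) =
    w a * (f a)%:R + w b * (f b)%:R + w c * (f c)%:R ->
    k%:Z = ka * (f a)%:Z + kb * (f b)%:Z + kc * (f c)%:Z.
  move=> e; apply: (@intr_inj R); rewrite !(intrD, intrM) -wa' -wb' -wc'.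
  have -> : k%:~R = 2 * (k%:R / 2) :> R by rewrite mulrC divfK.
  by rewrite e; ring.
have ex := coordE (fun p => p.1 : nat) i wx; have ey := coordE (fun p => p.2 : nat) j wy.
have even_false (p : point) : i = (2 * p.1)%N -> j = (2 * p.2)%N -> False.
  by move=> ei ej; move: odd_ij; rewrite ei ej !mul2n !odd_double.
have mem p q : p \in [set a; b; c] -> q \in [set a; b; c] -> p != q ->
    i = (p.1 + q.1)%N -> j = (p.2 + q.2)%N ->
    exists a b, [/\ [set a; b] \in edges T, a.1 + b.1 = i :> nat & a.2 + b.2 = j :> nat]%N.
  by move=> pA qA pq ei ej; exists p, q; split=> //; apply: edge_in AT pA qA pq.
case: (sum_to_two ka0 kb0 kc0 sum2) => [[||]|||] [e1 e2 e3]; rewrite e1 e2 e3 in ex ey.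
- by case: (even_false a); lia.
- by case: (even_false b); lia.
- by case: (even_false c); lia.
- by apply: (mem a b); rewrite ?inE ?eqxx ?orbT //; lia.
- by apply: (mem a c); rewrite ?inE ?eqxx ?orbT //; lia.
- by apply: (mem b c); rewrite ?inE ?eqxx ?orbT //; lia.
Qed.

End Full.

(** * Planar estimates for comparing two edges with the same midpoint *)

Lemma first_zero (R : realType) (u0 u1 v0 v1 : R) : 0 < u0 -> 0 < v0 ->
  u1 < 0 \/ v1 < 0 -> exists k, [/\ 0 < k, k < 1 &
    (u0 + k * (u1 - u0) = 0 /\ 0 <= v0 + k * (v1 - v0)) \/
    (v0 + k * (v1 - v0) = 0 /\ 0 <= u0 + k * (u1 - u0))].
Proof.
have zero (u u' : R) : 0 < u -> u' < 0 -> exists k, [/\ 0 < k, k < 1 & u + k * (u' - u) = 0].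
  move=> up un; have w0 : 0 < u - u' by lra.
  exists (u / (u - u')); split; first by rewrite divr_gt0.
  - by rewrite ltr_pdivrMr //; lra.
  - by field; rewrite gt_eqF.
have later (u u' k k' : R) : 0 < u -> 0 < k <= k' -> u + k' * (u' - u) = 0 ->
    0 <= u + k * (u' - u).
  move=> up /andP[k0 kk'] e; have [d|d] := leP 0 (u' - u); first by nra.
  have : k' * (u' - u) <= k * (u' - u) by rewrite ler_wnM2r // ltW.
  lra.
move=> u0p v0p; have [u1n|u1p] := ltP u1 0; have [v1n|v1p] := ltP v1 0 => h; last by lra.
- have [k [k0 k1 e]] := zero _ _ u0p u1n; have [l [l0 l1 f]] := zero _ _ v0p v1n.
  have [kl|lk] := leP k l.
    by exists k; split=> //; left; split=> //; apply: (later _ _ _ l) => //; rewrite k0.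
  by exists l; split=> //; right; split=> //; apply: (later _ _ _ k) => //; rewrite l0 ltW.
- have [k [k0 k1 e]] := zero _ _ u0p u1n; exists k; split=> //; left; split=> //; nra.
- have [k [k0 k1 e]] := zero _ _ v0p v1n; exists k; split=> //; right; split=> //; nra.
Qed.

(* Barycentric coordinates, up to the factor [bdet], of the point [(x, y)] in the
   triangle with vertices [(0, 0)], [(x2, y2)] and [(S1 / 2, S2 / 2)]. *)
Section TriangleCoordinates.
Variables (R : realType) (S1 S2 x2 y2 : R).

Definition bdet : R := S1 * y2 - S2 * x2.
Definition bar2 (x y : R) : R := S1 * y - S2 * x.
Definition barq (x y : R) : R := 2 * (x * y2 - y * x2).
Definition bar1 (x y : R) : R := bdet - bar2 x y - barq x y.
Definition inside (x y : R) : bool := [&& 0 <= bar1 x y, 0 <= bar2 x y & 0 <= barq x y].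

Lemma bar_x x y : x * bdet = bar2 x y * x2 + barq x y * (S1 / 2).
Proof. by rewrite /bdet /bar2 /barq; field. Qed.

Lemma bar_y x y : y * bdet = bar2 x y * y2 + barq x y * (S2 / 2).
Proof. by rewrite /bdet /bar2 /barq; field. Qed.

Lemma inside_linear x y la mu : 0 < bdet -> inside x y ->
  0 < x2 * la + y2 * mu -> 2 * (x2 * la + y2 * mu) < S1 * la + S2 * mu ->
  0 <= x * la + y * mu <= (S1 * la + S2 * mu) / 2.
Proof.
move=> D_gt0 /and3P[u1 u2 uq] f2 f2q.
have e : bdet * (x * la + y * mu) =
    bar2 x y * (x2 * la + y2 * mu) + barq x y * ((S1 * la + S2 * mu) / 2).
  have -> : bdet * (x * la + y * mu) = (x * bdet) * la + (y * bdet) * mu by ring.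
  by rewrite (bar_x x y) (bar_y x y); field.
have uD : bar2 x y + barq x y <= bdet by rewrite /bar1 in u1; lra.
have fq : 0 < (S1 * la + S2 * mu) / 2 by lra.
have f2le : x2 * la + y2 * mu <= (S1 * la + S2 * mu) / 2 by lra.
apply/andP; split; first by rewrite -(pmulr_rge0 _ D_gt0) e addr_ge0 // mulr_ge0 // ltW.
rewrite -(ler_pM2l D_gt0) e.
apply: (@le_trans _ _ ((bar2 x y + barq x y) * ((S1 * la + S2 * mu) / 2))).
  by rewrite [leRHS]mulrDl lerD2r ler_wpM2l.
by rewrite ler_wpM2r // ltW.
Qed.

Lemma inside_linear_eq x y la mu : 0 < bdet -> inside x y ->
  2 * (x2 * la + y2 * mu) < S1 * la + S2 * mu -> 0 < x2 * la + y2 * mu ->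
  (S1 * la + S2 * mu) / 2 <= x * la + y * mu -> bar2 x y = 0 /\ 0 < barq x y.
Proof.
move=> D_gt0 /and3P[u1 u2 uq] f2q f2 fxy.
have e : bdet * (x * la + y * mu) =
    bar2 x y * (x2 * la + y2 * mu) + barq x y * ((S1 * la + S2 * mu) / 2).
  have -> : bdet * (x * la + y * mu) = (x * bdet) * la + (y * bdet) * mu by ring.
  by rewrite (bar_x x y) (bar_y x y); field.
have uD : bar2 x y + barq x y <= bdet by rewrite /bar1 in u1; lra.
move: fxy; rewrite -(ler_pM2l D_gt0) e; move: f2 f2q.
set F := S1 * la + S2 * mu; set f := x2 * la + y2 * mu => f2 f2q fxy.
have fq : 0 < F / 2 by lra.
have p1 : (bar2 x y + barq x y) * (F / 2) <= bdet * (F / 2) by rewrite ler_wpM2r // ltW.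
have p2 : bar2 x y * (F / 2 - f) <= 0 by move: fxy p1; clear; lra.
have b0 : bar2 x y = 0.
  apply/le_anti; rewrite u2 andbT; move: p2; rewrite pmulr_lle0 //; lra.
split=> //; rewrite lt_neqAle uq andbT eq_sym; apply: contraTneq fxy => q0.
by rewrite b0 q0 !mul0r addr0 -ltNge mulr_gt0.
Qed.

Lemma bar_affine x y x' y' t :
  [/\ bar1 (x + t * (x' - x)) (y + t * (y' - y)) = bar1 x y + t * (bar1 x' y' - bar1 x y),
      bar2 (x + t * (x' - x)) (y + t * (y' - y)) = bar2 x y + t * (bar2 x' y' - bar2 x y) &
      barq (x + t * (x' - x)) (y + t * (y' - y)) = barq x y + t * (barq x' y' - barq x y)].
Proof. by rewrite /bar1 /bar2 /barq; split; ring. Qed.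

Lemma inside_convex x y x' y' t : inside x y -> inside x' y' -> 0 <= t <= 1 ->
  inside (x + t * (x' - x)) (y + t * (y' - y)).
Proof.
move=> /and3P[u1 u2 uq] /and3P[v1 v2 vq] /andP[t0 t1].
have [e1 e2 eq] := bar_affine x y x' y' t; rewrite /inside e1 e2 eq.
have conv (u v : R) : 0 <= u -> 0 <= v -> 0 <= u + t * (v - u).
  move=> u0 v0; have -> : u + t * (v - u) = (1 - t) * u + t * v by ring.
  by rewrite addr_ge0 // mulr_ge0 // subr_ge0.
by rewrite !conv.
Qed.

(** A point of the line with [x <= 0] would put [mu] between 0 and half of [S1 * la + S2 * mu], the
    range of the linear form on the triangle. In the application [c] is [(1, 0)], [d] is [(0, 1)]
    and [mu] is the level of [d] relative to [a1]; the triangle then meets the line [c d] only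
    inside the edge. *)
Lemma inside_line x y la mu : 0 < S1 -> 0 < S2 -> 2 < S1 + S2 -> 0 < bdet ->
  0 < x2 * la + y2 * mu -> 2 * (x2 * la + y2 * mu) < S1 * la + S2 * mu ->
  mu < 0 \/ S1 * la + S2 * mu < 2 * mu -> inside x y -> x + y = 1 -> 0 < x /\ 0 < y.
Proof.
move=> S1_gt0 S2_gt0 S_gt2 D_gt0 f2 f2q mu_out ins xy.
have /andP[f0 f1] := inside_linear D_gt0 ins f2 f2q; have /and3P[_ u2 _] := ins.
have y0 : 0 < y.
  rewrite -(pmulr_rgt0 _ (_ : 0 < S1 + S2)); last by lra.
  by move: u2; rewrite /bar2 (_ : x = 1 - y); lra.
split=> //; rewrite ltNge; apply/negP => x0.
move: mu_out f0 f1 f2 f2q; set La := S1 * la + S2 * mu => mu_out f0 f1 f2 f2q.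
have La0 : 0 < La by lra.
have ye : y = 1 - x by lra.
have K0 : 0 < S1 - x * (S1 + S2).
  by rewrite -mulNr ltr_wpDr // mulr_ge0; lra.
have e : mu * (S1 - x * (S1 + S2)) = S1 * (x * la + y * mu) + - x * La.
  by rewrite ye /La; ring.
have p1 : 0 <= - x * La by rewrite mulr_ge0 ?oppr_ge0 // ltW.
have mu0 : 0 <= mu.
  by rewrite -(pmulr_lge0 _ K0) e addr_ge0 // mulr_ge0 // ltW.
have p2 : S1 * (x * la + y * mu) <= S1 * (La / 2) by rewrite ler_pM2l.
have p3 : 0 <= - x * La * (S1 + S2 - 2) by rewrite mulr_ge0 //; lra.
have : 2 * mu <= La.
  rewrite -(ler_pM2r K0) -mulrA e.
  have -> : La * (S1 - x * (S1 + S2)) = La * S1 + - x * La * (S1 + S2 - 2) + 2 * (- x * La).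
    by ring.
  by move: p2 p3; clear; lra.
by case: mu_out; lra.
Qed.

End TriangleCoordinates.

(* The segment from [(xp, fp)] to [(xq, fq)] meets the line [f = 1] at the abscissa
   [crossing]; [side] is positive on the points to the right of this segment. *)
Section Crossing.
Variable R : realType.
Implicit Types xp fp xq fq xs fs : R.

Definition crossing xp fp xq fq : R := ((fq - 1) * xp + (1 - fp) * xq) / (fq - fp).
Definition side xp fp xq fq xs fs : R := (xs - xp) * (fq - fp) - (fs - fp) * (xq - xp).

Lemma crossing_left xp fp xq fq xs fs : fp < 1 -> 1 < fq -> fs < 1 ->
  (crossing xs fs xq fq - crossing xp fp xq fq) * ((fq - fs) * (fq - fp)) =
  (fq - 1) * side xp fp xq fq xs fs.
Proof.
move=> p1 q1 s1; rewrite /crossing /side; field.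
by apply/andP; split; rewrite subr_eq0 gt_eqF //; lra.
Qed.

Lemma crossing_right xp fp xq fq xs fs : fp < 1 -> 1 < fq -> 1 < fs ->
  (crossing xp fp xs fs - crossing xp fp xq fq) * ((fs - fp) * (fq - fp)) =
  (1 - fp) * side xp fp xq fq xs fs.
Proof.
move=> p1 q1 s1; rewrite /crossing /side; field.
by apply/andP; split; rewrite subr_eq0 gt_eqF //; lra.
Qed.

Lemma side_crossing xp fp xq fq x : fp < 1 -> 1 < fq ->
  side xp fp xq fq x 1 = (x - crossing xp fp xq fq) * (fq - fp).
Proof.
move=> p1 q1; rewrite /crossing /side; field.
by rewrite subr_eq0 gt_eqF //; lra.
Qed.

Lemma side_affine xp fp xq fq x f x' f' t :
  side xp fp xq fq (x + t * (x' - x)) (f + t * (f' - f)) =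
  side xp fp xq fq x f + t * (side xp fp xq fq x' f' - side xp fp xq fq x f).
Proof. rewrite /side; ring. Qed.

Lemma side_barycentric xp fp xq fq (S1 S2 x2 y2 x y : R) :
  bdet S1 S2 x2 y2 * side xp fp xq fq x (x + y) =
  bar1 S1 S2 x2 y2 x y * side xp fp xq fq 0 0 +
  bar2 S1 S2 x y * side xp fp xq fq x2 (x2 + y2) +
  barq x2 y2 x y * side xp fp xq fq (S1 / 2) ((S1 + S2) / 2).
Proof. by rewrite /bar1 /bdet /bar2 /barq /side; field. Qed.

Lemma side_ends xp fp xq fq : side xp fp xq fq xp fp = 0 /\ side xp fp xq fq xq fq = 0.
Proof. by rewrite /side; split; ring. Qed.

(** Take a pair with the largest crossing and, among these, the smallest gap [f q - f p]. A point to
    the right of the segment could replace the end on its side of the line [f = 1] and increase the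
    crossing; a point on the segment, strictly between the ends, would reduce the gap. *)
Lemma extremal_pair (I : finType) (P : pred I) (x f : I -> R) i j :
  P i -> P j -> f i < 1 -> 1 < f j -> (forall s, P s -> f s <> 1) ->
  exists p q, [/\ P p, P q, f p < 1, 1 < f q &
    forall s, P s -> side (x p) (f p) (x q) (f q) (x s) (f s) <= 0 /\
      (side (x p) (f p) (x q) (f q) (x s) (f s) = 0 -> ~ (f p < f s < f q))].
Proof.
move=> Pi Pj fi fj f1.
pose good (u : I * I) := [&& P u.1, P u.2, f u.1 < 1 & 1 < f u.2].
pose kappa (u : I * I) := crossing (x u.1) (f u.1) (x u.2) (f u.2).
have g0 : good (i, j) by rewrite /good /= Pi Pj fi fj.
have [u gu umax] : exists2 u, good u & forall w, good w -> kappa w <= kappa u.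
  by case: (arg_maxP kappa g0) => u gu umax; exists u.
pose best (v : I * I) := good v && (kappa v == kappa u).
have b0 : best u by rewrite /best gu eqxx.
case: (arg_minP (fun v : I * I => f v.2 - f v.1) b0) => v /andP[gv /eqP kv] vmin.
exists v.1, v.2; have /and4P[P1 P2 v1 v2] := gv; split=> // s Ps.
have gap : 0 < f v.2 - f v.1 by lra.
have [s1|s1] : f s < 1 \/ 1 < f s.
  by have := f1 s Ps; have [| |] := ltgtP (f s) 1; [left|right|].
- have gs : good (s, v.2) by rewrite /good /= Ps P2 s1 v2.
  have e := crossing_left (x v.1) (x v.2) (x s) v1 v2 s1.
  have gaps : 0 < f v.2 - f s by lra.
  split.
    have : kappa (s, v.2) <= kappa v by rewrite kv; apply: umax.
    rewrite -subr_le0 /kappa /=.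
    by rewrite -(pmulr_lle0 _ (mulr_gt0 gaps gap)) e pmulr_rle0 // subr_gt0.
  move=> s0; rewrite s0 mulr0 in e; move/eqP: e.
  rewrite mulf_eq0 (gt_eqF (mulr_gt0 gaps gap)) orbF subr_eq0 => /eqP e /andP[ps _].
  have /vmin /= : best (s, v.2) by rewrite /best gs -kv /kappa /= e eqxx.
  by rewrite lerD2l lerN2 leNgt ps.
have gs : good (v.1, s) by rewrite /good /= Ps P1 s1 v1.
have e := crossing_right (x v.1) (x v.2) (x s) v1 v2 s1.
have gaps : 0 < f s - f v.1 by lra.
split.
  have : kappa (v.1, s) <= kappa v by rewrite kv; apply: umax.
    rewrite -subr_le0 /kappa /=.
  by rewrite -(pmulr_lle0 _ (mulr_gt0 gaps gap)) e pmulr_rle0 // subr_gt0.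
move=> s0; rewrite s0 mulr0 in e; move/eqP: e.
rewrite mulf_eq0 (gt_eqF (mulr_gt0 gaps gap)) orbF subr_eq0 => /eqP e /andP[_ sq].
have /vmin /= : best (v.1, s) by rewrite /best gs -kv /kappa /= e eqxx.
by rewrite lerD2r leNgt sq.
Qed.

End Crossing.

Section Separation.
Variables (R : realType) (m n : nat).
Local Notation point := (lattice_point m n).
Local Notation co := (@coord R m n).

Lemma lerp_vertex (a b p : point) k : a != b -> 0 < k < 1 -> p \in [set a; b] ->
  lerp k (co a) (co b) <> co p.
Proof.
move=> ab /andP[k0 k1] pE h; move/eqP: ab; apply; apply: (@coord_inj R m n).
have k1' : 0 < 1 - k by lra.
have key (u v w : R) : w = u \/ w = v -> u + k * (v - u) = w -> u = v.
  case=> -> e; apply/eqP; rewrite eq_sym -subr_eq0.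
    have /eqP : k * (v - u) = 0 by lra.
    by rewrite mulf_eq0 (gt_eqF k0).
  have /eqP : (1 - k) * (v - u) = 0 by lra.
  by rewrite mulf_eq0 (gt_eqF k1').
have h1 := congr1 fst h; have h2 := congr1 snd h.
rewrite (surjective_pairing (co a)) (surjective_pairing (co b)).
congr pair; [apply: key h1|apply: key h2].
  by move: pE; rewrite !inE => /orP[] /eqP ->; [left|right].
by move: pE; rewrite !inE => /orP[] /eqP ->; [left|right].
Qed.

Lemma edge_neq (T : {set {set point}}) a b : [set a; b] \in edges T -> a != b.
Proof. by move=> /edgesP[e2 _]; apply: contra_eqN e2 => /eqP ->; rewrite setUid cards1. Qed.

Lemma ltW01 (k : R) : 0 < k < 1 -> 0 <= k <= 1.
Proof. by move=> /andP[? ?]; rewrite !ltW. Qed.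

Lemma addrC_subr (k : R) : k + (1 - k) = 1.
Proof. by rewrite addrC subrK. Qed.

Lemma edges_cross (T : {set {set point}}) a b e k : full_triangulation R T ->
  [set a; b] \in edges T -> e \in edges T -> [set a; b] != e -> 0 < k < 1 ->
  hull e (lerp k (co a) (co b)) -> False.
Proof.
move=> fT abT eT ne k01 he.
have [p [pab _]] := edge_meet fT abT eT ne (hull_pair a b (ltW01 k01)) he.
exact: lerp_vertex (edge_neq abT) k01 pab.
Qed.

(* Suppose that an edge [c d] of [T] separates, inside the triangle with vertices
   [a1], [a2] and [q], the vertex [a1] from [a2]; here [q] is the common midpoint
   of [a1 b1] and [a2 b2].  Among the lattice points of this triangle choose two on
   different sides of [c d] such that the segment joining them meets [c d] as close
   to the side [a1 q] as possible.  The edge of [T] through the midpoint of this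
   segment precedes [q]; it cannot leave the triangle through [a1 q] or [a2 q], so
   that one of its ends contradicts the choice of the segment. *)
Lemma edge_not_separating (T T1 : {set {set point}}) (a1 b1 a2 b2 c d : point)
    (X Y L : R * R -> R) (S1 S2 x2 y2 la mu La : R) :
  full_triangulation R T -> full_triangulation R T1 ->
  [set a1; b1] \in edges T1 -> [set a2; b2] \in edges T -> [set c; d] \in edges T ->
  (a1.1 + b1.1 = a2.1 + b2.1 :> nat)%N -> (a1.2 + b1.2 = a2.2 + b2.2 :> nat)%N ->
  (forall t x y, X (lerp t x y) = X x + t * (X y - X x)) ->
  (forall t x y, Y (lerp t x y) = Y x + t * (Y y - Y x)) ->
  (forall x y, X x = X y -> Y x = Y y -> x = y) ->
  X (co a1) = 0 -> Y (co a1) = 0 -> X (co c) = 1 -> Y (co c) = 0 ->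
  X (co d) = 0 -> Y (co d) = 1 -> X (co b1) = S1 -> Y (co b1) = S2 ->
  X (co a2) = x2 -> Y (co a2) = y2 ->
  (forall x, L x = L (co a1) + X x * la + Y x * mu) ->
  (forall u v : point, [set u; v] \in edges T ->
     L (co u) + L (co v) < L (co a1) + L (co b1) -> [set u; v] \in edges T1) ->
  L (co b1) - L (co a1) = La ->
  0 < S1 -> 0 < S2 -> 2 < S1 + S2 -> 0 < bdet S1 S2 x2 y2 ->
  0 < L (co a2) - L (co a1) -> 2 * (L (co a2) - L (co a1)) < La ->
  mu < 0 \/ La < 2 * mu -> La <= la + mu -> False.
Proof.
move=> fT fT1 e1T e2T cdT sum1 sum2 X_lerp Y_lerp XY_inj X_a1 Y_a1 X_c Y_c X_d Y_d
  X_b1 Y_b1 X_a2 Y_a2 L_XY K_sub LaL S1_gt0 S2_gt0 S_gt2 D_gt0 L_a2 L_a2q d_out cd_late.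
pose insidep (p : point) := inside S1 S2 x2 y2 (X (co p)) (Y (co p)).
set D := bdet S1 S2 x2 y2 in D_gt0.
have D0 : D != 0 by rewrite gt_eqF.
have mid_XY (p q r s : point) : (p.1 + q.1 = r.1 + s.1 :> nat)%N ->
    (p.2 + q.2 = r.2 + s.2 :> nat)%N ->
    X (co p) + X (co q) = X (co r) + X (co s) /\ Y (co p) + Y (co q) = Y (co r) + Y (co s).
  move=> e f; have := midpoint_eq R e f; rewrite /midpoint => h.
  have hX := congr1 X h; have hY := congr1 Y h; rewrite !X_lerp in hX; rewrite !Y_lerp in hY.
  by move: hX hY; clear; lra.
have LaE : La = S1 * la + S2 * mu by rewrite -LaL (L_XY (co b1)) X_b1 Y_b1; ring.
have f2E : L (co a2) - L (co a1) = x2 * la + y2 * mu by rewrite (L_XY (co a2)) X_a2 Y_a2; ring.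
rewrite LaE in L_a2q d_out cd_late LaL; rewrite f2E in L_a2 L_a2q.
have lin x y : inside S1 S2 x2 y2 x y -> 0 <= x * la + y * mu <= (S1 * la + S2 * mu) / 2.
  by move=> ins; apply: (inside_linear D_gt0 ins).
have line x y : inside S1 S2 x2 y2 x y -> x + y = 1 -> 0 < x /\ 0 < y.
  by apply: inside_line L_a2q d_out.
have cd_neq := edge_neq cdT.
have on_cd x y : 0 < x -> 0 < y -> x + y = 1 ->
    [/\ 0 < y < 1, X (lerp y (co c) (co d)) = x & Y (lerp y (co c) (co d)) = y].
  by move=> x0 y0 xy; split; rewrite ?X_lerp ?Y_lerp ?X_c ?Y_c ?X_d ?Y_d; lra.
(* Such a lattice point would lie in the interior of the edge [c d]. *)
have insidep_off p : insidep p -> X (co p) + Y (co p) <> 1.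
  move=> ins xy; have [x0 y0] := line _ _ ins xy.
  have [y01 zx zy] := on_cd _ _ x0 y0 xy.
  have zE := XY_inj _ _ zx zy.
  have y01' : 0 <= Y (co p) <= 1 by move: y01 => /andP[? ?]; rewrite !ltW.
  have hp := hull_pair c d y01'; rewrite zE in hp.
  exact: lerp_vertex cd_neq y01 (edge_vertex fT cdT hp) zE.
have [b2x b2y] : X (co b2) = S1 - x2 /\ Y (co b2) = S2 - y2.
  by have [hx hy] := mid_XY _ _ _ _ sum1 sum2; split; lra.
have inside_a1 : insidep a1.
  by rewrite /insidep /inside /bar1 /barq /bar2 -/D X_a1 Y_a1; apply/and3P; split; lra.
have inside_a2 : insidep a2.
  rewrite /insidep /inside /bar1 /barq /bar2 -/D X_a2 Y_a2.
  by apply/and3P; split; rewrite /D /bdet; [lra|exact: ltW|lra].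
have xE x y : x = bar2 S1 S2 x y / D * x2 + barq x2 y2 x y / D * (S1 / 2).
  by apply: (mulIf D0); rewrite (bar_x S1 S2 x2 y2 x y); field.
have yE x y : y = bar2 S1 S2 x y / D * y2 + barq x2 y2 x y / D * (S2 / 2).
  by apply: (mulIf D0); rewrite (bar_y S1 S2 x2 y2 x y); field.
have on_a2q x y : bar1 S1 S2 x2 y2 x y = 0 -> 0 < barq x2 y2 x y -> 0 <= bar2 S1 S2 x y ->
    exists k, [/\ 0 < k < 1, X (lerp k (co a2) (co b2)) = x & Y (lerp k (co a2) (co b2)) = y].
  rewrite /bar1 -/D => u1 uq u2; exists (barq x2 y2 x y / D / 2).
  have b2E : bar2 S1 S2 x y / D = 1 - barq x2 y2 x y / D.
    by rewrite (_ : bar2 S1 S2 x y = D - barq x2 y2 x y); [field|lra].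
  have q1 : barq x2 y2 x y / D <= 1 by rewrite ler_pdivrMr //; lra.
  have q0 : 0 < barq x2 y2 x y / D by rewrite divr_gt0.
  split; first by move: q0 q1; clear=> ? ?; apply/andP; split; lra.
  - by rewrite [RHS](xE x y) b2E X_lerp b2x X_a2; field.
  - by rewrite [RHS](yE x y) b2E Y_lerp b2y Y_a2; field.
have on_a1q x y : bar2 S1 S2 x y = 0 -> 0 < barq x2 y2 x y -> 0 <= bar1 S1 S2 x2 y2 x y ->
    exists k, [/\ 0 < k < 1, X (lerp k (co a1) (co b1)) = x & Y (lerp k (co a1) (co b1)) = y].
  rewrite /bar1 -/D => u2 uq u1; exists (barq x2 y2 x y / D / 2).
  have q1 : barq x2 y2 x y / D <= 1 by rewrite ler_pdivrMr //; lra.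
  have q0 : 0 < barq x2 y2 x y / D by rewrite divr_gt0.
  split; first by move: q0 q1; clear=> ? ?; apply/andP; split; lra.
  - by rewrite [RHS](xE x y) u2 X_lerp X_b1 X_a1; field.
  - by rewrite [RHS](yE x y) u2 Y_lerp Y_b1 Y_a1; field.
have e2_cd : [set a2; b2] != [set c; d].
  apply/eqP => e; have : a2 \in [set c; d] by rewrite -e set21.
  rewrite !inE => /orP[] /eqP a2E; apply: (insidep_off a2) => //; rewrite a2E ?X_c ?Y_c ?X_d ?Y_d; lra.
(* The common midpoint has [X + Y = (S1 + S2) / 2 > 1]. If [a2] were on the other side of [c d], the
   half of [a2 b2] from [a2] to this midpoint would cross [c d], although both are edges of [T]. *)
have phi_a2 : 1 < x2 + y2.
  rewrite ltNge le_eqVlt; apply/negP => /orP[/eqP|] phi2.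
    by apply: (insidep_off a2) => //; rewrite X_a2 Y_a2.
  have dp : 0 < (S1 + S2) / 2 - (x2 + y2) by lra.
  set k := (1 - (x2 + y2)) / ((S1 + S2) / 2 - (x2 + y2)).
  have kE : k * ((S1 + S2) / 2 - (x2 + y2)) = 1 - (x2 + y2) by rewrite divfK // gt_eqF.
  have k0 : 0 < k by rewrite divr_gt0 //; lra.
  have k1 : k < 1 by rewrite ltr_pdivrMr //; lra.
  have k2 : 0 < k / 2 < 1 by move: k0 k1; clear=> ? ?; apply/andP; split; lra.
  set z := lerp (k / 2) (co a2) (co b2).
  have zx : X z = x2 + k * (S1 / 2 - x2) by rewrite X_lerp b2x X_a2; field.
  have zy : Y z = y2 + k * (S2 / 2 - y2) by rewrite Y_lerp b2y Y_a2; field.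
  have zphi : X z + Y z = 1.
    by rewrite zx zy -[RHS](subrK (x2 + y2)) -kE; field.
  have zin : inside S1 S2 x2 y2 (X z) (Y z).
    have u2 : bar2 S1 S2 (X z) (Y z) = (1 - k) * D by rewrite /bar2 zx zy /D /bdet; field.
    have uq : barq x2 y2 (X z) (Y z) = k * D by rewrite /barq zx zy /D /bdet; field.
    have k1' : 0 <= 1 - k by rewrite subr_ge0 ltW.
    rewrite /inside /bar1 u2 uq -/D; apply/and3P; split; last 2 first.
    - exact: mulr_ge0 k1' (ltW D_gt0).
    - exact: mulr_ge0 (ltW k0) (ltW D_gt0).
    by rewrite (_ : D - _ - _ = 0) //; ring.
  have [x0 y0] := line _ _ zin zphi.
  have [y01 ex ey] := on_cd _ _ x0 y0 zphi.
  have hz : hull [set c; d] z.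
    by rewrite -(XY_inj _ _ ex ey); apply: hull_pair; move: y01 => /andP[? ?]; rewrite !ltW.
  exact: edges_cross fT e2T cdT e2_cd k2 hz.
(* The side from [a1] to the common midpoint is half of an edge of [T1], so [a1] is its only lattice
   point; the same holds for [a2] and [T] below. *)
have off_a1q p : insidep p -> bar2 S1 S2 (X (co p)) (Y (co p)) = 0 ->
    barq x2 y2 (X (co p)) (Y (co p)) <= 0.
  move=> /and3P[u1 _ _] u2; rewrite leNgt; apply/negP => uq.
  have [k [k01 ex ey]] := on_a1q _ _ u2 uq u1; have zE := XY_inj _ _ ex ey.
  have hp := hull_pair a1 b1 (ltW01 k01); rewrite zE in hp.
  exact: lerp_vertex (edge_neq e1T) k01 (edge_vertex fT1 e1T hp) zE.
have off_a2q p : insidep p -> bar1 S1 S2 x2 y2 (X (co p)) (Y (co p)) = 0 ->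
    barq x2 y2 (X (co p)) (Y (co p)) <= 0.
  move=> /and3P[_ u2 _] u1; rewrite leNgt; apply/negP => uq.
  have [k [k01 ex ey]] := on_a2q _ _ u1 uq u2; have zE := XY_inj _ _ ex ey.
  have hp := hull_pair a2 b2 (ltW01 k01); rewrite zE in hp.
  exact: lerp_vertex (edge_neq e2T) k01 (edge_vertex fT e2T hp) zE.
(* Failure would place the point on the side excluded by [off_a1q]. So all lattice points of the
   triangle precede the common midpoint, and so do the midpoints between them. *)
have lt_q p : insidep p -> L (co p) - L (co a1) < (S1 * la + S2 * mu) / 2.
  move=> ins; rewrite (_ : _ - _ = X (co p) * la + Y (co p) * mu); last by rewrite (L_XY (co p)); ring.
  rewrite ltNge; apply/negP => ge.
  have [b0 bq] := inside_linear_eq D_gt0 ins L_a2q L_a2 ge.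
  by have := off_a1q p ins b0; rewrite leNgt bq.
pose f (p : point) := X (co p) + Y (co p).
have f_a1 : f a1 < 1 by rewrite /f X_a1 Y_a1 addr0.
have f_a2 : 1 < f a2 by rewrite /f X_a2 Y_a2.
have [p [q [pin qin p1 q1 sides]]] :=
  extremal_pair (fun p => X (co p)) inside_a1 inside_a2 f_a1 f_a2 insidep_off.
pose sd (x y : R) := side (X (co p)) (f p) (X (co q)) (f q) x (x + y).
have sd_lerp x y x' y' t : sd (x + t * (x' - x)) (y + t * (y' - y)) =
    sd x y + t * (sd x' y' - sd x y).
  by rewrite /sd -side_affine; congr side; ring.
have sd_in s : insidep s -> sd (X (co s)) (Y (co s)) <= 0 by move=> /sides[].
have sd_tie s : insidep s -> sd (X (co s)) (Y (co s)) = 0 -> f p < f s -> f s < f q -> False.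
  by move=> /sides[_ h] s0 ps sq; apply: (h s0); rewrite ps sq.
have [sd_p sd_q] : sd (X (co p)) (Y (co p)) = 0 /\ sd (X (co q)) (Y (co q)) = 0.
  exact: side_ends.
have sd_a1 : sd 0 0 <= 0 by have := sd_in _ inside_a1; rewrite X_a1 Y_a1.
have sd_a2 : sd x2 y2 <= 0 by have := sd_in _ inside_a2; rewrite X_a2 Y_a2.
have gap : 0 < f q - f p by rewrite subr_gt0 (lt_trans p1).
pose kap := crossing (X (co p)) (f p) (X (co q)) (f q).
have sd_line x : sd x (1 - x) = (x - kap) * (f q - f p).
  by rewrite /sd (addrC x) subrK side_crossing.
have kin : inside S1 S2 x2 y2 kap (1 - kap).
  pose t := (1 - f p) / (f q - f p).
  have tE : t * (f q - f p) = 1 - f p by rewrite divfK // gt_eqF.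
  have t01 : 0 <= t <= 1.
    by rewrite divr_ge0 ?(ltW gap) ?subr_ge0 ?(ltW p1) //= ler_pdivrMr // mul1r lerD2r ltW.
  have ek : kap = X (co p) + t * (X (co q) - X (co p)).
    by rewrite /kap /crossing /t; field; rewrite gt_eqF.
  have -> : 1 - kap = Y (co p) + t * (Y (co q) - Y (co p)).
    rewrite ek -[1](subrK (f p)) -tE /f; ring.
  by rewrite ek; apply: inside_convex pin qin t01.
have [kap0 kap1] := line _ _ kin (addrC_subr kap).
(* The side from [a1] to the common midpoint meets the line [c d] at the abscissa [S1 / (S1 + S2)],
   not to the left of [kap], so [sd] is nonnegative there. As [sd] is affine and nonpositive at
   [a1], it is nonnegative at the far end too. *)
have sd_mid : 0 <= sd (S1 / 2) (S2 / 2).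
  have S0 : 0 < S1 + S2 by rewrite addr_gt0.
  have kle : kap <= S1 / (S1 + S2).
    have /and3P[_ + _] := kin; rewrite ler_pdivlMr // /bar2; clear; lra.
  have := sd_line (S1 / (S1 + S2)).
  have -> : 1 - S1 / (S1 + S2) = 0 + 2 / (S1 + S2) * (S2 / 2 - 0) by field; rewrite gt_eqF.
  have {1}-> : S1 / (S1 + S2) = 0 + 2 / (S1 + S2) * (S1 / 2 - 0) by field; rewrite gt_eqF.
  rewrite sd_lerp => e.
  have t0 : 0 < 2 / (S1 + S2) by rewrite divr_gt0.
  have t1 : 0 < 1 - 2 / (S1 + S2) by rewrite subr_gt0 ltr_pdivrMr // mul1r.
  have r0 : 0 <= (S1 / (S1 + S2) - kap) * (f q - f p) by rewrite mulr_ge0 ?(ltW gap) ?subr_ge0.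
  rewrite -(pmulr_rge0 _ t0).
  have -> : 2 / (S1 + S2) * sd (S1 / 2) (S2 / 2) =
    (S1 / (S1 + S2) - kap) * (f q - f p) + (1 - 2 / (S1 + S2)) * (- sd 0 0) by rewrite -e; ring.
  by rewrite addr_ge0 // mulr_ge0 ?oppr_ge0 // ltW.
have sd_bar x y : D * sd x y = bar1 S1 S2 x2 y2 x y * sd 0 0 +
    bar2 S1 S2 x y * sd x2 y2 + barq x2 y2 x y * sd (S1 / 2) (S2 / 2).
  by rewrite /sd addr0 -(mulrDl S1) -side_barycentric.
(* In [sd_bar] the values at [a1] and [a2] are nonpositive and the value at the common midpoint is
   nonnegative, so only the term with [barq] can make [sd] positive. *)
have barq_pos x y : 0 <= bar1 S1 S2 x2 y2 x y -> 0 <= bar2 S1 S2 x y -> 0 < sd x y ->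
    0 < barq x2 y2 x y.
  move=> u1 u2 spos; have pos := mulr_gt0 D_gt0 spos; rewrite sd_bar in pos.
  rewrite ltNge; apply/negP => uq; suff : 0 < 0 :> R by rewrite ltxx.
  apply: (lt_le_trans pos).
  have le3 (a b c' : R) : a <= 0 -> b <= 0 -> c' <= 0 -> a + b + c' <= 0 by clear; lra.
  by apply: le3; [apply: mulr_ge0_le0|apply: mulr_ge0_le0|apply: mulr_le0_ge0].
have bar1_p : 0 < bar1 S1 S2 x2 y2 (X (co p)) (Y (co p)).
  have /and3P[u1 u2 uq] := pin; rewrite lt_neqAle u1 andbT eq_sym; apply/eqP => u0.
  have q0 : barq x2 y2 (X (co p)) (Y (co p)) = 0.
    by apply/le_anti; rewrite uq off_a2q.
  have bb2 : bar2 S1 S2 (X (co p)) (Y (co p)) / D = 1.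
    by apply: (mulIf D0); rewrite divfK // mul1r; move: u0; rewrite /bar1 q0 -/D; clear; lra.
  have ex : X (co p) = x2.
    by rewrite [LHS](xE (X (co p)) (Y (co p))) bb2 q0 !mul0r mul1r addr0.
  have ey : Y (co p) = y2.
    by rewrite [LHS](yE (X (co p)) (Y (co p))) bb2 q0 !mul0r mul1r addr0.
  by move: p1; rewrite /f ex ey ltNge (ltW phi_a2).
have bar2_q : 0 < bar2 S1 S2 (X (co q)) (Y (co q)).
  have /and3P[u1 u2 uq] := qin; rewrite lt_neqAle u2 andbT eq_sym; apply/eqP => u0.
  have q0 : barq x2 y2 (X (co q)) (Y (co q)) = 0.
    by apply/le_anti; rewrite uq off_a1q.
  have ex : X (co q) = 0.
    by rewrite [LHS](xE (X (co q)) (Y (co q))) u0 q0 !mul0r addr0.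
  have ey : Y (co q) = 0.
    by rewrite [LHS](yE (X (co q)) (Y (co q))) u0 q0 !mul0r addr0.
  by move: q1; rewrite /f ex ey addr0 ltNge ler01.
have [bar1_m bar2_m] : 0 < bar1 S1 S2 x2 y2 (X (co p) + 1 / 2 * (X (co q) - X (co p)))
      (Y (co p) + 1 / 2 * (Y (co q) - Y (co p))) /\
    0 < bar2 S1 S2 (X (co p) + 1 / 2 * (X (co q) - X (co p)))
      (Y (co p) + 1 / 2 * (Y (co q) - Y (co p))).
  have [-> -> _] := bar_affine S1 S2 x2 y2 (X (co p)) (Y (co p)) (X (co q)) (Y (co q)) (1 / 2).
  have /and3P[u1 _ _] := qin; have /and3P[_ u2 _] := pin.
  by move: bar1_p bar2_q u1 u2; clear; split; lra.
set mx := X (co p) + _ in bar1_m bar2_m; set my := Y (co p) + _ in bar1_m bar2_m.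
have sd_m : sd mx my = 0 by rewrite sd_lerp sd_p sd_q; ring.
have L_sum u v : L (co u) + L (co v) = 2 * L (co a1) + (X (co u) + X (co v)) * la +
    (Y (co u) + Y (co v)) * mu by rewrite (L_XY (co u)) (L_XY (co v)); ring.
have pair_L (u v u' v' : point) : u != v -> u' != v' -> [set u; v] = [set u'; v'] ->
    L (co u) + L (co v) = L (co u') + L (co v').
  move=> uv uv' e; have h (i j : point) : i != j ->
      \sum_(p in [set i; j]) L (co p) = L (co i) + L (co j).
    by move=> ij; rewrite big_setU1 ?inE //= big_set1.
  by rewrite -h // -h // e.
(* If [sd] were positive at [u], then [u] would be outside the triangle. On the way from the
   midpoint of [p q] to [u], the first zero of [bar1] or [bar2] has [sd], hence [barq], positive, so
   it is interior to [a2 b2] or to [a1 b1]. But [u v] is an edge of both [T] and [T1]. *)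
have exit (u v : point) : [set u; v] \in edges T -> [set u; v] \in edges T1 ->
    X (co u) + X (co v) = X (co p) + X (co q) -> Y (co u) + Y (co v) = Y (co p) + Y (co q) ->
    sd (X (co u)) (Y (co u)) <= 0.
  move=> uvT uvT1 eX eY; rewrite leNgt; apply/negP => sdu.
  have uv_L : L (co u) + L (co v) < L (co a1) + L (co b1).
    move: (lt_q p pin) (lt_q q qin) (L_sum u v) (L_sum p q) LaL; rewrite eX eY; clear; lra.
  have a2b2_L : L (co a2) + L (co b2) = L (co a1) + L (co b1).
    by have [hx hy] := mid_XY _ _ _ _ sum1 sum2; rewrite !L_sum hx hy.
  have ne2 : [set a2; b2] != [set u; v].
    apply/eqP => /(pair_L _ _ _ _ (edge_neq e2T) (edge_neq uvT)) e.
    by move: uv_L; rewrite -e a2b2_L ltxx.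
  have ne1 : [set a1; b1] != [set u; v].
    apply/eqP => /(pair_L _ _ _ _ (edge_neq e1T) (edge_neq uvT)) e.
    by move: uv_L; rewrite -e ltxx.
  have mxE : mx = (X (co u) + X (co v)) / 2 by rewrite /mx eX; field.
  have myE : my = (Y (co u) + Y (co v)) / 2 by rewrite /my eY; field.
  have neg : bar1 S1 S2 x2 y2 (X (co u)) (Y (co u)) < 0 \/ bar2 S1 S2 (X (co u)) (Y (co u)) < 0.
    have [|u1] := ltP (bar1 S1 S2 x2 y2 (X (co u)) (Y (co u))) 0; first by left.
    have [|u2] := ltP (bar2 S1 S2 (X (co u)) (Y (co u))) 0; first by right.
    have uq := barq_pos _ _ u1 u2 sdu.
    have uin : insidep u by rewrite /insidep /inside u1 u2 ltW.
    by have := sd_in u uin; rewrite leNgt sdu.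
  have [k [k0 k1 hz]] := first_zero bar1_m bar2_m neg.
  have [z1 z2 _] := bar_affine S1 S2 x2 y2 mx my (X (co u)) (Y (co u)) k.
  rewrite -z1 -z2 in hz.
  pose z := lerp ((1 - k) / 2) (co u) (co v).
  have zx : X z = mx + k * (X (co u) - mx) by rewrite X_lerp mxE; field.
  have zy : Y z = my + k * (Y (co u) - my) by rewrite Y_lerp myE; field.
  rewrite -zx -zy in hz.
  have hz_uv : hull [set u; v] z.
    by apply: hull_pair; move: k0 k1; clear; move=> k0 k1; apply/andP; split; lra.
  have sdz : 0 < sd (X z) (Y z) by rewrite zx zy sd_lerp sd_m subr0 add0r mulr_gt0.
  case: hz => [[b1z b2z]|[b2z b1z]].
    have bq : 0 < barq x2 y2 (X z) (Y z) by apply: barq_pos; rewrite ?b1z.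
    have [k' [k01 ex ey]] := on_a2q _ _ b1z bq b2z.
    by apply: (edges_cross fT e2T uvT ne2 k01); rewrite (XY_inj _ _ ex ey).
  have bq : 0 < barq x2 y2 (X z) (Y z) by apply: barq_pos; rewrite ?b2z.
  have [k' [k01 ex ey]] := on_a1q _ _ b2z bq b1z.
  by apply: (edges_cross fT1 e1T uvT1 ne1 k01); rewrite (XY_inj _ _ ex ey).
have in_seg w : sd (X (co w)) (Y (co w)) = 0 -> f p <= f w <= f q -> insidep w.
  move=> sw /andP[pw wq]; pose t := (f w - f p) / (f q - f p).
  have tE : t * (f q - f p) = f w - f p by rewrite divfK // gt_eqF.
  have t01 : 0 <= t <= 1.
    by rewrite divr_ge0 ?(ltW gap) ?subr_ge0 //= ler_pdivrMr // mul1r lerD2r.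
  have ex : X (co w) = X (co p) + t * (X (co q) - X (co p)).
    apply: (mulIf (lt0r_neq0 gap)); apply/eqP; rewrite -subr_eq0 -[X in _ == X]sw.
    by rewrite /sd /side -/(f w) -tE; apply/eqP; ring.
  have ey : Y (co w) = Y (co p) + t * (Y (co q) - Y (co p)).
    have -> : Y (co w) = f w - X (co w) by rewrite /f; ring.
    by rewrite -[f w](subrK (f p)) -tE ex /f; ring.
  by rewrite /insidep ex ey; apply: inside_convex.
have im : (p.1 + q.1 <= m.*2)%N by rewrite -addnn leq_add ?leq_ord.
have jn : (p.2 + q.2 <= n.*2)%N by rewrite -addnn leq_add ?leq_ord.
(* If the midpoint of [p q] is a lattice point, it contradicts the minimal gap. Otherwise it is the
   midpoint of an edge [u v] of [T], which also belongs to [T1] because it is early. *)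
have [/andP[ev1 ev2]|od] := boolP (~~ odd (p.1 + q.1) && ~~ odd (p.2 + q.2)).
  pose s : point := (inord (p.1 + q.1)./2, inord (p.2 + q.2)./2).
  have s1 : (p.1 + q.1 = s.1 + s.1 :> nat)%N.
    by rewrite inordK ?addnn ?even_halfK // ltnS leq_half_double (leq_trans im).
  have s2 : (p.2 + q.2 = s.2 + s.2 :> nat)%N.
    by rewrite inordK ?addnn ?even_halfK // ltnS leq_half_double (leq_trans jn).
  have [hx hy] := mid_XY _ _ _ _ s1 s2.
  have sx : X (co s) = mx by move: hx; rewrite /mx; clear; lra.
  have sy : Y (co s) = my by move: hy; rewrite /my; clear; lra.
  have sf : f s = f p + 1 / 2 * (f q - f p) by rewrite /f sx sy /mx /my; ring.
  have s0 : sd (X (co s)) (Y (co s)) = 0 by rewrite sx sy.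
  have ps : f p < f s by rewrite sf; move: gap; clear; lra.
  have sq : f s < f q by rewrite sf; move: gap; clear; lra.
  by apply: (sd_tie s) => //; apply: in_seg; rewrite // !ltW.
have [u [v [uvT uv1 uv2]]] := half_point_edge fT im jn od.
have [eX eY] := mid_XY _ _ _ _ uv1 uv2.
have uv_L : L (co u) + L (co v) < L (co a1) + L (co b1).
  move: (lt_q p pin) (lt_q q qin) (L_sum u v) (L_sum p q) LaL; rewrite eX eY; clear; lra.
have uvT1 := K_sub _ _ uvT uv_L.
have sdu := exit u v uvT uvT1 eX eY.
have sdv : sd (X (co v)) (Y (co v)) <= 0.
  by apply: (exit v u); rewrite 1?setUC // addrC.
have [sdu0 sdv0] : sd (X (co u)) (Y (co u)) = 0 /\ sd (X (co v)) (Y (co v)) = 0.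
  have e : sd (X (co u)) (Y (co u)) + sd (X (co v)) (Y (co v)) = 0.
    have := sd_lerp (X (co u)) (Y (co u)) (X (co v)) (Y (co v)) (1 / 2).
    have -> : X (co u) + 1 / 2 * (X (co v) - X (co u)) = mx by move: eX; rewrite /mx; clear; lra.
    have -> : Y (co u) + 1 / 2 * (Y (co v) - Y (co u)) = my by move: eY; rewrite /my; clear; lra.
    by rewrite sd_m; clear; lra.
  by move: sdu sdv e; clear; split; lra.
have fsum : f u + f v = f p + f q by rewrite /f; move: eX eY; clear; lra.
clear sdu sdv exit.
(* Both ends of [u v] are on the line [p q], symmetric about the midpoint of [p q]. Either one of
   them is strictly between [p] and [q], against the minimal gap, or [u v] crosses [c d] at the same
   point as [p q]. *)
wlog fuv : u v uvT uv1 uv2 eX eY uv_L uvT1 sdu0 sdv0 fsum / f u <= f v.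
  move=> th; have [|/ltW] := leP (f u) (f v); first exact: th uvT uv1 uv2 eX eY uv_L uvT1 sdu0 sdv0 fsum.
  have vu i : i \in [set [set u; v]] -> [set v; u] = i by rewrite inE setUC => /eqP.
  apply: (th v u); rewrite 1?(vu _ (set11 _)) // 1?addnC // 1?addrC //.
have [fv1|fv1] := leP (f v) 1.
  have pu : f p < f u by move: fsum fv1 q1; clear; lra.
  have uq : f u < f q by move: fuv fv1 q1; clear; lra.
  by apply: (sd_tie u) => //; apply: in_seg; rewrite // !ltW.
have [fu1|fu1] := leP 1 (f u).
  have pv : f p < f v by apply: lt_trans p1 fv1.
  have vq : f v < f q by move: fsum fu1 p1; clear; lra.
  by apply: (sd_tie v) => //; apply: in_seg; rewrite // !ltW.
pose t := (1 - f u) / (f v - f u).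
have fuv' : 0 < f v - f u by rewrite subr_gt0 (lt_trans fu1).
have tE : t * (f v - f u) = 1 - f u by rewrite divfK // gt_eqF.
have t01 : 0 <= t <= 1.
  by rewrite divr_ge0 ?(ltW fuv') ?subr_ge0 ?(ltW fu1) //= ler_pdivrMr // mul1r lerD2r ltW.
pose z := lerp t (co u) (co v).
have zf : X z + Y z = 1.
  rewrite X_lerp Y_lerp -[RHS](subrK (f u)) -tE /f; ring.
have zx : X z = kap.
  have : sd (X z) (1 - X z) = 0.
    have -> : 1 - X z = Y z by rewrite -zf; ring.
    by rewrite X_lerp Y_lerp sd_lerp sdu0 sdv0; ring.
  by rewrite sd_line => /eqP; rewrite mulf_eq0 (gt_eqF gap) orbF subr_eq0 => /eqP.
have zy : Y z = 1 - kap by rewrite -zx -zf; ring.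
have [y01 ex ey] := on_cd _ _ kap0 kap1 (addrC_subr kap).
(* The midpoint of [u v] precedes the common midpoint, that of [c d] does not. *)
have ne : [set c; d] != [set u; v].
  apply/eqP => /(pair_L _ _ _ _ cd_neq (edge_neq uvT)) e.
  have := L_sum c d; rewrite X_c X_d Y_c Y_d e.
  by move: uv_L cd_late LaL; clear; lra.
apply: (edges_cross fT cdT uvT ne y01).
rewrite (XY_inj _ _ (etrans ex (esym zx)) (etrans ey (esym zy))).
exact: hull_pair.
Qed.

End Separation.

(** Here [la], [mu] and [La] are the levels of [c], [d] and [b1] relative to [a1]. If [la] and [mu]
    were both positive, then [S1, S2 >= 1], not both 1, would give [La > la + mu]. So [mu > 0]
    implies [la < 0], and then [La <= la + mu < mu]. *)
Lemma out_of_range (R : realType) (la mu S1 S2 La : R) :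
  0 < La -> La <= la + mu -> la != 0 -> mu != 0 -> 1 <= S1 -> 1 <= S2 -> 2 < S1 + S2 ->
  La = S1 * la + S2 * mu -> mu < 0 \/ La < 2 * mu.
Proof.
move=> La0 late c_ne d_ne S1_1 S2_1 S_gt2 LaE.
have [mu0|mu0|mu0] := ltgtP mu 0; [by left| |by rewrite mu0 eqxx in d_ne].
right; have [la0|la0|la0] := ltgtP la 0; [lra| |by rewrite la0 eqxx in c_ne].
have p1 : 0 <= (S1 - 1) * la by rewrite mulr_ge0 ?subr_ge0 // ltW.
have p2 : 0 <= (S2 - 1) * mu by rewrite mulr_ge0 ?subr_ge0 // ltW.
have p3 : 0 < (S1 - 1) * la + (S2 - 1) * mu.
  have [S1_e|S1_ne] := eqVneq S1 1.
    by rewrite S1_e subrr mul0r add0r mulr_gt0 //; lra.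
  by rewrite ltr_wpDr // mulr_gt0 // subr_gt0 lt_neqAle eq_sym S1_ne.
lra.
Qed.

(** * The scanning order, and the triangle on an edge and the lowest end *)

Section Anclin.
Variables (R : realType) (m n : nat).
Local Notation point := (lattice_point m n).
Local Notation co := (@coord R m n).
Implicit Types (T : {set {set point}}) (a b c d p q : point).

(** Lexicographic order as a single number. The base [n.*2.+1] exceeds every sum of two second
    coordinates, so the sum of the levels of two points determines their midpoint; this is the
    generic direction of the scan. *)
Definition level p : nat := (p.1 * n.*2.+1 + p.2)%N.

Lemma level_sum a b c d : (level a + level b = level c + level d)%N ->
  (a.1 + b.1 = c.1 + d.1 :> nat)%N /\ (a.2 + b.2 = c.2 + d.2 :> nat)%N.
Proof.
have bd p q : (p.2 + q.2 < n.*2.+1)%N by rewrite ltnS -addnn leq_add ?leq_ord.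
have e p q : (level p + level q = (p.1 + q.1) * n.*2.+1 + (p.2 + q.2))%N.
  by rewrite /level mulnDl addnACA.
rewrite !e => h; have h1 := congr1 (divn^~ n.*2.+1) h; have h2 := congr1 (modn^~ n.*2.+1) h.
move: h1 h2; rewrite /= !divnMDl // !(divn_small (bd _ _)) !addn0.
by rewrite !modnMDl !(modn_small (bd _ _)).
Qed.

Lemma level_inj : injective level.
Proof.
move=> a b e; have [e1 e2] : (a.1 + a.1 = b.1 + b.1 /\ a.2 + a.2 = b.2 + b.2 :> nat)%N.
  by apply: level_sum; rewrite e.
move: a b e1 e2 {e} => [a1 a2] [b1 b2] /= e1 e2.
by congr pair; apply: val_inj => /=; lia.
Qed.

Definition rlevel (x : R * R) : R := x.1 * (n.*2.+1)%:R + x.2.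

Lemma rlevel_coord p : rlevel (co p) = (level p)%:R.
Proof. by rewrite /rlevel /level natrD natrM. Qed.

Lemma set3_mem (I : finType) (A : {set I}) (i : I) : #|A| = 3%N -> i \in A ->
  exists j k, [/\ i != j, i != k, j != k & A = [set i; j; k]].
Proof.
move=> A3 iA; have : #|A :\ i| == 2%N.
  by have := cardsD1 i A; rewrite A3 iA => -[->].
move=> /cards2P[j [k [jk AE]]].
have : j \in A :\ i by rewrite AE set21.
have : k \in A :\ i by rewrite AE set22.
rewrite !inE => /andP[ki kA] /andP[ji jA].
exists j, k; split; rewrite // 1?eq_sym //.
by apply: (set3_eq A3); rewrite // eq_sym.
Qed.

Lemma orient_basis (x0 y z w : R * R) :
  orient x0 y z * (w.1 - x0.1) = orient x0 w z * (y.1 - x0.1) + orient x0 y w * (z.1 - x0.1) /\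
  orient x0 y z * (w.2 - x0.2) = orient x0 w z * (y.2 - x0.2) + orient x0 y w * (z.2 - x0.2).
Proof. by rewrite /orient; split; ring. Qed.

Lemma collinear_level (x y z : R * R) : orient x y z = 0 -> rlevel x != rlevel y ->
  z = lerp ((rlevel z - rlevel x) / (rlevel y - rlevel x)) x y.
Proof.
move=> o0 ne; have ne' : rlevel y - rlevel x != 0 by rewrite subr_eq0 eq_sym.
rewrite [LHS]surjective_pairing /lerp; congr pair; apply: (mulIf ne').
- rewrite mulrDl mulrAC divfK // -[RHS]subr0 -o0 /rlevel /orient; ring.
- rewrite mulrDl mulrAC divfK // -[RHS]addr0 -(mulr0 (n.*2.+1)%:R) -o0 /rlevel /orient; ring.
Qed.

(** Let [c d] be the side opposite [a1] in the triangle of [T] that contains the beginning of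
    [a1 b1]. If it is not [a2 b2], it crosses [a1 b1]; then it is not an edge of [T1], so it does
    not precede the common midpoint. This is the situation excluded by [edge_not_separating]. *)
Lemma tri_of_smaller_end T T1 a1 b1 a2 b2 :
  full_triangulation R T -> full_triangulation R T1 ->
  [set a1; b1] \in edges T1 -> [set a2; b2] \in edges T ->
  (level a1 + level b1 = level a2 + level b2)%N ->
  (level a1 < level a2)%N -> (level a2 < level b2)%N ->
  (forall u v, [set u; v] \in edges T -> (level u + level v < level a1 + level b1)%N ->
     [set u; v] \in edges T1) ->
  [set a1; a2; b2] \in T.
Proof.
move=> fT fT1 e1T e2T lev lt1 lt2 K.
have [sum1 sum2] := level_sum lev.
have [lt3 lt4] : (level a1 < level b1)%N /\ (level a2 < level b1)%N.
  by move: lev lt1 lt2; clear; move: (level a1) (level a2) (level b1) (level b2); lia.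
have a1_e2 : a1 \notin [set a2; b2].
  by rewrite !inE -!(inj_eq level_inj); rewrite !ltn_eqF // (ltn_trans lt1).
have a2_e1 : a2 \notin [set a1; b1].
  by rewrite !inE -!(inj_eq level_inj) gtn_eqF // ltn_eqF.
have rq : @rectangle R m n (midpoint R a1 b1) := hull_rect (hull_midpoint R a1 b1).
have [A [e [AT e0 he]]] := tri_ray fT.1 (coord_rect R a1) rq.
have a1A : a1 \in A.
  apply: (full_vertex fT AT); have := he 0; rewrite lexx ltW // => /(_ isT).
  by rewrite /lerp !mul0r !addr0 -surjective_pairing.
have [c0 [d0 [ac0 ad0 cd0 AE]]] := set3_mem (tri_card fT.1 AT) a1A.
have o_neq0 : orient (co a1) (co b1) (co a2) != 0.
  apply/eqP => o0; have ne : rlevel (co a1) != rlevel (co b1).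
    by rewrite !rlevel_coord eqr_nat neq_ltn lt3.
  have aE := collinear_level o0 ne; move/negP: a2_e1; apply.
  apply: (edge_vertex fT1 e1T); rewrite aE; apply: hull_pair.
  have d0' : 0 < rlevel (co b1) - rlevel (co a1).
    by rewrite !rlevel_coord subr_gt0 ltr_nat.
  by rewrite divr_ge0 ?(ltW d0') ?ler_pdivrMr ?mul1r ?lerD2r ?subr_ge0 //= !rlevel_coord ler_nat ltnW.
apply: contraT => nT; exfalso.
(* The names are chosen so that [d] and [a2] are on the same side of the line [a1 b1]. *)
suff main c d : a1 != c -> a1 != d -> c != d -> A = [set a1; c; d] ->
    0 < orient (co a1) (co c) (co d) * orient (co a1) (co b1) (co a2) -> False.
  have oA : orient (co a1) (co c0) (co d0) != 0.
    by apply: indep_orient; rewrite // -AE; exact: (tri_indep fT.1 AT).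
  have [lt|gt|eq] := ltgtP 0 (orient (co a1) (co c0) (co d0) * orient (co a1) (co b1) (co a2)).
  - exact: (main c0 d0).
  - have dc0 : d0 != c0 by rewrite eq_sym.
    have AE' : A = [set a1; d0; c0] by rewrite AE setUAC.
    apply: (main d0 c0 ad0 ac0 dc0 AE').
    have -> : orient (co a1) (co d0) (co c0) = - orient (co a1) (co c0) (co d0).
      by rewrite /orient; ring.
    by rewrite mulNr oppr_gt0.
  - by move/esym/eqP: eq; rewrite mulf_eq0 (negPf oA) (negPf o_neq0).
move=> ac ad cd {}AE; set o := orient (co a1) (co c) (co d) => opos.
have cA : c \in A by rewrite AE !inE eqxx orbT.
have dA : d \in A by rewrite AE !inE eqxx !orbT.
have o1 : o = 1 \/ o = - 1 by apply: (full_unimodular fT) => //; rewrite -AE.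
have oo : o * o = 1 by case: o1 => ->; ring.
have o0 : o != 0 by case: o1 => ->; rewrite ?oppr_eq0 oner_eq0.
(* In these coordinates [a1], [c], [d] are [(0, 0)], [(1, 0)], [(0, 1)]. Multiplication by [o],
   which is 1 or -1, replaces division by it. *)
pose X (x : R * R) := o * orient (co a1) x (co d).
pose Y (x : R * R) := o * orient (co a1) (co c) x.
have basis x : x.1 = (co a1).1 + X x * ((co c).1 - (co a1).1) + Y x * ((co d).1 - (co a1).1) /\
    x.2 = (co a1).2 + X x * ((co c).2 - (co a1).2) + Y x * ((co d).2 - (co a1).2).
  have [h1 h2] := orient_basis (co a1) (co c) (co d) x; rewrite -/o in h1 h2.
  have step (u v w r s : R) : o * (u - v) = r * w + s -> u = v + o * r * w + o * s.
    move=> h; apply: (mulfI o0); rewrite -[X in X = _](subrK (o * v)) -mulrBr h.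
    have -> : o * (v + o * r * w + o * s) = o * v + (o * o) * (r * w + s) by ring.
    by rewrite oo; ring.
  split; rewrite /X /Y.
    by rewrite -[_ * ((co d).1 - _)]mulrA; apply: step.
  by rewrite -[_ * ((co d).2 - _)]mulrA; apply: step.
have X_lerp t x y : X (lerp t x y) = X x + t * (X y - X x).
  by rewrite /X orient_lerpm; ring.
have Y_lerp t x y : Y (lerp t x y) = Y x + t * (Y y - Y x).
  by rewrite /Y orient_lerp; ring.
have XY_inj x y : X x = X y -> Y x = Y y -> x = y.
  move=> ex ey; have [h1 h2] := basis x; have [h3 h4] := basis y.
  by rewrite (surjective_pairing x) (surjective_pairing y) h1 h2 h3 h4 ex ey.
have L_XY x : rlevel x = rlevel (co a1) + X x * (rlevel (co c) - rlevel (co a1)) +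
    Y x * (rlevel (co d) - rlevel (co a1)).
  by rewrite {1}/rlevel; have [-> ->] := basis x; rewrite /rlevel; ring.
have X_a1 : X (co a1) = 0 by rewrite /X orient0 mulr0.
have Y_a1 : Y (co a1) = 0 by rewrite /Y orient0 mulr0.
have X_c : X (co c) = 1 by rewrite /X -/o.
have Y_c : Y (co c) = 0 by rewrite /Y orient0 mulr0.
have X_d : X (co d) = 0 by rewrite /X orient0 mulr0.
have Y_d : Y (co d) = 1 by rewrite /Y -/o.
have integral p q r : exists k : int, o * orient (co p) (co q) (co r) = k%:~R.
  rewrite orient_int; case: o1 => ->; [exists (iorient p q r)|exists (- iorient p q r)].
    by rewrite mul1r.
  by rewrite mulN1r intrN.
have [kx kxE] : exists k : int, X (co b1) = k%:~R := integral a1 b1 d.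
have [ky kyE] : exists k : int, Y (co b1) = k%:~R := integral a1 c b1.
have ac' : a1 \notin [set c; d] by rewrite !inE negb_or ac.
have [X0 Y0] : 0 <= X (co b1) /\ 0 <= Y (co b1).
  have e01 : 0 <= e <= e by rewrite lexx ltW.
  have := he e e01; rewrite AE => /(tri_hullP _ ac ad cd o0)[_ h1 h2].
  have inv : o^-1 = o by case: o1 => ->; rewrite ?invrN invr1.
  rewrite inv orient_lerpm orient_xxy add0r subr0 orient_lerpm orient_xxy add0r subr0 in h1.
  rewrite inv orient_lerp orient_xyx add0r subr0 orient_lerp orient_xyx add0r subr0 in h2.
  rewrite -[_ * o]mulrA -mulrA pmulr_rge0 // pmulr_rge0 // mulrC -/(X _) in h1.
  by rewrite -[_ * o]mulrA -mulrA pmulr_rge0 // pmulr_rge0 // mulrC -/(Y _) in h2.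
have kx0 : 0 <= kx by rewrite -(ler0z R) -kxE.
have ky0 : 0 <= ky by rewrite -(ler0z R) -kyE.
have b1_ne : a1 != b1 by apply: contraTneq lt3 => ->; rewrite ltnn.
have corner p : p \in A -> a1 != p -> p \in [set a1; b1] -> False.
  move=> pA ap; rewrite !inE eq_sym (negPf ap) => /eqP pb.
  have e1T' : [set a1; b1] \in edges T by apply: edge_in AT a1A _ b1_ne; rewrite -pb.
  have := same_midpoint fT e1T' e2T sum1 sum2 => eq.
  by move: a1_e2; rewrite -eq set21.
(* If [b1] is on an axis, the edge [a1 b1] contains [d] or [c], which must then be [b1]. So [a1 b1]
   is an edge of [T] with the same midpoint as [a2 b2], which [corner] excludes. *)
have [kx_eq0|kx_neq0] := eqVneq kx 0.
  have ky1 : 1 <= ky.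
    rewrite -gtz0_ge1 lt_neqAle ky0 andbT eq_sym; apply: contra b1_ne => /eqP k0.
    apply/eqP; apply: (@coord_inj R m n); apply: XY_inj.
      by rewrite X_a1 kxE kx_eq0.
    by rewrite Y_a1 kyE k0.
  apply: (corner d) => //; apply: (edge_vertex fT1 e1T).
  have k1 : 1 <= ky%:~R :> R by rewrite ler1z.
  have k0 : 0 < ky%:~R :> R by apply: lt_le_trans k1.
  have -> : co d = lerp (ky%:~R^-1) (co a1) (co b1).
    apply: XY_inj; rewrite ?X_lerp ?Y_lerp ?X_a1 ?Y_a1 ?X_d ?Y_d ?kxE ?kyE ?kx_eq0.
      by ring.
    by rewrite subr0 add0r mulVf // gt_eqF.
  by apply: hull_pair; rewrite invr_ge0 ltW //= invf_le1.
have [ky_eq0|ky_neq0] := eqVneq ky 0.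
  have kx1 : 1 <= kx by rewrite -gtz0_ge1 lt_neqAle kx0 andbT eq_sym.
  apply: (corner c) => //; apply: (edge_vertex fT1 e1T).
  have k1 : 1 <= kx%:~R :> R by rewrite ler1z.
  have k0 : 0 < kx%:~R :> R by apply: lt_le_trans k1.
  have -> : co c = lerp (kx%:~R^-1) (co a1) (co b1).
    apply: XY_inj; rewrite ?X_lerp ?Y_lerp ?X_a1 ?Y_a1 ?X_c ?Y_c ?kxE ?kyE ?ky_eq0.
      by rewrite subr0 add0r mulVf // gt_eqF.
    by ring.
  by apply: hull_pair; rewrite invr_ge0 ltW //= invf_le1.
have kx1 : 1 <= kx by rewrite -gtz0_ge1 lt_neqAle kx0 andbT eq_sym.
have ky1 : 1 <= ky by rewrite -gtz0_ge1 lt_neqAle ky0 andbT eq_sym.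
have cdT : [set c; d] \in edges T by apply: edge_in AT cA dA cd.
(* For [kx = ky = 1] the edge [c d] has the common midpoint, so it is [a2 b2], and [A] is the
   triangle sought. *)
have [le2|gt2] := leP (kx + ky) 2.
  have [kx_1 ky_1] : kx = 1 /\ ky = 1 by move: kx1 ky1 le2; clear; lia.
  have [s1 s2] : (c.1 + d.1 = a2.1 + b2.1 :> nat)%N /\ (c.2 + d.2 = a2.2 + b2.2 :> nat)%N.
    rewrite -sum1 -sum2; have [h1 h2] := basis (co b1).
    rewrite kxE kyE kx_1 ky_1 /= in h1 h2.
    split; apply/eqP; rewrite -(eqr_nat R) !natrD; apply/eqP; [move: h1|move: h2]; clear; lra.
  have eq := same_midpoint fT cdT e2T s1 s2.
  by move: nT; rewrite -setUA -eq setUA -AE AT.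
pose S1 := X (co b1); pose S2 := Y (co b1).
have S1_1 : 1 <= S1 by rewrite /S1 kxE ler1z.
have S2_1 : 1 <= S2 by rewrite /S2 kyE ler1z.
have S_gt2 : 2 < S1 + S2 by rewrite /S1 /S2 kxE kyE -intrD (ltr_int R 2).
have S1_0 : 0 < S1 by apply: lt_le_trans S1_1.
have S2_0 : 0 < S2 by apply: lt_le_trans S2_1.
have ne1 : [set a1; b1] != [set c; d] by apply: contraNneq ac' => <-; rewrite set21.
(* Otherwise [c d] would belong to [T1], where it crosses [a1 b1] at the parameter
   [1 / (S1 + S2)]. *)
have late : (level a1 + level b1 <= level c + level d)%N.
  rewrite leqNgt; apply/negP => lt; have cdT1 := K c d cdT lt.
  have S0 : 0 < S1 + S2 by rewrite addr_gt0.
  have k01 : 0 < (S1 + S2)^-1 < 1 by rewrite invr_gt0 S0 /= invf_lt1 //; move: S_gt2; clear; lra.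
  apply: (edges_cross fT1 e1T cdT1 ne1 k01).
  have -> : lerp (S1 + S2)^-1 (co a1) (co b1) = lerp (S2 / (S1 + S2)) (co c) (co d).
    apply: XY_inj; rewrite ?X_lerp ?Y_lerp ?X_a1 ?Y_a1 ?X_c ?Y_c ?X_d ?Y_d -?/S1 -?/S2; field;
    by rewrite gt_eqF.
  apply: hull_pair; rewrite divr_ge0 ?(ltW S0) ?(ltW S2_0) //= ler_pdivrMr // mul1r.
  by rewrite lerDr ltW.
have D_pos : 0 < bdet S1 S2 (X (co a2)) (Y (co a2)).
  have -> : bdet S1 S2 (X (co a2)) (Y (co a2)) =
      o * o * (o * orient (co a1) (co b1) (co a2)).
    have <- : orient (co a1) (co b1) (co d) * orient (co a1) (co c) (co a2) -
        orient (co a1) (co c) (co b1) * orient (co a1) (co a2) (co d) =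
        o * orient (co a1) (co b1) (co a2) by rewrite /o /orient; ring.
    by rewrite /bdet /S1 /S2 /X /Y; ring.
  by rewrite oo mul1r.
have La0 : 0 < rlevel (co b1) - rlevel (co a1) by rewrite subr_gt0 !rlevel_coord ltr_nat.
have late' : rlevel (co b1) - rlevel (co a1) <=
    rlevel (co c) - rlevel (co a1) + (rlevel (co d) - rlevel (co a1)).
  move: late; rewrite -(ler_nat R) (natrD _ (level a1)) (natrD _ (level c)) -!rlevel_coord; clear; lra.
have c_ne : rlevel (co c) - rlevel (co a1) != 0.
  by rewrite subr_eq0 !rlevel_coord eqr_nat (inj_eq level_inj) eq_sym.
have d_ne : rlevel (co d) - rlevel (co a1) != 0.
  by rewrite subr_eq0 !rlevel_coord eqr_nat (inj_eq level_inj) eq_sym.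
apply: (edge_not_separating fT fT1 e1T e2T cdT sum1 sum2 X_lerp Y_lerp XY_inj X_a1 Y_a1
  X_c Y_c X_d Y_d erefl erefl erefl erefl L_XY _ erefl S1_0 S2_0 S_gt2 D_pos _ _ _ late').
- move=> u v uvT; rewrite !rlevel_coord -(natrD _ (level u)) -(natrD _ (level a1)) ltr_nat; exact: K.
- by rewrite !rlevel_coord subr_gt0 ltr_nat.
- have : (level a2 + level a2 < level a1 + level b1)%N by rewrite lev ltn_add2l.
  by rewrite -(ltr_nat R) (natrD _ (level a1)) (natrD _ (level a2)) -!rlevel_coord; clear; lra.
apply: (out_of_range La0 late' c_ne d_ne S1_1 S2_1 S_gt2).
by rewrite {1}(L_XY (co b1)) -/S1 -/S2; ring.
Qed.

End Anclin.

(** * Counting full triangulations by scanning their edges *)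

Section CountFull.
Variables (R : realType) (m n : nat).
Local Notation point := (lattice_point m n).
Local Notation co := (@coord R m n).
Implicit Types (T : {set {set point}}) (a b c d p q : point) (e : {set point}).

(** [a' - a] is a positive multiple of [c - b], so [b a'] and [c a] are the diagonals of a
    trapezoid. *)
Lemma trapezoid_cross T a a' b c (k : R) : full_triangulation R T ->
  [set b; a'] \in edges T -> [set c; a] \in edges T -> a != b -> b != c -> 0 < k ->
  (co a').1 = (co a).1 + k * ((co c).1 - (co b).1) ->
  (co a').2 = (co a).2 + k * ((co c).2 - (co b).2) -> False.
Proof.
move=> fT ba ca ab bc k0 e1 e2; have k1 : 0 < 1 + k by rewrite addr_gt0.
have k01 : 0 < (1 + k)^-1 < 1 by rewrite invr_gt0 k1 /= invf_lt1 // ltrDl.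
have ne : [set b; a'] != [set c; a].
  apply/eqP => e; have : b \in [set c; a] by rewrite -e set21.
  by rewrite !inE (negPf bc) eq_sym (negPf ab).
apply: (edges_cross fT ba ca ne k01).
have -> : lerp (1 + k)^-1 (co b) (co a') = lerp (1 + k)^-1 (co c) (co a).
  rewrite /lerp e1 e2; congr pair; field; by rewrite gt_eqF.
exact: hull_pair (ltW01 k01).
Qed.

(** For a triangle [b c a] of [T1], the triangle of [T2] entered from the midpoint of [b c] towards
    [a] has the side [b c] and an apex [a']. By unimodularity [a] and [a'] are equally far from
    [b c], on the same side; if they differ, two edges of [T2] are the crossing diagonals of a
    trapezoid. *)
Lemma edges_sub_inj T1 T2 : full_triangulation R T1 -> full_triangulation R T2 ->
  edges T1 = edges T2 -> T1 \subset T2.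
Proof.
move=> fT1 fT2 E12; apply/subsetP => A AT1.
have [a [b [c [ab ac bc AE]]]] := cards3P (tri_card fT1.1 AT1).
have aA : a \in A by rewrite AE !inE eqxx.
have bA : b \in A by rewrite AE !inE eqxx orbT.
have cA : c \in A by rewrite AE !inE eqxx !orbT.
have ba : b != a by rewrite eq_sym.
have ca : c != a by rewrite eq_sym.
have abT2 : [set b; a] \in edges T2 by rewrite -E12; apply: edge_in AT1 bA aA ba.
have acT2 : [set c; a] \in edges T2 by rewrite -E12; apply: edge_in AT1 cA aA ca.
have bcT2 : [set b; c] \in edges T2 by rewrite -E12; apply: edge_in AT1 bA cA bc.
have rq := hull_rect (hull_midpoint R b c).
have [B [e [BT e0 he]]] := tri_ray fT2.1 rq (coord_rect R a).
have qB : hull B (midpoint R b c).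
  have := he 0; rewrite lexx ltW // => /(_ isT).
  by rewrite /lerp !mul0r !addr0 -surjective_pairing.
have half01 : 0 < (1 / 2 : R) < 1 by apply/andP; split; lra.
have bcB : [set b; c] \subset B.
  apply/setIidPl/eqP; rewrite eqEcard subsetIl /= leqNgt; apply/negP => lt.
  have hI := edge_tri_face fT2 bcT2 BT (hull_midpoint R b c) qB.
  have [|p pI pE] := hull_small hI.
    by have /edgesP[c2 _] := bcT2; rewrite -ltnS -c2.
  move: pI; rewrite inE => /andP[pbc _].
  exact: lerp_vertex bc half01 pbc pE.
have [bB cB] : b \in B /\ c \in B by split; apply: (subsetP bcB); rewrite !inE eqxx ?orbT.
have [a' [ba' ca' BE]] : exists a', [/\ b != a', c != a' & B = [set b; c; a']].
  have [j [k [bj bk jk BE]]] := set3_mem (tri_card fT2.1 BT) bB.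
  move: cB; rewrite BE !inE eq_sym (negPf bc) /= => /orP[] /eqP cE.
    by exists k; rewrite cE.
  by exists j; rewrite cE (eq_sym k) setUAC.
have a'B : a' \in B by rewrite BE !inE eqxx !orbT.
rewrite BE in BT he.
have o1 := full_unimodular fT2 bc ba' ca' BT.
have AE' := set3_eq (tri_card fT1.1 AT1) bA cA aA bc ba ca.
have AT1' : [set b; c; a] \in T1 by rewrite -AE'.
have o2 := full_unimodular fT1 bc ba ca AT1'.
have o10 : orient (co b) (co c) (co a') != 0 by case: o1 => ->; rewrite ?oppr_eq0 oner_eq0.
have same : orient (co b) (co c) (co a) = orient (co b) (co c) (co a').
  have /(tri_hullP _ bc ba' ca' o10)[_ _] := he e (introT andP (conj (ltW e0) (lexx e))).
  rewrite orient_lerp /midpoint orient_lerp !orient0.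
  have -> x : 0 + 1 / 2 * (0 - 0) + e * (x - (0 + 1 / 2 * (0 - 0))) = e * x by ring.
  rewrite -mulrA pmulr_rge0 //.
  by case: o1 => ->; case: o2 => -> //; rewrite ?invr1 ?invrN1 ?mulrN1 ?mulr1; lra.
have [h1 h2] := orient_basis (co b) (co c) (co a) (co a').
rewrite -same in h1 h2; set o := orient (co b) (co c) (co a) in h1 h2 same o2.
have oo : o * o = 1 by case: o2 => ->; ring.
have o0 : o != 0 by case: o2 => ->; rewrite ?oppr_eq0 oner_eq0.
set k := o * orient (co b) (co a') (co a).
have step (u v w r : R) : o * (u - v) = orient (co b) (co a') (co a) * r + o * (w - v) ->
    u = w + k * r.
  move=> h; apply: (mulfI o0); rewrite /k.
  have -> : o * (w + o * orient (co b) (co a') (co a) * r) =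
    o * w + (o * o) * (orient (co b) (co a') (co a) * r) by ring.
  by rewrite oo; move: h; clear; lra.
have e1 := step _ _ _ _ h1; have e2 := step _ _ _ _ h2.
have ba'T2 : [set b; a'] \in edges T2 by apply: edge_in BT _ _ ba'; rewrite -BE.
have ca'T2 : [set c; a'] \in edges T2 by apply: edge_in BT _ _ ca'; rewrite -BE.
have [kn|kp|k0] := ltgtP k 0.
- have cb : c != b by rewrite eq_sym.
  case: (@trapezoid_cross T2 a a' c b (- k)) => //; rewrite ?oppr_gt0 //.
    by rewrite e1; ring.
  by rewrite e2; ring.
- by case: (@trapezoid_cross T2 a a' b c k).
have aa : a' = a.
  apply: (@coord_inj R m n); rewrite (surjective_pairing (co a')) e1 e2 k0 !mul0r !addr0.
  by rewrite -surjective_pairing.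
by rewrite AE' -aa.
Qed.

Lemma edges_inj T1 T2 : full_triangulation R T1 -> full_triangulation R T2 ->
  edges T1 = edges T2 -> T1 = T2.
Proof. by move=> f1 f2 e; apply/eqP; rewrite eqEsubset !edges_sub_inj. Qed.

(** For an edge this is twice the level of its midpoint, hence its place in the scan. *)
Definition key e : nat := (\sum_(p in e) level p)%N.

Lemma key_pair a b : a != b -> key [set a; b] = (level a + level b)%N.
Proof. by move=> ab; rewrite /key big_setU1 ?inE //= big_set1. Qed.

Lemma edge_ends T e : e \in edges T ->
  exists a b, [/\ (level a < level b)%N, e = [set a; b] & key e = (level a + level b)%N].
Proof.
move=> /edgesP[/eqP/cards2P[a [b [ab ->]]] _].
have := ab; rewrite -(inj_eq (@level_inj m n)) neq_ltn => /orP[lt|lt].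
  by exists a, b; rewrite key_pair.
by exists b, a; rewrite setUC key_pair // eq_sym.
Qed.

Definition early k T : {set {set point}} := [set e in edges T | (key e < k)%N].

Lemma early_sub k T T1 u v : early k T = early k T1 -> [set u; v] \in edges T ->
  (level u + level v < k)%N -> [set u; v] \in edges T1.
Proof.
move=> eT uvT lt; have : [set u; v] \in early k T.
  by rewrite inE uvT key_pair //; apply: edge_neq uvT.
by rewrite eT inE => /andP[].
Qed.

Definition icross (a b c d : point) : int :=
  ((b.1 : nat)%:Z - (a.1 : nat)%:Z) * ((d.2 : nat)%:Z - (c.2 : nat)%:Z) -
  ((b.2 : nat)%:Z - (a.2 : nat)%:Z) * ((d.1 : nat)%:Z - (c.1 : nat)%:Z).

(** The lowest of the four ends, say [a], forms with [c d] a unimodular triangle by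
    [tri_of_smaller_end]. Substituting [b = c + d - a] turns the determinant of the two directions
    into twice that of this triangle. *)
Lemma edges_icross T T1 a b c d : full_triangulation R T -> full_triangulation R T1 ->
  [set a; b] \in edges T -> [set c; d] \in edges T1 ->
  (level a < level b)%N -> (level c < level d)%N ->
  (level a + level b = level c + level d)%N ->
  early (level a + level b) T = early (level a + level b) T1 ->
  [set a; b] != [set c; d] -> icross a b c d = 2 \/ icross a b c d = - 2.
Proof.
move=> fT fT1 abT cdT ltab ltcd lev ET ne.
wlog lt : T T1 a b c d fT fT1 abT cdT ltab ltcd lev ET ne / (level a < level c)%N.
  move=> th; have [lt|gt|eq] := ltngtP (level a) (level c).
  - exact: (th T T1).
  - have sw : icross a b c d = - icross c d a b by rewrite /icross; ring.
    have [||h|h] := th T1 T c d a b fT1 fT cdT abT ltcd ltab (esym lev) _ _ gt.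
    + by rewrite -lev.
    + by rewrite eq_sym.
    + by right; rewrite sw h.
    + by left; rewrite sw h.
  - case/eqP: ne; rewrite (level_inj eq); congr (_ :|: [set _]); apply: level_inj.
    by move: lev; rewrite eq => /addnI.
have triT1 : [set a; c; d] \in T1.
  apply: (tri_of_smaller_end fT1 fT abT cdT lev lt ltcd) => u v uvT h.
  exact: early_sub (esym ET) uvT h.
have ac : a != c by rewrite -(inj_eq (@level_inj m n)) ltn_eqF.
have ad : a != d by rewrite -(inj_eq (@level_inj m n)) ltn_eqF // (ltn_trans lt).
have cd := edge_neq cdT.
have [s1 s2] := level_sum lev.
have e : icross a b c d = 2 * iorient a c d.
  have b1 : (b.1 : nat)%:Z = (c.1 : nat)%:Z + (d.1 : nat)%:Z - (a.1 : nat)%:Z.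
    by rewrite -PoszD -s1 PoszD addrC addKr.
  have b2 : (b.2 : nat)%:Z = (c.2 : nat)%:Z + (d.2 : nat)%:Z - (a.2 : nat)%:Z.
    by rewrite -PoszD -s2 PoszD addrC addKr.
  by rewrite /icross b1 b2 /iorient; ring.
have := full_unimodular fT1 ac ad cd triT1; rewrite orient_int e.
case=> h; [left|right].
  have -> : iorient a c d = 1 by apply: (@intr_inj R); rewrite h.
  by [].
have -> : iorient a c d = - 1 by apply: (@intr_inj R); rewrite h intrN.
by [].
Qed.

(** The three signs have an odd sum, and the relation makes the product of this sum with [S]
    even. *)
Lemma sign_parity (e1 e2 e3 S x1 x2 x3 : int) : e1 = 1 \/ e1 = - 1 ->
  e2 = 1 \/ e2 = - 1 -> e3 = 1 \/ e3 = - 1 ->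
  e1 * (S - 2 * x1) + e2 * (S - 2 * x2) + e3 * (S - 2 * x3) = 0 -> exists y, S = 2 * y.
Proof.
move=> h1 h2 h3 h.
exists (S %/ 2)%Z.
by case: h1 h2 h3 h => -> [] -> [] ->; lia.
Qed.

Lemma even_of_double (x y : nat) (z : int) : x%:Z + y%:Z = 2 * z -> ~~ odd (x + y).
Proof. lia. Qed.

(** The key [k] determines the midpoint, so each triangulation has at most one edge with this key,
    and all three have one as soon as one does. Three distinct ones would have directions with
    pairwise determinants 2 or -2, which forces an integral midpoint. *)
Lemma early_fiber T1 T2 T3 k : full_triangulation R T1 -> full_triangulation R T2 ->
  full_triangulation R T3 -> early k T1 = early k T2 -> early k T2 = early k T3 ->
  [\/ early k.+1 T1 = early k.+1 T2, early k.+1 T2 = early k.+1 T3 |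
      early k.+1 T3 = early k.+1 T1].
Proof.
move=> f1 f2 f3 E12 E23; have E31 : early k T3 = early k T1 by rewrite E12.
have split_early T : early k.+1 T = early k T :|: [set e in edges T | key e == k].
  by apply/setP => e; rewrite !inE ltnS leq_eqVlt orbC andb_orr.
have transfer T T' a b : full_triangulation R T -> full_triangulation R T' ->
    [set a; b] \in edges T -> (level a + level b = k)%N ->
    exists c d, [/\ (level c < level d)%N, [set c; d] \in edges T' &
      (level c + level d = k)%N].
  move=> fT fT' abT lev.
  have im : (a.1 + b.1 <= m.*2)%N by rewrite -addnn leq_add ?leq_ord.
  have jn : (a.2 + b.2 <= n.*2)%N by rewrite -addnn leq_add ?leq_ord.
  have od : ~~ (~~ odd (a.1 + b.1) && ~~ odd (a.2 + b.2)).
    apply/negP => /andP[ev1 ev2].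
    apply: (@edge_midpoint R m n T a b (inord (a.1 + b.1)./2, inord (a.2 + b.2)./2) fT abT).
    rewrite /= !inordK ?ltnS ?leq_half_double ?(leq_trans im) ?(leq_trans jn) //.
    by rewrite !mul2n !even_halfK.
  have [c [d [cdT e1 e2]]] := half_point_edge fT' im jn od.
  have levcd : (level c + level d = k)%N.
    have mE p q : (level p + level q = (p.1 + q.1) * n.*2.+1 + (p.2 + q.2))%N.
      by rewrite /level mulnDl addnACA.
    by rewrite mE e1 e2 -mE.
  have := edge_neq cdT; rewrite -(inj_eq (@level_inj m n)) neq_ltn => /orP[lt|lt].
    by exists c, d.
  by exists d, c; rewrite setUC addnC.
have uniq_edge T a b : full_triangulation R T -> [set a; b] \in edges T ->
    (level a + level b = k)%N -> [set e in edges T | key e == k] = [set [set a; b]].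
  move=> fT abT lev; apply/setP => e; rewrite in_set in_set1.
  apply/andP/eqP => [[eT /eqP ke]|->]; last first.
    by rewrite key_pair ?(edge_neq abT) // lev.
  have [c [d [ltcd eE ke']]] := edge_ends eT.
  rewrite eE in eT *; apply: (same_midpoint fT eT abT);
    by have [] := @level_sum m n c d a b; rewrite // -ke' ke.
have [none|] := eqVneq [set e in edges T1 | key e == k] set0.
  have none' T : full_triangulation R T -> [set e in edges T | key e == k] = set0.
    move=> fT; apply/eqP; rewrite -subset0; apply/subsetP => e.
    rewrite in_set => /andP[eT /eqP ke]; have [a [b [_ eE ke']]] := edge_ends eT.
    rewrite eE in eT; have [c [d [_ cdT lev]]] := transfer T T1 a b fT f1 eT (etrans (esym ke') ke).
    by move/setP/(_ [set c; d]): none; rewrite in_set in_set0 cdT key_pair ?(edge_neq cdT) // lev eqxx.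
  by constructor 1; rewrite !split_early !none' ?E12.
case/set0Pn => e; rewrite in_set => /andP[eT /eqP ke].
have [a [b [ltab eE ke']]] := edge_ends eT; rewrite eE in eT.
have levab := etrans (esym ke') ke.
have [c [d [ltcd cdT levcd]]] := transfer T1 T2 a b f1 f2 eT levab.
have [g [h [ltgh ghT levgh]]] := transfer T1 T3 a b f1 f3 eT levab.
rewrite !split_early (uniq_edge _ _ _ f1 eT levab) (uniq_edge _ _ _ f2 cdT levcd).
rewrite (uniq_edge _ _ _ f3 ghT levgh) E12 E23.
have [->|n12] := eqVneq [set a; b] [set c; d]; first by constructor 1.
have [->|n23] := eqVneq [set c; d] [set g; h]; first by constructor 2.
have [->|n31] := eqVneq [set g; h] [set a; b]; first by constructor 3.
exfalso.
have c12 : icross a b c d = 2 \/ icross a b c d = - 2.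
  by apply: (edges_icross f1 f2) => //; rewrite ?levab ?levcd.
have c23 : icross c d g h = 2 \/ icross c d g h = - 2.
  by apply: (edges_icross f2 f3) => //; rewrite ?levgh ?levcd.
have c31 : icross g h a b = 2 \/ icross g h a b = - 2.
  by apply: (edges_icross f3 f1) => //; rewrite ?levgh ?levab.
have [s1 s2] := @level_sum m n c d a b (etrans levcd (esym levab)).
have [t1 t2] := @level_sum m n g h a b (etrans levgh (esym levab)).
have half (x : int) : x = 2 \/ x = - 2 -> exists y : int, (y = 1 \/ y = - 1) /\ x = 2 * y.
  by case=> ->; [exists 1|exists (- 1)]; split=> //; [left|right].
have [x12 [y12 e12]] := half _ c12; have [x23 [y23 e23]] := half _ c23.
have [x31 [y31 e31]] := half _ c31.
(* Three plane vectors satisfy [det(v2, v3) v1 + det(v3, v1) v2 + det(v1, v2) v3 = 0], and halving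
   leaves coefficients 1 or -1. A coordinate of a direction has the form [S - 2 x], where [S] is the
   common sum of that coordinate over the two ends; so [S] is even. *)
have nz (f : point -> nat) : (f c + f d = f a + f b)%N -> (f g + f h = f a + f b)%N ->
    x23 * ((f b)%:Z - (f a)%:Z) + x31 * ((f d)%:Z - (f c)%:Z) + x12 * ((f h)%:Z - (f g)%:Z) = 0 ->
    exists y : int, (f a)%:Z + (f b)%:Z = 2 * y.
  move=> ec eg ez; apply: (sign_parity (x1 := (f a)%:Z) (x2 := (f c)%:Z) (x3 := (f g)%:Z) y23 y31 y12).
  rewrite -[RHS]ez; congr (_ * _ + _ * _ + _ * _); lia.
have lin (f : point -> nat) :
    icross c d g h * ((f b)%:Z - (f a)%:Z) + icross g h a b * ((f d)%:Z - (f c)%:Z) +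
      icross a b c d * ((f h)%:Z - (f g)%:Z) = 0 ->
    x23 * ((f b)%:Z - (f a)%:Z) + x31 * ((f d)%:Z - (f c)%:Z) + x12 * ((f h)%:Z - (f g)%:Z) = 0.
  by rewrite e12 e23 e31 => ez; apply: (@mulfI _ 2) => //; rewrite mulr0 -[RHS]ez; ring.
have [y1 yE1] : exists y : int, (a.1 : nat)%:Z + (b.1 : nat)%:Z = 2 * y.
  by apply: (nz (fun p => p.1 : nat)) => //; apply: (lin (fun p => p.1 : nat)); rewrite /icross; ring.
have [y2 yE2] : exists y : int, (a.2 : nat)%:Z + (b.2 : nat)%:Z = 2 * y.
  by apply: (nz (fun p => p.2 : nat)) => //; apply: (lin (fun p => p.2 : nat)); rewrite /icross; ring.
apply: (@edge_midpoint R m n T1 a b (inord (a.1 + b.1)./2, inord (a.2 + b.2)./2) f1 eT).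
have im : (a.1 + b.1 <= m.*2)%N by rewrite -addnn leq_add ?leq_ord.
have jn : (a.2 + b.2 <= n.*2)%N by rewrite -addnn leq_add ?leq_ord.
rewrite /= !inordK ?ltnS ?leq_half_double ?(leq_trans im) ?(leq_trans jn) //.
by rewrite !mul2n !even_halfK // (even_of_double yE1, even_of_double yE2).
Qed.

(** Midpoints are stored with doubled coordinates; both even means a lattice point. *)
Definition midpoints : {set 'I_m.*2.+1 * 'I_n.*2.+1} :=
  [set ij : ('I_m.*2.+1 * 'I_n.*2.+1)%type | ~~ (~~ odd ij.1 && ~~ odd ij.2)].

Definition midlevel (ij : 'I_m.*2.+1 * 'I_n.*2.+1) : nat := (ij.1 * n.*2.+1 + ij.2)%N.

Lemma midlevel_inj : injective midlevel.
Proof.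
move=> [i j] [i' j']; rewrite /midlevel /= => h.
have h1 := congr1 (divn^~ n.*2.+1) h; have h2 := congr1 (modn^~ n.*2.+1) h.
move: h1 h2; rewrite /= !divnMDl // !(divn_small (ltn_ord _)) !addn0 => h1.
by rewrite !modnMDl !(modn_small (ltn_ord _)) => h2; congr pair; apply: val_inj.
Qed.

Lemma card_midpoints : (#|midpoints| + m.+1 * n.+1 <= m.*2.+1 * n.*2.+1)%N.
Proof.
pose dbl (p : point) : 'I_m.*2.+1 * 'I_n.*2.+1 := (inord p.1.*2, inord p.2.*2).
have dbl1 p : ((dbl p).1 = p.1.*2 :> nat)%N by rewrite inordK // ltnS leq_double leq_ord.
have dbl2 p : ((dbl p).2 = p.2.*2 :> nat)%N by rewrite inordK // ltnS leq_double leq_ord.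
have dbl_inj : injective dbl.
  move=> p q e; have := dbl1 p; have := dbl2 p; rewrite e dbl1 dbl2 => /double_inj e2 /double_inj e1.
  by case: p q e1 e2 {e} => [p1 p2] [q1 q2] /= e1 e2; congr pair; apply: val_inj.
have -> : (m.*2.+1 * n.*2.+1 = #|[set: 'I_m.*2.+1 * 'I_n.*2.+1]|)%N.
  by rewrite cardsT card_prod !card_ord.
have -> : (m.+1 * n.+1 = #|dbl @: [set: point]|)%N.
  by rewrite card_imset // cardsT card_prod !card_ord.
rewrite -cardsUI (_ : _ :&: _ = set0) ?cards0 ?addn0 ?subset_leq_card ?subsetT //.
apply/eqP; rewrite -subset0; apply/subsetP => ij; rewrite inE => /andP[+ /imsetP[p _ ijE]].
by rewrite ijE inE dbl1 dbl2 !odd_double.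
Qed.

(** Passing from [k] to [k.+1] adds nothing unless [k] is the doubled level of a possible midpoint,
    and in that case [early_fiber] allows at most a doubling. *)
Lemma card_early (F : {set {set {set point}}}) k :
  (forall T, T \in F -> full_triangulation R T) ->
  (#|early k @: F| <= 2 ^ #|[set ij in midpoints | midlevel ij < k]|)%N.
Proof.
move=> fF; elim: k => [|k IH].
  apply: (@leq_trans 1); last by rewrite expn_gt0.
  rewrite -(cards1 (set0 : {set {set point}})); apply: subset_leq_card; apply/subsetP => X.
  by case/imsetP => T TF ->; rewrite in_set1; apply/eqP/setP => e; rewrite in_set in_set0 ltn0 andbF.
have restr T : early k T = [set e in early k.+1 T | (key e < k)%N].
  apply/setP => e; rewrite [LHS]in_set [RHS]in_set [e \in early _ _]in_set -andbA.
  case: (e \in edges T) => //=; case: (ltnP (key e) k) => [h|]; last by rewrite andbF.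
  by rewrite ltnS ltnW.
have imE : early k @: F = (fun Z : {set {set point}} => [set e in Z | (key e < k)%N]) @: (early k.+1 @: F).
  by rewrite -imset_comp; apply: eq_imset => T; exact: restr.
have step : (#|early k.+1 @: F| <= 2 * #|early k @: F|)%N.
  rewrite imE; apply: leq_card_fibers2 => X1 X2 X3 h1 h2 h3.
  have [T1 F1 {X1 h1}->] := imsetP h1; have [T2 F2 {X2 h2}->] := imsetP h2.
  have [T3 F3 {X3 h3}->] := imsetP h3.
  by rewrite -!restr; apply: early_fiber; apply: fF.
have [[ij ijM kE]|none] : (exists2 ij, ij \in midpoints & midlevel ij = k) \/
    (forall ij, ij \in midpoints -> midlevel ij <> k).
  have [/exists_inP[ij ijM /eqP kE]|/exists_inPn h] :=
    boolP [exists ij in midpoints, midlevel ij == k]; first by left; exists ij.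
  by right=> ij /h /eqP.
  apply: (leq_trans step).
  have -> : [set ij in midpoints | (midlevel ij < k.+1)%N] =
      ij |: [set ij in midpoints | (midlevel ij < k)%N].
    apply/setP => x; rewrite in_setU1 !in_set ltnS leq_eqVlt andb_orr; congr (_ || _).
    apply/andP/eqP => [[_ /eqP xk]|->]; last by rewrite kE; move: ijM; rewrite in_set.
    by apply: midlevel_inj; rewrite kE.
  by rewrite cardsU1 in_set kE ltnn andbF expnS leq_pmul2l.
rewrite (_ : early k.+1 @: F = early k @: F).
  apply: leq_trans IH _; rewrite leq_exp2l //; apply: subset_leq_card.
  by apply/subsetP => x; rewrite !in_set => /andP[-> /ltnW].
apply: eq_in_imset => T TF; rewrite [RHS]restr; apply/setP => e; rewrite [RHS]in_set.
case eE: (e \in early k.+1 T) => //=; apply/esym; move: eE; rewrite in_set ltnS leq_eqVlt.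
case/andP => eT /predU1P[ke|//]; exfalso.
have [a [b [_ eE ke']]] := edge_ends eT; rewrite eE in eT.
have im : (a.1 + b.1 < m.*2.+1)%N by rewrite ltnS -addnn leq_add ?leq_ord.
have jn : (a.2 + b.2 < n.*2.+1)%N by rewrite ltnS -addnn leq_add ?leq_ord.
apply: (none (Ordinal im, Ordinal jn)).
  rewrite in_set /=; apply/negP => /andP[ev1 ev2].
  apply: (@edge_midpoint R m n T a b (inord (a.1 + b.1)./2, inord (a.2 + b.2)./2) (fF _ TF) eT).
  rewrite /= !inordK ?ltnS ?leq_half_double ?(ltnW im) ?(ltnW jn) //.
  by rewrite !mul2n !even_halfK.
by rewrite /midlevel /= -ke ke' /level mulnDl addnACA.
Qed.

Lemma card_full : (#|triangulations R (set0 : {set point})| <= 2 ^ #|midpoints|)%N.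
Proof.
set F := triangulations R (set0 : {set point}).
have fF T : T \in F -> full_triangulation R T.
  by move=> /triangulationsP[triT /(congr1 (@setC _))]; rewrite setCK setC0.
pose K := (\max_(e : {set point}) key e).+1.
have earlyE T : early K T = edges T.
  by apply/setP => e; rewrite in_set ltnS leq_bigmax andbT.
have -> : #|F| = #|early K @: F|.
  apply/esym/card_in_imset => T1 T2 F1 F2; rewrite !earlyE.
  by apply: edges_inj; apply: fF.
apply: leq_trans (card_early K fF) _; rewrite leq_exp2l //; apply: subset_leq_card.
by apply/subsetP => x; rewrite in_set => /andP[].
Qed.

Lemma fnp_upper : (fnp R m n <= 3 ^ (m.+1 * n.+1) * 2 ^ (m.*2.+1 * n.*2.+1 - m.+1 * n.+1))%N.
Proof.
apply: leq_trans (fnp_le R m n) _; rewrite leq_mul2l; apply/orP; right.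
apply: leq_trans card_full _; rewrite leq_exp2l //.
by have := card_midpoints; lia.
Qed.

End CountFull.

(** * Symmetries and gluing *)

Section Transport.
Variables (R : realType) (m n m' n' : nat).
Variables (f : lattice_point m n -> lattice_point m' n') (L L' : R * R -> R * R).

Definition affine_map (L : R * R -> R * R) : Prop :=
  exists a b c d e g, forall x, L x = (affine_fun a b c x, affine_fun d e g x).

(** Serves for the transposition, the reflection and the two embeddings used in gluing. As an
    embedding is not onto, the inverse is required only of the maps of the plane. *)
Definition lattice_affine : Prop :=
  [/\ affine_map L, affine_map L', cancel L L', cancel L' L &
      forall p, L (coord R p) = coord R (f p)].

Hypothesis fL : lattice_affine.

Lemma lattice_affine_inj : injective f.
Proof.
case: fL => _ _ LK _ Lf p q e; apply: (@coord_inj R m n).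
by apply: (can_inj LK); rewrite !Lf e.
Qed.

Lemma affine_sum (M : R * R -> R * R) (I : finType) (P : pred I) (w : I -> R)
    (z : I -> R * R) y : affine_map M -> \sum_(i | P i) w i = 1 ->
  y.1 = \sum_(i | P i) w i * (z i).1 -> y.2 = \sum_(i | P i) w i * (z i).2 ->
  (M y).1 = \sum_(i | P i) w i * (M (z i)).1 /\ (M y).2 = \sum_(i | P i) w i * (M (z i)).2.
Proof.
move=> [a [b [c [d [e [g ME]]]]]] w1 y1 y2.
have key (u v t : R) : affine_fun u v t y = \sum_(i | P i) w i * affine_fun u v t (z i).
  rewrite /affine_fun y1 y2.
  under [RHS]eq_bigr do rewrite !mulrDr; rewrite !big_split /= -mulr_suml w1 mul1r.
  by congr (_ + _ + _); rewrite mulr_sumr; apply: eq_bigr => i _; ring.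
rewrite ME /= !key; split; apply: eq_bigr => i _; by rewrite ME.
Qed.

Lemma hull_image (A : {set lattice_point m n}) y : hull (f @: A) y <-> hull A (L' y).
Proof.
have [aL aL' LK L'K Lf] := fL; have f_inj := lattice_affine_inj.
have sumE (F : lattice_point m' n' -> R) : \sum_(q in f @: A) F q = \sum_(p in A) F (f p).
  by rewrite big_imset //= => p q _ _ /f_inj.
split=> [[w [w0 w1 wx wy]]|[w [w0 w1 wx wy]]].
  rewrite !sumE in w1 wx wy.
  have [ex ey] := affine_sum (z := fun p => coord R (f p)) aL' w1 wx wy.
  exists (w \o f); split=> //.
  - by move=> p pA; apply: w0; apply: imset_f.
  - by rewrite ex; apply: eq_bigr => p _; rewrite -Lf LK.
  - by rewrite ey; apply: eq_bigr => p _; rewrite -Lf LK.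
have [ex ey] := affine_sum (z := fun p => coord R p) aL w1 wx wy.
rewrite L'K in ex ey.
(* The weights are carried along [f]; 0 is a default value outside its image. *)
pose v q := if [pick p | f p == q] is Some p then w p else 0.
have vf p : v (f p) = w p.
  by rewrite /v; case: pickP => [p' /eqP/f_inj -> //|/(_ p)]; rewrite eqxx.
exists v; split.
- by move=> q /imsetP[p pA ->]; rewrite vf w0.
- by rewrite sumE -w1; apply: eq_bigr => p _; rewrite vf.
- by rewrite sumE ex; apply: eq_bigr => p _; rewrite vf Lf.
- by rewrite sumE ey; apply: eq_bigr => p _; rewrite vf Lf.
Qed.

Lemma indep_image (A : {set lattice_point m n}) : affinely_independent R A -> affinely_independent R (f @: A).
Proof.
have [aL [a [b [c [d [e [g L'E]]]]]] LK L'K Lf] := fL; have f_inj := lattice_affine_inj.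
have sumE (F : lattice_point m' n' -> R) : \sum_(q in f @: A) F q = \sum_(p in A) F (f p).
  by rewrite big_imset //= => p q _ _ /f_inj.
move=> iA w; rewrite !sumE => w0 wx wy.
have key (u v t : R) : \sum_(p in A) w (f p) * affine_fun u v t (coord R (f p)) = 0.
  rewrite /affine_fun /=; under eq_bigr do rewrite !mulrDr.
  rewrite !big_split /= -mulr_suml w0 mul0r add0r.
  under eq_bigr do rewrite mulrCA; under [X in _ + X]eq_bigr do rewrite mulrCA.
  by rewrite -!mulr_sumr wx wy !mulr0 addr0.
have wA : forall p, p \in A -> w (f p) = 0.
  apply: (iA (w \o f)) => //=.
  - rewrite -[RHS](key a b c); apply: eq_bigr => p _.
    by have := congr1 fst (L'E (coord R (f p))); rewrite -Lf LK /= => <-.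
  - rewrite -[RHS](key d e g); apply: eq_bigr => p _.
    by have := congr1 snd (L'E (coord R (f p))); rewrite -Lf LK /= => <-.
by move=> q /imsetP[p pA ->]; apply: wA.
Qed.

Definition image_tri (T : {set {set lattice_point m n}}) : {set {set lattice_point m' n'}} :=
  [set f @: A | A : {set lattice_point m n} in T].

Lemma cover_image T : cover (image_tri T) = f @: cover T.
Proof.
apply/setP => q; apply/bigcupP/imsetP => [[_ /imsetP[A AT ->] /imsetP[p pA ->]]|].
  by exists p => //; apply/bigcupP; exists A.
move=> [p /bigcupP[A AT pA] ->]; exists (f @: A); last exact: imset_f.
by apply: imset_f.
Qed.

Lemma image_triangle T A : is_lattice_triangulation R T -> A \in image_tri T ->
  is_triangle R A.
Proof.
move=> triT /imsetP[B BT ->]; split.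
  by rewrite card_imset ?(tri_card triT) //; exact: lattice_affine_inj.
exact: (indep_image (tri_indep triT BT)).
Qed.

Lemma image_face T A B (y : R * R) : is_lattice_triangulation R T -> A \in image_tri T ->
  B \in image_tri T -> hull A y -> hull B y -> hull (A :&: B) y.
Proof.
move=> triT /imsetP[A' AT ->] /imsetP[B' BT ->] /hull_image hA /hull_image hB.
rewrite -imsetI; last by move=> p q _ _; apply: lattice_affine_inj.
by apply/hull_image; apply: (tri_face triT AT BT).
Qed.

Lemma image_tri_inj : injective image_tri.
Proof. exact: imset_inj (imset_inj lattice_affine_inj). Qed.

Lemma image_is_triangulation T :
  (forall y, @rectangle R m' n' y <-> @rectangle R m n (L' y)) ->
  is_lattice_triangulation R T -> is_lattice_triangulation R (image_tri T).
Proof.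
move=> rL triT; split=> [A|| A B AT BT].
- exact: image_triangle.
- apply/seteqP; split=> [y [A _]|y /rL/(tri_cover triT)[A AT hA]]; first exact: hull_rect.
  by exists (f @: A); [rewrite /= imset_f|apply/hull_image].
- apply/seteqP; split=> [y [hA hB]|y h].
    exact: (image_face triT AT BT hA hB).
  by split; apply: hull_sub h; rewrite ?subsetIl ?subsetIr.
Qed.

End Transport.

Section Symmetries.
Variables (R : realType) (m n : nat).

Definition transpose (p : lattice_point m n) : lattice_point n m := (p.2, p.1).
Definition swap (x : R * R) : R * R := (x.2, x.1).

Lemma transpose_affine : lattice_affine transpose swap swap.
Proof.
have aff : affine_map swap.
  exists 0, 0, 1, 0, 1, 0 => x; rewrite /swap /affine_fun; congr pair; ring.
by split=> // -[x y].
Qed.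

Lemma fnp_transpose_le : (fnp R m n <= fnp R n m)%N.
Proof.
rewrite /fnp -(card_imset _ (image_tri_inj transpose_affine)).
apply: subset_leq_card; apply/subsetP => _ /imsetP[T + ->]; rewrite !inE => /asboolP triT.
apply/asboolP; apply: (image_is_triangulation transpose_affine) => // y.
by rewrite /rectangle /=; split=> -[].
Qed.

Definition mirror (p : lattice_point m n) : lattice_point m n := (rev_ord p.1, p.2).
Definition flip (x : R * R) : R * R := (m%:R - x.1, x.2).

Lemma mirror_affine : lattice_affine mirror flip flip.
Proof.
have aff : affine_map flip.
  exists m%:R, (-1), 0, 0, 0, 1 => x; rewrite /flip /affine_fun; congr pair; ring.
have flipK : cancel flip flip by move=> [x y]; rewrite /flip /=; congr pair; ring.
split=> // -[i j]; rewrite /flip /coord /=; congr pair.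
by rewrite subSS natrB // -ltnS.
Qed.

Lemma mirror_triangulation T : is_lattice_triangulation R T ->
  is_lattice_triangulation R (image_tri mirror T).
Proof.
move=> triT; apply: (image_is_triangulation mirror_affine) => // y.
by rewrite /rectangle /=; split=> -[/andP[? ?] ?]; split=> //; apply/andP; split; lra.
Qed.

End Symmetries.

Lemma fnp_transpose (R : realType) m n : fnp R m n = fnp R n m.
Proof. by apply/eqP; rewrite eqn_leq !fnp_transpose_le. Qed.

(** * The vertices on the two vertical sides *)

Section Types.
Variables (R : realType) (m n : nat).
Implicit Types (T : {set {set lattice_point m n}}) (A : {set lattice_point m n}).

Definition left_type T : {set 'I_n.+1} := [set y | (ord0, y) \in cover T].
Definition right_type T : {set 'I_n.+1} := [set y | (ord_max, y) \in cover T].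

(** A nonnegative function with weighted mean 0 vanishes wherever the weight is positive. Applied to
    the distance from a side of the rectangle, this shows that the side cuts a face out of each
    hull. *)
Lemma face_bary A (x : R * R) w (h : lattice_point m n -> R) : bary A x w ->
  (forall p, 0 <= h p) -> \sum_p w p * h p = 0 -> bary [set p in A | h p == 0] x w.
Proof.
move=> bw h0 s0; have [w0 wA _ _ _] := bw; apply: (bary_restrict bw) => p.
rewrite inE negb_and => /orP[/wA //|hp].
have /eqP := s0; rewrite psumr_eq0 => [/allP/(_ p)|q _]; last by rewrite mulr_ge0.
by rewrite mem_index_enum => /(_ isT) /=; rewrite mulf_eq0 (negPf hp) orbF => /eqP.
Qed.

Lemma left_face A (x : R * R) : x.1 = 0 -> hull A x -> hull [set p in A | p.1 == ord0] x.
Proof.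
move=> x0 /hullP[w bw]; have [_ _ _ wx _] := bw.
have : bary [set p in A | ((p.1 : nat)%:R : R) == 0] x w by apply: face_bary bw _ _; rewrite -?wx.
move/bary_hull; apply: hull_sub; apply/subsetP => p; rewrite !inE pnatr_eq0.
by move=> /andP[-> /eqP p0]; apply/eqP/val_inj.
Qed.

Lemma right_face A (x : R * R) : x.1 = m%:R -> hull A x ->
  hull [set p in A | p.1 == ord_max] x.
Proof.
move=> xm /hullP[w bw]; have [w0 _ w1 wx _] := bw.
have h0 (p : lattice_point m n) : 0 <= m%:R - (p.1 : nat)%:R :> R.
  by rewrite subr_ge0 ler_nat leq_ord.
have s0 : \sum_p w p * (m%:R - (p.1 : nat)%:R) = 0.
  under eq_bigr do rewrite mulrBr.
  by rewrite sumrB -mulr_suml w1 mul1r -wx xm subrr.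
move/bary_hull: (face_bary bw h0 s0); apply: hull_sub; apply/subsetP => p.
rewrite !inE subr_eq0 eqr_nat => /andP[-> /eqP pm]; apply/eqP/val_inj => /=.
by rewrite -pm.
Qed.

Lemma hull_extent A (x : R * R) (h : lattice_point m n -> R) w : bary A x w ->
  \sum_p w p * h p = 0 -> exists2 p, p \in A & h p <= 0.
Proof.
move=> bw s0; have [w0 wA w1 _ _] := bw.
have [p /andP[pA hp]|no] := pickP [pred p | (p \in A) && (h p <= 0)]; first by exists p.
have [q qA wq] := bary_nonempty bw; exfalso.
have pos p : p \in A -> 0 < h p by move=> pA; rewrite ltNge; have /= := no p; rewrite pA /= => ->.
have /eqP := s0; rewrite psumr_eq0 => [/allP/(_ q)|p _]; last first.
  by have [pA|/wA ->] := boolP (p \in A); rewrite ?mul0r // mulr_ge0 // ltW ?pos.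
by rewrite mem_index_enum => /(_ isT) /=; rewrite mulf_eq0 !gt_eqF // pos.
Qed.

Lemma hull_below A (x : R * R) : hull A x -> exists2 p, p \in A & (p.2 : nat)%:R <= x.2.
Proof.
move=> /hullP[w bw]; have [_ _ w1 _ wy] := bw.
have [|p pA le] := hull_extent (h := fun p => (p.2 : nat)%:R - x.2) bw.
  by under eq_bigr do rewrite mulrBr; rewrite sumrB -mulr_suml w1 mul1r -wy subrr.
by exists p; rewrite // -subr_le0.
Qed.

Lemma hull_above A (x : R * R) : hull A x -> exists2 p, p \in A & x.2 <= (p.2 : nat)%:R.
Proof.
move=> /hullP[w bw]; have [_ _ w1 _ wy] := bw.
have [|p pA le] := hull_extent (h := fun p => x.2 - (p.2 : nat)%:R) bw.
  by under eq_bigr do rewrite mulrBr; rewrite sumrB -mulr_suml w1 mul1r -wy subrr.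
by exists p; rewrite // -subr_le0.
Qed.

Lemma vertical_hull A (x : R * R) p q : p \in A -> q \in A -> p.1 = q.1 ->
  x.1 = (p.1 : nat)%:R -> (p.2 : nat)%:R <= x.2 <= (q.2 : nat)%:R -> hull A x.
Proof.
move=> pA qA pq xp /andP[px xq]; have [e|ne] := eqVneq ((p.2 : nat)%:R : R) (q.2 : nat)%:R.
  rewrite (_ : x = coord R p); first exact: hull_vertex.
  rewrite [LHS]surjective_pairing xp; congr pair; apply/le_anti; rewrite px andbT.
  by rewrite (le_trans xq) // e.
have d0 : 0 < (q.2 : nat)%:R - (p.2 : nat)%:R :> R.
  by rewrite subr_gt0 lt_neqAle ne (le_trans px).
pose t := (x.2 - (p.2 : nat)%:R) / ((q.2 : nat)%:R - (p.2 : nat)%:R).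
have -> : x = lerp t (coord R p) (coord R q).
  rewrite [LHS]surjective_pairing /lerp /= -pq subrr mulr0 addr0 xp /t divfK ?gt_eqF //.
  by congr pair; ring.
apply: hull_lerp; [|exact: hull_vertex|exact: hull_vertex].
by rewrite /t divr_ge0 ?(ltW d0) ?subr_ge0 //= ler_pdivrMr // mul1r lerD2r.
Qed.

Lemma not_vertical T A i : is_lattice_triangulation R T -> A \in T ->
  exists2 p, p \in A & p.1 != i.
Proof.
move=> triT AT; have [a [b [c [ab ac bc AE]]]] := cards3P (tri_card triT AT).
have [p /andP[pA pi]|no] := pickP [pred p | (p \in A) && (p.1 != i)]; first by exists p.
have := tri_indep triT AT; rewrite AE => /(indep_orient ab ac bc).
have all p : p \in A -> p.1 = i by move=> pA; have /= := no p; rewrite pA => /negbFE/eqP.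
rewrite /orient /= !all ?AE ?inE ?eqxx ?orbT //.
by rewrite !subrr mul0r mulr0 subrr eqxx.
Qed.

End Types.

(** * Gluing two rectangles along a vertical side *)

Section Glue.
Variables (R : realType) (m1 m2 n : nat).
Local Notation point1 := (lattice_point m1 n).
Local Notation point2 := (lattice_point m2 n).
Local Notation point := (lattice_point (m1 + m2) n).

Definition inl_point (p : point1) : point := (inord p.1, p.2).
Definition inr_point (p : point2) : point := (inord (m1 + p.1), p.2).
Definition shift (t : R) (x : R * R) : R * R := (t + x.1, x.2).

Lemma inl_point1 p : (inl_point p).1 = p.1 :> nat.
Proof. by rewrite inordK // ltnS (leq_trans (leq_ord _)) // leq_addr. Qed.

Lemma inr_point1 p : (inr_point p).1 = (m1 + p.1)%N :> nat.
Proof. by rewrite inordK // ltnS leq_add2l leq_ord. Qed.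

Lemma shift_affine t : affine_map (shift t).
Proof.
by exists t, 1, 0, 0, 0, 1 => x; rewrite /shift /affine_fun; congr pair; ring.
Qed.

Lemma inl_affine : lattice_affine inl_point (shift 0) (shift 0).
Proof.
split; [exact: shift_affine|exact: shift_affine| | |].
- by move=> [x y]; rewrite /shift /= !add0r.
- by move=> [x y]; rewrite /shift /= !add0r.
- by move=> p; rewrite /shift /coord inl_point1 /= add0r.
Qed.

Lemma inr_affine : lattice_affine inr_point (shift m1%:R) (shift (- m1%:R)).
Proof.
split; [exact: shift_affine|exact: shift_affine| | |].
- by move=> [x y]; rewrite /shift /= addKr.
- by move=> [x y]; rewrite /shift /= addNKr.
- by move=> p; rewrite /shift /coord inr_point1 /= natrD.
Qed.

Definition glue (T1 : {set {set point1}}) (T2 : {set {set point2}}) : {set {set point}} :=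
  image_tri inl_point T1 :|: image_tri inr_point T2.

End Glue.
Arguments inl_point {m1} m2 {n} p.
Arguments inr_point m1 {m2 n} p.

Section GlueTriangulation.
Variables (R : realType) (m1 m2 n : nat).
Local Notation point1 := (lattice_point m1 n).
Local Notation point2 := (lattice_point m2 n).

Lemma inl_inr (v : 'I_n.+1) :
  inl_point m2 (ord_max, v) = inr_point m1 (ord0, v) :> lattice_point (m1 + m2) n.
Proof. by congr pair; apply: val_inj; rewrite /= addn0. Qed.

(** The point [y] is on the seam. Take seam vertices of [A] and of [B] below it: the higher one is a
    vertex of both, because equal types make it a used point of the other piece and it lies in the
    other triangle. The same holds for the lower of two seam vertices above [y], and [y] is between
    these two common vertices. *)
Lemma glue_face (T1 : {set {set point1}}) (T2 : {set {set point2}})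
    (A : {set point1}) (B : {set point2}) (y : R * R) :
  is_lattice_triangulation R T1 -> is_lattice_triangulation R T2 ->
  right_type T1 = left_type T2 -> A \in T1 -> B \in T2 ->
  hull (inl_point m2 @: A) y -> hull (inr_point m1 @: B) y ->
  hull ((inl_point m2 @: A) :&: (inr_point m1 @: B)) y.
Proof.
move=> tri1 tri2 type AT BT /(hull_image (inl_affine R m1 m2 n)) hA
  /(hull_image (inr_affine R m1 m2 n)) hB.
have y1 : y.1 = m1%:R.
  have [/andP[_ +] _] := hull_rect hA; have [/andP[+ _] _] := hull_rect hB.
  by rewrite /shift /=; lra.
have hA' : hull [set p in A | p.1 == ord_max] (shift 0 y).
  by apply: right_face hA; rewrite /shift /= add0r.
have hB' : hull [set p in B | p.1 == ord0] (shift (- m1%:R) y).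
  by apply: left_face hB; rewrite /shift /= y1 addNr.
have fromB a a' v : (ord_max, a) \in A -> (ord_max, a') \in A -> (ord0, v) \in B ->
    ((a : nat)%:R : R) <= ((v : nat)%:R : R) <= (a' : nat)%:R -> (ord_max, v) \in A.
  move=> aA aA' vB av; apply: (tri_vertex tri1 AT).
    suff : v \in right_type T1 by rewrite inE.
    by rewrite type inE; apply/bigcupP; exists B.
  exact: (vertical_hull aA aA').
have fromA b b' v : (ord0, b) \in B -> (ord0, b') \in B -> (ord_max, v) \in A ->
    ((b : nat)%:R : R) <= ((v : nat)%:R : R) <= (b' : nat)%:R -> (ord0, v) \in B.
  move=> bB bB' vA bv; apply: (tri_vertex tri2 BT).
    suff : v \in left_type T2 by rewrite inE.
    by rewrite -type inE; apply/bigcupP; exists A.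
  exact: (vertical_hull bB bB').
have [[i1 a1] + /= a1y] := hull_below hA'; rewrite inE => /andP[a1A /eqP /= e1]; rewrite {i1}e1 in a1A.
have [[i2 a2] + /= a2y] := hull_above hA'; rewrite inE => /andP[a2A /eqP /= e2]; rewrite {i2}e2 in a2A.
have [[i3 b1] + /= b1y] := hull_below hB'; rewrite inE => /andP[b1B /eqP /= e3]; rewrite {i3}e3 in b1B.
have [[i4 b2] + /= b2y] := hull_above hB'; rewrite inE => /andP[b2B /eqP /= e4]; rewrite {i4}e4 in b2B.
have inI v : (ord_max, v) \in A -> (ord0, v) \in B ->
    inl_point m2 (ord_max, v) \in (inl_point m2 @: A) :&: (inr_point m1 @: B).
  by move=> vA vB; rewrite inE imset_f //= inl_inr imset_f.
have [lo [loA loB loy]] : exists lo, [/\ (ord_max, lo) \in A, (ord0, lo) \in B &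
    ((lo : nat)%:R : R) <= y.2].
  have [le|/ltW le] := leP ((a1 : nat)%:R : R) (b1 : nat)%:R.
    by exists b1; split=> //; apply: (fromB a1 a2) => //; rewrite le (le_trans b1y).
  by exists a1; split=> //; apply: (fromA b1 b2) => //; rewrite le (le_trans a1y).
have [hi [hiA hiB hiy]] : exists hi, [/\ (ord_max, hi) \in A, (ord0, hi) \in B &
    y.2 <= ((hi : nat)%:R : R)].
  have [le|/ltW le] := leP ((a2 : nat)%:R : R) (b2 : nat)%:R.
    by exists a2; split=> //; apply: (fromA b1 b2) => //; rewrite le (le_trans b1y).
  by exists b2; split=> //; apply: (fromB a1 a2) => //; rewrite le (le_trans a1y).
apply: (vertical_hull (inI _ loA loB) (inI _ hiA hiB)) => //=.
  by rewrite y1 inordK // ltnS leq_addr.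
by rewrite loy.
Qed.

Lemma glue_triangulation (T1 : {set {set point1}}) (T2 : {set {set point2}}) :
  is_lattice_triangulation R T1 -> is_lattice_triangulation R T2 ->
  right_type T1 = left_type T2 -> is_lattice_triangulation R (glue T1 T2).
Proof.
move=> tri1 tri2 type; have al := inl_affine R m1 m2 n; have ar := inr_affine R m1 m2 n.
split=> [A|| A B].
- by rewrite in_setU => /orP[]; [apply: (image_triangle al)|apply: (image_triangle ar)].
- apply/seteqP; split=> [y [A _]|y [/andP[y0 ym] y2]]; first exact: hull_rect.
  have [le|/ltW le] := leP y.1 m1%:R.
    have [|A AT hA] := tri_cover tri1 (x := shift 0 y).
      by rewrite /rectangle /shift /= add0r y0 le.
    exists (inl_point m2 @: A); last exact/(hull_image al).
    by rewrite /= in_setU imset_f.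
  have [|A AT hA] := tri_cover tri2 (x := shift (- m1%:R) y).
    rewrite /rectangle /shift /=; split=> //; rewrite natrD in ym.
    by apply/andP; split; lra.
  exists (inr_point m1 @: A); last exact/(hull_image ar).
  by rewrite /= in_setU (imset_f _ AT) orbT.
move=> As Bs; apply/seteqP; split=> [y [hA hB]|y h]; last first.
  by split; apply: hull_sub h; rewrite ?subsetIl ?subsetIr.
move: As Bs; rewrite !in_setU => /orP[As|As] /orP[Bs|Bs].
- exact: (image_face al tri1 As Bs).
- case/imsetP: As hA => A' AT -> hA; case/imsetP: Bs hB => B' BT -> hB.
  exact: (glue_face tri1 tri2 type AT BT).
- case/imsetP: As hA => A' AT -> hA; case/imsetP: Bs hB => B' BT -> hB.
  by rewrite setIC; apply: (glue_face tri1 tri2 type BT AT).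
- exact: (image_face ar tri2 As Bs).
Qed.

Lemma cover_glue (T1 : {set {set point1}}) (T2 : {set {set point2}}) :
  cover (glue T1 T2) = (inl_point m2 @: cover T1) :|: (inr_point m1 @: cover T2).
Proof. by rewrite /cover bigcup_setU -!/(cover _) !cover_image. Qed.

Lemma left_type_glue (T1 : {set {set point1}}) (T2 : {set {set point2}}) :
  (0 < m1)%N -> left_type (glue T1 T2) = left_type T1.
Proof.
move=> m10; apply/setP => v; rewrite !in_set cover_glue in_setU.
have -> : ((ord0, v) \in inr_point m1 @: cover T2) = false.
  apply/negbTE/imsetP => -[p _ e]; have := inr_point1 m1 p; rewrite -e /=.
  by move/eqP; rewrite eq_sym addn_eq0 (gtn_eqF m10).
rewrite orbF; apply/imsetP/idP => [[p pT e]|vT].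
  rewrite (_ : (ord0, v) = p) //; rewrite (surjective_pairing p).
  have e1 : p.1 = ord0 by apply: val_inj; have := inl_point1 m2 p; rewrite -e.
  by rewrite e1; congr pair; have := congr1 snd e.
by exists (ord0, v) => //; congr pair; apply: val_inj; rewrite /= inordK.
Qed.

(** By [not_vertical] a triangle of the right piece has a vertex off the seam, so no triangle comes
    from both pieces and each piece can be read off the union. *)
Lemma glue_inj (T1 T1' : {set {set point1}}) (T2 T2' : {set {set point2}}) :
  is_lattice_triangulation R T1 -> is_lattice_triangulation R T2 ->
  is_lattice_triangulation R T1' -> is_lattice_triangulation R T2' ->
  glue T1 T2 = glue T1' T2' -> T1 = T1' /\ T2 = T2'.
Proof.
move=> tri1 tri2 tri1' tri2'.
have il := lattice_affine_inj (inl_affine R m1 m2 n).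
have ir := lattice_affine_inj (inr_affine R m1 m2 n).
have disj (A : {set point1}) (B : {set point2}) U V :
    is_lattice_triangulation R U -> is_lattice_triangulation R V ->
    A \in U -> B \in V -> inl_point m2 @: A = inr_point m1 @: B -> False.
  move=> triU triV AU BV e; have [q qB q0] := not_vertical ord0 triV BV.
  have : inr_point m1 q \in inl_point m2 @: A by rewrite e imset_f.
  case/imsetP => p pA e'; have := inl_point1 m2 p; rewrite -e' inr_point1.
  have := ltn_ord p.1; rewrite ltnS => pm e1; move: pm; rewrite -e1 -[leqRHS]addn0 leq_add2l leqn0.
  by move=> /eqP q0'; case/eqP: q0; apply: val_inj.
have recl (U : {set {set point1}}) (V : {set {set point2}}) A :
    is_lattice_triangulation R U -> is_lattice_triangulation R V ->
    A \in U <-> inl_point m2 @: A \in glue U V /\ exists2 W, is_lattice_triangulation R W & A \in W.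
  move=> triU triV; split=> [AU|[+ [W triW AW]]]; first by rewrite in_setU imset_f //; split=> //; exists U.
  rewrite in_setU => /orP[/imsetP[A' AU e]|/imsetP[B BV e]].
    by rewrite (imset_inj il e).
  by case: (disj A B W V).
have recr (U : {set {set point1}}) (V : {set {set point2}}) B :
    is_lattice_triangulation R U -> is_lattice_triangulation R V ->
    B \in V <-> inr_point m1 @: B \in glue U V /\ exists2 W, is_lattice_triangulation R W & B \in W.
  move=> triU triV; split=> [BV|[+ [W triW BW]]].
    by rewrite in_setU (imset_f _ BV) orbT; split=> //; exists V.
  rewrite in_setU => /orP[/imsetP[A AU e]|/imsetP[B' BV e]].
    by case: (disj A B U W).
  by rewrite (imset_inj ir e).
move=> e; split; apply/setP => A; apply/idP/idP.
- by move=> /(recl _ T2 _ tri1 tri2)[+ ex]; rewrite e => h; apply/(recl _ T2' _ tri1' tri2').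
- by move=> /(recl _ T2' _ tri1' tri2')[+ ex]; rewrite -e => h; apply/(recl _ T2 _ tri1 tri2).
- by move=> /(recr T1 _ _ tri1 tri2)[+ ex]; rewrite e => h; apply/(recr T1' _ _ tri1' tri2').
- by move=> /(recr T1' _ _ tri1' tri2')[+ ex]; rewrite -e => h; apply/(recr T1 _ _ tri1 tri2).
Qed.

End GlueTriangulation.

(** * Realizing types and counting triangulations by type *)

Section Existence.
Variables (R : realType) (m n : nat).
Local Notation point := (lattice_point m n).
Implicit Types (T : {set {set point}}) (S : {set point}).

Lemma extend_triangulation T S : is_lattice_triangulation R T -> cover T \subset S ->
  exists2 T', is_lattice_triangulation R T' & cover T' = S.
Proof.
move Nk : #|S :\: cover T| => k; elim: k T Nk => [|k IH] T Nk triT sTS.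
  exists T => //; apply/eqP; rewrite eqEsubset sTS /= -setD_eq0.
  by move/eqP: Nk; rewrite cards_eq0.
have /set0Pn[p] : S :\: cover T != set0 by rewrite -cards_eq0 Nk.
rewrite in_setD => /andP[pT pS]; apply: (IH (stellar R T p)).
- rewrite stellar_cover // setUC -setDDl; have := cardsD1 p (S :\: cover T).
  by rewrite Nk in_setD pT pS => -[].
- exact: stellar_tri.
- by rewrite stellar_cover // subUset sub1set pS.
Qed.

Lemma corner_triangulation : (0 < m)%N -> (0 < n)%N ->
  exists2 T : {set {set point}}, is_lattice_triangulation R T &
    cover T = [set (ord_max, ord0); (ord0, ord_max); (ord0, ord0); (ord_max, ord_max)].
Proof.
move=> m0 n0; have m0R : 0 < m%:R :> R by rewrite ltr0n.
have n0R : 0 < n%:R :> R by rewrite ltr0n.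
have ne k : (0 < k)%N -> (ord0 == ord_max :> 'I_k.+1) = false.
  by move=> k0; apply/eqP => /(congr1 val) /= e; rewrite -e in k0.
have ne' k : (0 < k)%N -> (ord_max == ord0 :> 'I_k.+1) = false by rewrite eq_sym; apply: ne.
pose a : point := (ord0, ord0); pose b : point := (ord_max, ord0).
pose c : point := (ord0, ord_max); pose d : point := (ord_max, ord_max).
have [ab ac ad] : [/\ b != a, c != a & d != a] by rewrite !xpair_eqE !ne'.
have [bc bd cd] : [/\ b != c, b != d & c != d] by rewrite !xpair_eqE !ne ?ne' ?andbF.
have orA : orient (coord R b) (coord R c) (coord R a) = m%:R * n%:R.
  by rewrite /orient /=; ring.
have orD : orient (coord R b) (coord R c) (coord R d) = - (m%:R * n%:R).
  by rewrite /orient /=; ring.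
have mn0 : 0 < m%:R * n%:R :> R by rewrite mulr_gt0.
have oA0 : orient (coord R b) (coord R c) (coord R a) != 0 by rewrite orA gt_eqF.
have oD0 : orient (coord R b) (coord R c) (coord R d) != 0 by rewrite orD oppr_eq0 gt_eqF.
have hullA (x : R * R) : hull [set b; c; a] x <->
    [/\ 0 <= x.1, 0 <= x.2 & m%:R * x.2 + n%:R * x.1 <= m%:R * n%:R].
  have H := tri_hullP x bc ab ac oA0; rewrite orA in H; apply: (iff_trans H).
  rewrite !pmulr_lge0 ?invr_gt0 //.
  have -> : orient x (coord R c) (coord R a) = n%:R * x.1 by rewrite /orient /=; ring.
  have -> : orient (coord R b) x (coord R a) = m%:R * x.2 by rewrite /orient /=; ring.
  have -> : orient (coord R b) (coord R c) x = m%:R * n%:R - (m%:R * x.2 + n%:R * x.1).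
    by rewrite /orient /=; ring.
  by rewrite !pmulr_rge0 // subr_ge0.
have hullD (x : R * R) : hull [set b; c; d] x <->
    [/\ x.2 <= n%:R, x.1 <= m%:R & m%:R * n%:R <= m%:R * x.2 + n%:R * x.1].
  have H := tri_hullP x bc bd cd oD0; rewrite orD in H; apply: (iff_trans H).
  rewrite invrN !mulrN -!mulNr !pmulr_lge0 ?invr_gt0 //.
  have -> : - orient x (coord R c) (coord R d) = m%:R * (n%:R - x.2) by rewrite /orient /=; ring.
  have -> : - orient (coord R b) x (coord R d) = n%:R * (m%:R - x.1) by rewrite /orient /=; ring.
  have -> : - orient (coord R b) (coord R c) x = (m%:R * x.2 + n%:R * x.1) - m%:R * n%:R.
    by rewrite /orient /=; ring.
  by rewrite !pmulr_rge0 // !subr_ge0.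
have hullBC (x : R * R) : hull [set b; c; a] x -> hull [set b; c; d] x ->
    hull ([set b; c; a] :&: [set b; c; d]) x.
  move=> /hullA[x1 x2 le1] /hullD[x2n x1m le2].
  have e : m%:R * x.2 + n%:R * x.1 = m%:R * n%:R by apply/le_anti; rewrite le1.
  have -> : x = lerp (x.2 / n%:R) (coord R b) (coord R c).
    rewrite [LHS]surjective_pairing /lerp /= subr0 !add0r divfK ?gt_eqF //; congr pair.
    apply: (mulfI (x := n%:R)); first by rewrite gt_eqF.
    rewrite mulrDr [X in _ = _ + X]mulrA [n%:R * (_ / _)]mulrC divfK ?gt_eqF //.
    by apply/eqP; rewrite -subr_eq0; apply/eqP; move: e; clear; lra.
  apply: hull_lerp; first by rewrite divr_ge0 ?(ltW n0R) //= ler_pdivrMr // mul1r.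
    by apply: hull_vertex; rewrite !inE eqxx.
  by apply: hull_vertex; rewrite !inE eqxx !orbT.
exists [set [set b; c; a]; [set b; c; d]]; last first.
  rewrite /cover bigcup_setU !big_set1.
  by apply/setP => p; rewrite !inE; do 4 case: (p == _).
have tri u : u != b -> u != c -> b != c ->
    orient (coord R b) (coord R c) (coord R u) != 0 -> is_triangle R [set b; c; u].
  move=> ub uc _ o0; split; last by apply: orient_indep o0; rewrite // eq_sym.
  by rewrite setUC cardsU1 cards2 !inE negb_or ub uc bc.
split=> [A|| A B].
- by rewrite in_set2 => /orP[]/eqP ->; apply: tri; rewrite // eq_sym.
- apply/seteqP; split=> [y [A _]|y [/andP[y1 y1m] /andP[y2 y2n]]]; first exact: hull_rect.
  have [le|/ltW le] := leP (m%:R * y.2 + n%:R * y.1) (m%:R * n%:R).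
    by exists [set b; c; a]; [rewrite /= set21|apply/hullA].
  by exists [set b; c; d]; [rewrite /= set22|apply/hullD].
rewrite !in_set2 => As Bs; apply/seteqP; split=> [y [hA hB]|y h]; last first.
  by split; apply: hull_sub h; rewrite ?subsetIl ?subsetIr.
move: hA hB; case/orP: As => /eqP ->; case/orP: Bs => /eqP -> hA hB.
- by rewrite setIid.
- exact: hullBC.
- by rewrite setIC; apply: hullBC.
- by rewrite setIid.
Qed.

Lemma left_type_corners T : is_lattice_triangulation R T ->
  ord0 \in left_type T /\ ord_max \in left_type T.
Proof.
move=> triT; split; rewrite in_set.
- have [A AT hA] := tri_cover triT (coord_rect R (ord0, ord0)).
  have [//|[i j] + /=] := hull_below (left_face _ hA).
  rewrite inE /= ler_nat leqn0 => /andP[pA /eqP i0] j0.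
  have {}j0 : j = ord0 by apply: val_inj; apply/eqP.
  by apply/bigcupP; exists A => //; rewrite -{1}i0 -j0.
have [A AT hA] := tri_cover triT (coord_rect R (ord0, ord_max)).
have [//|[i j] + /=] := hull_above (left_face _ hA).
rewrite inE /= ler_nat => /andP[pA /eqP i0] j0.
have {}j0 : j = ord_max by apply: val_inj; apply/eqP; rewrite eqn_leq j0 leq_ord.
by apply/bigcupP; exists A => //; rewrite -{1}i0 -j0.
Qed.

Lemma left_type_mirror T : left_type (image_tri (@mirror m n) T) = right_type T.
Proof.
apply/setP => y; rewrite !in_set cover_image.
have -> : (ord0, y) = mirror (ord_max : 'I_m.+1, y) :> point.
  by congr pair; apply: val_inj; rewrite /= subnn.
by rewrite mem_imset //; exact: lattice_affine_inj (mirror_affine R m n).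
Qed.

Lemma right_type_mirror T : right_type (image_tri (@mirror m n) T) = left_type T.
Proof.
apply/setP => y; rewrite !in_set cover_image.
have -> : (ord_max, y) = mirror (ord0 : 'I_m.+1, y) :> point.
  by congr pair; apply: val_inj; rewrite /= subn1.
by rewrite mem_imset //; exact: lattice_affine_inj (mirror_affine R m n).
Qed.

Definition left_typed (s : {set 'I_n.+1}) : {set {set {set point}}} :=
  [set T | `[< is_lattice_triangulation R T >] && (left_type T == s)].

Definition typed (s s' : {set 'I_n.+1}) : {set {set {set point}}} :=
  [set T in left_typed s | right_type T == s'].

Lemma left_typedP s T :
  reflect (is_lattice_triangulation R T /\ left_type T = s) (T \in left_typed s).
Proof.
by rewrite in_set; apply: (iffP andP) => [[/asboolP ? /eqP]|[/asboolP ? /eqP]].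
Qed.

Lemma typedP s s' T : reflect
  [/\ is_lattice_triangulation R T, left_type T = s & right_type T = s'] (T \in typed s s').
Proof.
rewrite in_set; apply: (iffP andP) => [[/left_typedP[? ?] /eqP]|[? ? /eqP]] //.
by split=> //; apply/left_typedP.
Qed.

Lemma left_typed_le s : (#|left_typed s| <= fnp R m n)%N.
Proof. by apply: subset_leq_card; apply/subsetP => T /left_typedP[triT _]; apply/asboolP. Qed.

(** Stellar insertions into the triangulation with two triangles produce one that uses all points
    off the left side and exactly those of [s] on it. *)
Lemma left_typed_gt0 (s : {set 'I_n.+1}) : (0 < m)%N -> (0 < n)%N -> ord0 \in s -> ord_max \in s ->
  (0 < #|left_typed s|)%N.
Proof.
move=> m0 n0 s0 s1; have [T triT cT] := corner_triangulation m0 n0.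
have ne : (ord_max == ord0 :> 'I_m.+1) = false.
  by apply/eqP => /(congr1 val) /= e; rewrite e in m0.
have [|T' triT' cT'] := @extend_triangulation T [set p | (p.1 == ord0) ==> (p.2 \in s)] triT.
  rewrite cT; apply/subsetP => p; rewrite !in_setU !in_set1 in_set.
  by move=> /orP[/orP[/orP[]|]|] /eqP -> /=; rewrite ?ne ?eqxx.
apply/card_gt0P; exists T'; apply/left_typedP; split=> //.
by apply/setP => y; rewrite in_set cT' in_set eqxx.
Qed.

Lemma fnp_gt0 : (0 < m)%N -> (0 < n)%N -> (0 < fnp R m n)%N.
Proof.
move=> m0 n0; apply: leq_trans (left_typed_le setT).
by apply: left_typed_gt0; rewrite ?in_setT.
Qed.

Lemma typed_mirror s s' : (#|typed s s'| <= #|typed s' s|)%N.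
Proof.
rewrite -(card_imset _ (image_tri_inj (mirror_affine R m n))).
apply: subset_leq_card; apply/subsetP => _ /imsetP[T /typedP[triT lT rT] ->].
by apply/typedP; rewrite left_type_mirror right_type_mirror; split=> //; exact: mirror_triangulation.
Qed.

Lemma fnp_typed : exists s s', (fnp R m n <= 4 ^ n.+1 * #|typed s s'|)%N.
Proof.
pose c (ss : {set 'I_n.+1} * {set 'I_n.+1}) := #|typed ss.1 ss.2|.
have [[s s'] _ cmax] := @arg_maxnP _ (set0, set0) predT c isT.
exists s, s'; have -> : (4 ^ n.+1 = #|{: {set 'I_n.+1} * {set 'I_n.+1}}|)%N.
  by rewrite card_prod -!cardsT -powersetT !card_powerset cardsT card_ord -expnMn.
rewrite -sum_nat_const.
have -> : fnp R m n = (\sum_ss c ss)%N.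
  rewrite /fnp -sum1_card (partition_big
    (fun T : {set {set point}} => (left_type T, right_type T)) xpredT) //=.
  apply: eq_bigr => -[t t'] _; rewrite sum1dep_card /c /typed /left_typed /=; apply: eq_card => T.
  by rewrite !in_set xpair_eqE andbA.
by apply: leq_sum => ss _; exact: cmax.
Qed.

End Existence.

Lemma glue_count (R : realType) m1 m2 n s s' : (0 < m1)%N ->
  (#|typed R m1 s s'| * #|left_typed R m2 s'| <= #|left_typed R (m1 + m2) (n := n) s|)%N.
Proof.
move=> m10; rewrite -cardsX.
rewrite -(card_in_imset (f := fun TT => glue TT.1 TT.2)); last first.
  move=> [T1 T2] [T1' T2'] /=; rewrite !in_setX /=.
  move=> /andP[/typedP[? _ _] /left_typedP[? _]] /andP[/typedP[? _ _] /left_typedP[? _]].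
  by move=> e; have [||||-> -> //] := @glue_inj R _ _ _ T1 T1' T2 T2' _ _ _ _ e.
apply: subset_leq_card; apply/subsetP => _ /imsetP[[T1 T2] + ->]; rewrite in_setX /=.
move=> /andP[/typedP[tri1 l1 r1] /left_typedP[tri2 l2]].
apply/left_typedP; rewrite left_type_glue // l1; split=> //.
by apply: glue_triangulation => //; rewrite r1.
Qed.

(* The copies are glued with alternating orientations. *)
Lemma fnp_supermul (R : realType) m n r k : (0 < m)%N -> (0 < n)%N -> (0 < r)%N ->
  (fnp R m n ^ k <= (4 ^ n.+1) ^ k * fnp R (k * m + r) n)%N.
Proof.
move=> m0 n0 r0; have [s [s' le]] := fnp_typed R m n.
have : (0 < #|typed R m s s'|)%N.
  by have := fnp_gt0 R m0 n0; move: le; case: #|typed R m s s'| => //; rewrite muln0; case: fnp.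
case/card_gt0P => T /typedP[triT lT rT].
have [] := left_type_corners triT; rewrite lT => s0 s1.
have [] := left_type_corners (mirror_triangulation triT); rewrite (left_type_mirror R) rT => s0' s1'.
(* Behind a piece of type [(t, t')] the rest has left type [t'], and its first piece is taken of
   type [(t', t)]; reflection shows that there are as many of these. *)
have key j (t t' : {set 'I_n.+1}) : ord0 \in t -> ord_max \in t -> ord0 \in t' -> ord_max \in t' ->
    (#|typed R m t t'| ^ j <= #|left_typed R (j * m + r) (n := n) t|)%N.
  elim: j t t' => [|j IH] t t' t0 t1 t0' t1'; first by rewrite expn0 left_typed_gt0.
  rewrite expnS mulSn -addnA; apply: leq_trans (glue_count R (j * m + r) t t' m0).
  rewrite leq_mul2l (leq_trans _ (IH t' t _ _ _ _)) ?orbT //.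
  by case: (j) => // i; rewrite leq_exp2r // typed_mirror.
apply: leq_trans (_ : (4 ^ n.+1 * #|typed R m s s'|) ^ k <= _)%N.
  by case: k => // k; rewrite leq_exp2r.
rewrite expnMn leq_mul2l (leq_trans (key k s s' _ _ _ _)) ?orbT //.
exact: left_typed_le.
Qed.

(** * The limit *)

Section Limit.
Variable R : realType.
Implicit Types (x : R^nat) (D e : R).

Lemma div_nat_small D e : 0 < e -> exists N0 : nat, forall N : nat, (N0 < N)%N -> D / N%:R <= e.
Proof.
move=> e0; exists (Num.bound (`|D| / e)) => N ltN.
have N0 : 0 < N%:R :> R by rewrite ltr0n (leq_ltn_trans _ ltN).
have := archi_boundP (divr_ge0 (normr_ge0 D) (ltW e0)).
rewrite ltr_pdivrMr // => h; rewrite ler_pdivrMr // (le_trans (ler_norm D)) // ltW //.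
by apply: (lt_le_trans h); rewrite mulrC ler_pM2l // ler_nat ltnW.
Qed.

(* A two-dimensional Fekete lemma: the limit is [sup_n (x_n - c / n)]. *)
Lemma fekete_cvg x (c M K : R) : 0 <= c ->
  (forall n, (0 < n)%N -> exists D, forall N, (0 < N)%N -> x n - c / n%:R - D / N%:R <= x N) ->
  (forall N, (0 < N)%N -> x N <= M + K / N%:R) ->
  exists2 L, (x N @[N --> \oo] --> L)%classic & L <= M.
Proof.
move=> c0 xlow xup; pose S : classical_sets.set R := fun u => exists2 n, (0 < n)%N & u = x n - c / n%:R.
have ubM : ubound S M.
  move=> _ [n n0 ->]; have [D xD] := xlow n n0.
  apply/ler_addgt0Pr => e e0; have [N0 hN0] := div_nat_small (D + K) e0.
  have := xD N0.+1 isT; have := xup N0.+1 isT; have := hN0 N0.+1 (ltnSn _).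
  rewrite mulrDl; move: (_ / N0.+1%:R) (_ / N0.+1%:R) (x _ - _) => u v w; clear; lra.
have S0 : classical_sets.nonempty S by exists (x 1%N - c / 1%:R), 1%N.
have supS : has_sup S by split=> //; exists M.
exists (sup S); last exact: ge_sup.
apply/cvgrPdist_le => e e0.
have [_ [n n0 ->] ln] := sup_adherent (divr_gt0 e0 (ltr0n R 2)) supS.
have [D xD] := xlow n n0.
have [N1 hN1] := div_nat_small D (divr_gt0 e0 (ltr0n R 2)).
have [N2 hN2] := div_nat_small c e0.
exists (maxn N1 N2).+1 => //= N; rewrite /= gtn_max => /andP[l1 l2].
have N0 : (0 < N)%N by apply: leq_ltn_trans l1.
have h1 := hN1 N l1; have h2 := hN2 N l2; have h3 := xD N N0.
have h4 : x N - c / N%:R <= sup S by apply: sup_upper_bound => //; exists N.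
rewrite distrC ler_distl; move: h1 h2 h3 h4 ln.
move: (x n - _) (_ / N%:R) (_ / N%:R) (sup S) (x N) => ? ? ? ? ?; clear; lra.
Qed.

Lemma ln2_gt0 : 0 < ln 2 :> R.
Proof. by rewrite ln_gt0 // ltr1n. Qed.

Lemma log2_le (a b : nat) : (0 < a)%N -> (a <= b)%N -> log2 a%:R <= log2 b%:R :> R.
Proof.
move=> a0 ab; rewrite /log2 ler_pM2r ?invr_gt0 ?ln2_gt0 // ler_ln ?posrE ?ltr0n ?ler_nat //.
exact: leq_trans ab.
Qed.

Lemma log2M (a b : nat) : (0 < a)%N -> (0 < b)%N ->
  log2 (a * b)%:R = log2 a%:R + log2 b%:R :> R.
Proof. by move=> a0 b0; rewrite /log2 natrM lnM ?posrE ?ltr0n // mulrDl. Qed.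

Lemma log2X (a k : nat) : (0 < a)%N -> log2 (a ^ k)%:R = k%:R * log2 a%:R :> R.
Proof. by move=> a0; rewrite /log2 natrX lnXn ?ltr0n // -[X in X / _]mulr_natl mulrA. Qed.

Lemma log2_2 : log2 2%:R = 1 :> R.
Proof. by rewrite /log2 divff ?gt_eqF ?ln2_gt0. Qed.

Lemma log2_3 : log2 3%:R <= 8 / 5 :> R.
Proof.
have := @log2_le (3 ^ 5) (2 ^ 8) isT isT; rewrite !log2X // log2_2; lra.
Qed.

(** The width is extended first and then, after a transposition, the height. The two terms in the
    exponent of 4 account for the types on sides of length [n] and of length [N]. *)
Lemma square_supermul n k r : (0 < n)%N -> (0 < r)%N ->
  (fnp R n n ^ (k * k) <=
    4 ^ (n.+1 * (k * k) + (k * n + r).+1 * k) * fnp R (k * n + r) (k * n + r))%N.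
Proof.
move=> n0 r0; set N := (k * n + r)%N.
have N0 : (0 < N)%N by rewrite addn_gt0 r0 orbT.
have h1 := fnp_supermul R k n0 n0 r0; have h2 := fnp_supermul R k n0 N0 r0.
rewrite -/N (fnp_transpose R N n) in h1; rewrite -/N in h2.
have pow a b : (a <= b)%N -> (a ^ k <= b ^ k)%N by case: (k) => // j; rewrite leq_exp2r.
rewrite expnD !expnM (leq_trans (pow _ _ h1)) // expnMn -mulnA.
by rewrite leq_mul2l h2 orbT.
Qed.

(** With [t], [u], [v] for [k / N], [1 / n], [1 / N], the value at [N] is at least
    [t ^+ 2 * b - 2 * t - 2 * t * v], and the value at [n] is [b * u ^+ 2 + 2 * u + 2 * u ^+ 2].
    Since [t <= u <= t + v] and [u <= 1], the terms [2 * u], [2 * u ^+ 2] and [2 * t] cost at most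
    [6 * u], and all others at most [2 * |b| + 2] times [v]. *)
Lemma np_capacity_low n : (0 < n)%N -> exists D, forall N, (0 < N)%N ->
  np_capacity_seq R n - 6 / n%:R - D / N%:R <= np_capacity_seq R N.
Proof.
move=> n0; pose b : R := log2 (fnp R n n)%:R - 2 * n%:R - 2.
exists (2 * `|b| + 2) => N N0.
(* Dividing [N.-1] instead of [N] keeps the last width [r] between 1 and [n]. *)
pose k := (N.-1 %/ n)%N; pose r := (N.-1 %% n).+1.
have NE : N = (k * n + r)%N by rewrite /r addnS -divn_eq prednK.
have rn : (r <= n)%N by rewrite ltn_pmod.
have := @square_supermul n k r n0 isT; rewrite -NE.
have f0 i : (0 < i)%N -> (0 < fnp R i i)%N by move=> i0; apply: fnp_gt0.
move/(log2_le _); rewrite expn_gt0 f0 // => /(_ isT).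
have log4 j : log2 (4 ^ j)%:R = 2 * j%:R :> R.
  by rewrite -[4%N]/(2 ^ 2)%N -expnM log2X // log2_2 mulr1 natrM.
rewrite log2M ?expn_gt0 ?f0 // log4 log2X ?f0 //.
rewrite natrD !natrM /np_capacity_seq -/b.
move: (log2 (fnp R N N)%:R) => c.
have n0R : 0 < n%:R :> R by rewrite ltr0n.
have N0R : 0 < N%:R :> R by rewrite ltr0n.
pose t : R := k%:R / N%:R; pose u : R := n%:R^-1; pose v : R := N%:R^-1.
have t0 : 0 <= t by rewrite divr_ge0.
have tu : t <= u.
  by rewrite ler_pdivrMr // mulrC ler_pdivlMr // -natrM ler_nat NE leq_addr.
have ut : u <= t + v.
  rewrite /t /u -[v]mul1r -mulrDl ler_pdivlMr // mulrC ler_pdivrMr // natr1 -natrM ler_nat NE.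
  by rewrite mulSn addnC leq_add2r.
have u1 : u <= 1 by rewrite invf_le1 // ler1n.
have v0 : 0 < v by rewrite invr_gt0.
move=> h.
have {}h : t ^+ 2 * b - 2 * t - 2 * t * v <= c / N%:R ^+ 2.
  rewrite ler_pdivlMr ?exprn_gt0 //.
  have -> : (t ^+ 2 * b - 2 * t - 2 * t * v) * N%:R ^+ 2 = k%:R ^+ 2 * b - 2 * k%:R * (N%:R + 1).
    rewrite /t /v; field; by rewrite gt_eqF.
  rewrite /b; move: h; rewrite -[n.+1%:R]natr1 -[N.+1%:R]natr1; move: (log2 _) => a; clear; lra.
apply: le_trans h; rewrite -/v -/u.
have -> : log2 (fnp R n n)%:R / n%:R ^+ 2 = b * u ^+ 2 + 2 * u + 2 * u ^+ 2.
  rewrite /b /u; field; by rewrite gt_eqF.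
have h1 : b * (u ^+ 2 - t ^+ 2) <= `|b| * (2 * v).
  rewrite (le_trans (ler_norm _)) // normrM ler_wpM2l // ger0_norm; last first.
    by rewrite subr_ge0 lerXn2r ?nnegrE // (le_trans t0).
  by move: t0 tu ut u1 v0; clear; nra.
have h2 : 0 <= u * (1 - u) by rewrite mulr_ge0 ?subr_ge0 // (le_trans t0).
have h3 : t * v <= v by rewrite ler_piMl ?(ltW v0) // (le_trans tu).
have e : u * (1 - u) = u - u ^+ 2 by ring.
have eb : b * (u ^+ 2 - t ^+ 2) = b * u ^+ 2 - t ^+ 2 * b by ring.
rewrite e in h2; rewrite eb in h1; pose B : R := `|b|; rewrite -/B in h1 *.
move: h1 h2 h3 tu v0; move: (b * _) (_ * b) B => x y B; clear; lra.
Qed.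

(** The exponent of 2 is [(2 N + 1)^2 - (N + 1)^2 = 3 N^2 + 2 N], and the power of 3 contributes at
    most [8/5 (N + 1)^2]. The lower terms [26/5 N + 8/5] are at most [7 N]. *)
Lemma np_capacity_up N : (0 < N)%N -> np_capacity_seq R N <= 23 / 5 + 7 / N%:R.
Proof.
move=> N0; have := log2_le (fnp_gt0 R N0 N0) (fnp_upper R N N).
rewrite log2M ?expn_gt0 // !log2X // log2_2 mulr1.
have N1R : 1 <= N%:R :> R by rewrite ler1n.
rewrite natrB; last by rewrite leq_mul // ltnS -addnn leq_addr.
have e1 : N.+1%:R = N%:R + 1 :> R by rewrite natr1.
have e2 : N.*2.+1%:R = 2 * N%:R + 1 :> R by rewrite -natr1 -mul2n natrM.
rewrite !natrM e1 e2 => h.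
rewrite /np_capacity_seq ler_pdivrMr ?exprn_gt0 // ?ltr0n // (le_trans h) //.
rewrite [leRHS]mulrDl (_ : 7 / N%:R * N%:R ^+ 2 = 7 * N%:R); last by field; rewrite gt_eqF // ltr0n.
have := ler_wpM2l (exprn_ge0 2 (addr_ge0 (ler0n R N) ler01)) log2_3.
move: (N%:R) (log2 3%:R) N1R; clear => z l; lra.
Qed.

End Limit.

Local Open Scope classical_set_scope.
Local Open Scope ring_scope.

Theorem proposition6p1 (R : realType) :
  [/\ cvgn (np_capacity_seq R),
      exists2 b : R,
        decimal9 R 4 735 820 221 <= b < decimal9 R 4 735 820 222 & cnp R <= b &
      cnp R < decimal9 R 4 735 820 222].
Proof.
have [||| L cL leL] := @fekete_cvg R (np_capacity_seq R) 6 (23 / 5) 7.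
- by [].
- exact: np_capacity_low.
- exact: np_capacity_up.
have cnpE : cnp R = L by apply: cvg_lim.
have lt9 : decimal9 R 4 735 820 221 < decimal9 R 4 735 820 222.
  by rewrite /decimal9 ltrD2l ltr_pM2r ?invr_gt0 ?exprn_gt0 // ltr_nat.
have le9 : cnp R <= decimal9 R 4 735 820 221.
  rewrite cnpE (le_trans leL) // /decimal9.
  (* The first block of decimals already decides: 600 against 735. *)
  have -> : 23 / 5 = 4 + 600%:R / 10 ^+ 3 :> R by lra.
  have le3 : 600%:R / 10 ^+ 3 <= 735%:R / 10 ^+ 3 :> R.
    by rewrite ler_pM2r ?invr_gt0 ?exprn_gt0 // ler_nat.
  rewrite -!(addrA (4 : R)) lerD2l (le_trans le3) // -addrA lerDl.
  by rewrite addr_ge0 ?divr_ge0 ?exprn_ge0 ?ler0n.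
split; first by apply: cvgP cL.
  by exists (decimal9 R 4 735 820 221) => //; rewrite lexx lt9.
exact: le_lt_trans le9 lt9.
Qed.
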